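(* Let $\mathcal{H}$ be a finite-dimensional complex Hilbert space, let $\Theta_1,\Theta_2\in H^\infty(\mathcal{L}(\mathcal{H}))$ be two pure inner functions, and let $X_{\Theta_1}:\widetilde{\mathcal{D}}_{\Theta_1}\to\mathcal{D}_{\Theta_1}$ and $X_{\Theta_2}:\widetilde{\mathcal{D}}_{\Theta_2}\to\mathcal{D}_{\Theta_2}$ be linear operators. Let $A:K_{\Theta_1}\to K_{\Theta_2}$ be a bounded linear operator. Then $A\in\mathcal{MT}(\Theta_1,\Theta_2)$ if and only if there exist bounded linear operators $B:\mathcal{D}_{\Theta_1}\to K_{\Theta_2}$ and $B':\mathcal{D}_{\Theta_2}\to K_{\Theta_1}$ such that $$A-S_{\Theta_2,X_{\Theta_2}}AS_{\Theta_1,X_{\Theta_1}}^*=BP_{\mathcal{D}_{\Theta_1}}+P_{\mathcal{D}_{\Theta_2}}B'^{*}.$$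
   Context: $\mathcal{H}$ is a finite-dimensional complex Hilbert space, $\mathcal{L}(\mathcal{H})$ is the algebra of linear operators on $\mathcal{H}$, $\mathbb{D}$ is the open unit disk, $\mathbb{T}$ the unit circle with normalized Lebesgue measure $m$. $L^2(\mathcal{H})$ is the Hilbert space of square-integrable $\mathcal{H}$-valued functions on $\mathbb{T}$, $H^2(\mathcal{H})\subset L^2(\mathcal{H})$ the Hardy space of functions whose Fourier coefficients with negative indices vanish; $H^\infty(\mathcal{H})$ the essentially bounded functions in $H^2(\mathcal{H})$. $L^2(\mathcal{L}(\mathcal{H}))$, $H^2(\mathcal{L}(\mathcal{H}))$, $H^\infty(\mathcal{L}(\mathcal{H}))$ are the analogous operator-valued spaces ($\mathcal{L}(\mathcal{H})$ with Hilbert–Schmidt norm for the $L^2$ spaces). Functions in Hardy spaces are identified with their analytic extensions to $\mathbb{D}$. An inner function is $\Theta\in H^\infty(\mathcal{L}(\mathcal{H}))$ whose boundary values $\Theta(z)$ are unitary for a.e. $z\in\mathbb{T}$; it is pure if $\|\Theta(0)\|<1$. The model space is $K_\Theta=H^2(\mathcal{H})\ominus\Theta H^2(\mathcal{H})$, $P_\Theta$ is the orthogonal projection of $L^2(\mathcal{H})$ onto $K_\Theta$, and $K_\Theta^\infty=K_\Theta\cap H^\infty(\mathcal{H})$, which is dense in $K_\Theta$. For $\Phi\in L^2(\mathcal{L}(\mathcal{H}))$, $A_\Phi^{\Theta_1,\Theta_2}f=P_{\Theta_2}(\Phi f)$ for $f\in K_{\Theta_1}^\infty$. If this densely defined operator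 is bounded it is identified with its bounded extension $K_{\Theta_1}\to K_{\Theta_2}$. $\mathcal{MT}(\Theta_1,\Theta_2)$ is the set of all such bounded operators $A_\Phi^{\Theta_1,\Theta_2}$, $\Phi\in L^2(\mathcal{L}(\mathcal{H}))$. The compressed shift on $K_\Theta$ is $S_\Theta f=P_\Theta(zf)$. Put $\mathcal{D}_\Theta=\{(I_{\mathcal{H}}-\Theta(z)\Theta(0)^* )x:\ x\in\mathcal{H}\}\subset K_\Theta$ and $\widetilde{\mathcal{D}}_\Theta=\{\bar z(\Theta(z)-\Theta(0))x:\ x\in\mathcal{H}\}\subset K_\Theta$, and let $P_{\mathcal{D}_\Theta}$, $P_{\widetilde{\mathcal{D}}_\Theta}$ be the orthogonal projections of $K_\Theta$ onto these subspaces. For a linear operator $X_\Theta:\widetilde{\mathcal{D}}_\Theta\to\mathcal{D}_\Theta$ define $\widehat X_\Theta\in\mathcal{L}(K_\Theta)$ by $\widehat X_\Theta f=X_\Theta P_{\widetilde{\mathcal{D}}_\Theta}f$. The modified compressed shift is the operator on $K_\Theta$ $$S_{\Theta,X_\Theta}=S_\Theta+(\widehat X_\Theta-S_\Theta)P_{\widetilde{\mathcal{D}}_\Theta}.$$ *)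

(* Defs.v *)
(* H is an arbitrary finite-dimensional complex vector space ([vectType R[i]])
   with a positive definite Hermitian form [dot], linear in its first argument;
   L(H) is ['End(H)].

   Functions on the unit circle are functions f : R[i] -> V of which only the
   values f z with |z| = 1 matter.  Normalized Lebesgue measure on the circle
   is the image of Lebesgue measure on [0, 1] under t |-> exp(2 pi i t).
   Elements of L^2 are represented by functions, not by classes: a subspace of
   L^2 is a set of functions, equality in L^2 is [=T] (equality a.e. on the
   circle), and an operator is a map on functions compatible with [=T]. *)
From mathcomp Require Import all_boot all_order all_algebra.
From mathcomp Require Import sesquilinear.
From mathcomp Require Import complex.
From mathcomp Require Import all_classical all_reals all_analysis.

Set Implicit Arguments.
Unset Strict Implicit.
Unset Printing Implicit Defensive.

Import Order.TTheory GRing.Theory Num.Theory.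
Import numFieldNormedType.Exports.

Local Open Scope classical_set_scope.
Local Open Scope ring_scope.

Reserved Notation "f =T g" (at level 70, no associativity).

Section Circle.
Context {R : realType}.
Local Notation I01 := (`[0%R, 1%R]%classic : set R).
Implicit Types (P : R[i] -> Prop) (f : R[i] -> R[i]).

Definition circle_pt (t : R) : R[i] :=
  Complex (cos (2 * pi * t)) (sin (2 * pi * t)).

Definition ae_circle P : Prop :=
  {ae @lebesgue_measure R, forall t, I01 t -> P (circle_pt t)}.

Definition circle_measurable f : Prop :=
  measurable_fun I01 (fun t : R => complex.Re (f (circle_pt t))) /\
  measurable_fun I01 (fun t : R => complex.Im (f (circle_pt t))).

Definition circle_int f : R[i] :=
  Complex (\int[@lebesgue_measure R]_(t in I01) complex.Re (f (circle_pt t)))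
          (\int[@lebesgue_measure R]_(t in I01) complex.Im (f (circle_pt t))).

(* The limit of a convergent sequence of complex numbers. *)
Definition clim (u : nat -> R[i]) : R[i] :=
  Complex (lim (complex.Re (u n) @[n --> \oo]))
          (lim (complex.Im (u n) @[n --> \oo])).

End Circle.

Notation "f =T g" := (ae_circle (fun z => f z = g z)).

Section HardySpaces.
Context {R : realType} {V : vectType R[i]}.
Implicit Types (f g : R[i] -> V) (ip : V -> V -> R[i]).

Local Notation I01 := (`[0%R, 1%R]%classic : set R).
Let b := vbasis {:V}.

Definition vmeasurable f : Prop :=
  forall i, circle_measurable (fun z => coord b i (f z)).

Definition vint f : V :=
  \sum_i circle_int (fun z => coord b i (f z)) *: b`_i.

(* On the circle z ^ (- n) is the n-th power of the conjugate of z. *)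
Definition fourier f (n : int) : V := vint (fun z => z ^ (- n) *: f z).

(* The value at l (|l| < 1) of the analytic extension of f. *)
Definition analytic_ext f (l : R[i]) : V :=
  \sum_i clim (fun N : nat =>
     \sum_(0 <= k < N) l ^+ k * coord b i (fourier f k%:Z)) *: b`_i.

(* Below, [ip] is the inner product of V: the one given on H, or the
   Hilbert-Schmidt one on L(H). *)
Definition L2 ip f : Prop :=
  vmeasurable f /\
  (\int[@lebesgue_measure R]_(t in I01)
     (complex.Re (ip (f (circle_pt t)) (f (circle_pt t))))%:E < +oo)%E.

Definition L2dot ip f g : R[i] := circle_int (fun z => ip (f z) (g z)).

Definition L2norm ip f : R := Num.sqrt (complex.Re (L2dot ip f f)).

Definition H2 ip f : Prop := L2 ip f /\ forall n : int, n < 0 -> fourier f n = 0.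

Definition Hinfty ip (nrm : V -> R) f : Prop :=
  H2 ip f /\ exists M : R, ae_circle (fun z => nrm (f z) <= M).

End HardySpaces.

Section Operators.
Context {R : realType} {H : vectType R[i]}.
Variable dot : {dot H for @Num.conj R[i]}.
Implicit Types (S T : 'End(H)) (f g h : R[i] -> H).
Implicit Types (K : set (R[i] -> H)) (Theta : R[i] -> 'End(H)).

Definition hnorm (x : H) : R := Num.sqrt (complex.Re (dot x x)).

Definition opnorm T : R := sup [set hnorm (T x) | x in [set x | hnorm x <= 1]].

Definition adj T : 'End(H) :=
  xget 0 [set S : 'End(H) | forall x y, dot (T x) y = dot x (S y)].

Definition unitary T : Prop :=
  (adj T \o T)%VF = \1%VF /\ (T \o adj T)%VF = \1%VF.

Definition trace T : R[i] :=
  \sum_i coord (vbasis {:H}) i (T (vbasis {:H})`_i).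

Definition hs_dot S T : R[i] := trace (adj T \o S)%VF.

Definition linear_op K1 K2 (A : (R[i] -> H) -> (R[i] -> H)) : Prop :=
  [/\ forall f, K1 f -> K2 (A f),
      forall f g, K1 f -> K1 g -> f =T g -> A f =T A g
    & forall (a : R[i]) f g, K1 f -> K1 g ->
        A (fun z => a *: f z + g z) =T (fun z => a *: A f z + A g z)].

Definition bounded_op K1 K2 (A : (R[i] -> H) -> (R[i] -> H)) : Prop :=
  linear_op K1 K2 A /\
  exists M : R, forall f, K1 f -> L2norm dot (A f) <= M * L2norm dot f.

Definition orthoproj K f : R[i] -> H :=
  xget (fun=> 0) [set p | K p /\ forall g, K g -> L2dot dot (f - p) g = 0].

(* The adjoint, with values in K, of an operator A whose domain is K. *)
Definition adjoint K (A : (R[i] -> H) -> (R[i] -> H)) g : R[i] -> H :=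
  xget (fun=> 0)
    [set h | K h /\ forall f, K f -> L2dot dot (A f) g = L2dot dot f h].

Definition inner Theta : Prop :=
  Hinfty hs_dot opnorm Theta /\ ae_circle (fun z => unitary (Theta z)).

Definition pure Theta : Prop := opnorm (analytic_ext Theta 0) < 1.

Definition model Theta : set (R[i] -> H) :=
  [set f | H2 dot f /\
     forall g, H2 dot g -> L2dot dot f (fun z => Theta z (g z)) = 0].

Definition model_infty Theta : set (R[i] -> H) :=
  [set f | model Theta f /\ Hinfty dot hnorm f].

Definition MT Theta1 Theta2 (A : (R[i] -> H) -> (R[i] -> H)) : Prop :=
  bounded_op (model Theta1) (model Theta2) A /\
  exists Phi : R[i] -> 'End(H), L2 hs_dot Phi /\
    forall f, model_infty Theta1 f ->
      A f =T orthoproj (model Theta2) (fun z => Phi z (f z)).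

(* Membership in [L2] is required because a function equal a.e. to a
   measurable one need not be measurable. *)
Definition defect Theta : set (R[i] -> H) :=
  [set f | L2 dot f /\ exists x : H,
     f =T (fun z => x - Theta z (adj (analytic_ext Theta 0) x))].

Definition codefect Theta : set (R[i] -> H) :=
  [set f | L2 dot f /\ exists x : H,
     f =T (fun z => Num.conj z *: (Theta z x - analytic_ext Theta 0 x))].

Definition compressed_shift Theta f : R[i] -> H :=
  orthoproj (model Theta) (fun z => z *: f z).

Definition hat Theta (X : (R[i] -> H) -> (R[i] -> H)) f : R[i] -> H :=
  X (orthoproj (codefect Theta) f).

Definition modified_shift Theta (X : (R[i] -> H) -> (R[i] -> H)) f
    : R[i] -> H :=
  let p := orthoproj (codefect Theta) f in
  compressed_shift Theta f + (hat Theta X p - compressed_shift Theta p).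

End Operators.

(* Main.v *)
(* Let T be the backward shift f |-> z^-1 (f - f(0)), which is the adjoint of
   S_Theta on the model space, let T_X be the adjoint of S_{Theta,X}, and let
   a(f, g) = <A f, g>.  The defect space consists of the reproducing kernels at 0,
   and purity makes x |-> k_x(0) invertible, so that the projection of f on the
   defect space depends only on f(0).  Hence, paired with g, the equation of the
   theorem says that
     a(f, g) - a(T_X f, T_X g) = <Psi f(0), g> + <f, Psi' g(0)>
   for operator functions Psi and Psi' with columns in the model spaces.  Since
   T_X f - T f is determined linearly by f(0), replacing T_X by T changes the
   left-hand side by a form of the same kind, and X disappears.

   Multiplication by a symbol commutes with z, which gives such an equation for
   every truncated Toeplitz operator.  Conversely, the equation telescopes:
   T^n f = z^-n (f - s_n f), where s_n f is the Taylor polynomial, so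
     a(f, g) = a(T^n f, T^n g) + <Psi s_n f, g> + <f, Psi' s_n g>,
   and n -> oo yields the symbol z |-> Psi z + adj (Psi' z). *)
Require Import Defs.
From HB Require Import structures.
From mathcomp Require Import all_boot all_order all_algebra.
From mathcomp Require Import sesquilinear complex.
From mathcomp Require Import all_classical all_reals all_analysis.
From mathcomp Require Import measurable_realfun.
From mathcomp Require Import ring lra zify.

Set Implicit Arguments.
Unset Strict Implicit.
Unset Printing Implicit Defensive.

Import Order.TTheory GRing.Theory Num.Theory.
Import numFieldNormedType.Exports.
Local Open Scope classical_set_scope.
Local Open Scope ring_scope.

(** * Hilbert spaces *)

(** Operators and projections are fixed only up to null functions, so identities are tested weakly:
    two elements of a subspace agree a.e. once all their pairings with it agree. The delicate point
    is that a symbol is merely square integrable, so that Phi f is known to lie in L^2 only for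
    essentially bounded f. In the direct implication the equation is first known for bounded f; it
    extends because, for fixed g, the difference of its sides is the pairing of f with one function
    of L^2, made from the Riesz representers of f |-> <A f, g> and f |-> <A f, T g>. In the
    converse, f and g are both bounded at first. Density costs no estimate: the projections of all
    z^n x on the model space are bounded and read off every Fourier coefficient. The remainder a(T^n
    f, T^n g) disappears in the limit because T^n f has the norm of f - s_n f and A is bounded.
    Finite dimension of H lets a linear map from H to L^2 become an operator function with square
    integrable Hilbert-Schmidt norm; this is the passage between B, B' and symbols. *)

Section ComplexParts.
Context {R : realType}.
Implicit Types (z w : R[i]) (a : R).

Lemma ReCD z w : complex.Re (z + w) = complex.Re z + complex.Re w.
Proof. by case: z w => [? ?] [? ?]. Qed.

Lemma ImCD z w : complex.Im (z + w) = complex.Im z + complex.Im w.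
Proof. by case: z w => [? ?] [? ?]. Qed.

Lemma ReCN z : complex.Re (- z) = - complex.Re z.
Proof. by case: z. Qed.

Lemma ImCN z : complex.Im (- z) = - complex.Im z.
Proof. by case: z. Qed.

Lemma ReCM z w : complex.Re (z * w) =
  complex.Re z * complex.Re w - complex.Im z * complex.Im w.
Proof. by case: z w => [? ?] [? ?]. Qed.

Lemma ImCM z w : complex.Im (z * w) =
  complex.Re z * complex.Im w + complex.Im z * complex.Re w.
Proof. by case: z w => [? ?] [? ?]. Qed.

Lemma ReCJ z : complex.Re (Num.conj z) = complex.Re z.
Proof. by case: z. Qed.

Lemma ImCJ z : complex.Im (Num.conj z) = - complex.Im z.
Proof. by case: z. Qed.

Lemma Re_sum (I : Type) (r : seq I) (Q : pred I) (F : I -> R[i]) :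
  complex.Re (\sum_(i <- r | Q i) F i) = \sum_(i <- r | Q i) complex.Re (F i).
Proof. by apply: (big_morph _ ReCD). Qed.

Lemma complex_ext z w :
  complex.Re z = complex.Re w -> complex.Im z = complex.Im w -> z = w.
Proof. by case: z w => [? ?] [? ?] /= -> ->. Qed.

Lemma cvg0_bound (x : R) (u : nat -> R) : u n @[n --> \oo] --> (0 : R) ->
  (forall n, x <= u n) -> x <= 0.
Proof.
move=> u0 xu; rewrite -(cvg_lim (@Rhausdorff R) u0); apply: limr_ge; last exact: nearW.
by apply/cvg_ex; exists 0.
Qed.

Lemma complex_sqr_le0 (e : R[i]) :
  complex.Re e ^+ 2 + complex.Im e ^+ 2 <= 0 -> e = 0.
Proof.
have e1 := sqr_ge0 (complex.Re e); have e2 := sqr_ge0 (complex.Im e).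
by move=> e0; apply: complex_ext; apply/eqP; rewrite -sqrf_eq0; apply/eqP => /=; lra.
Qed.

(** Shape of the final error bound in [split_form_MT]: there [u] and [v] are the squared norms of
    the Taylor remainders of f and g, and [m], [a], [b] are constants. *)
Lemma cvg0_combination (u v : nat -> R) (m a b : R) :
  u n @[n --> \oo] --> (0 : R) -> v n @[n --> \oo] --> (0 : R) ->
  3 * (m * u n * v n + u n * a + b * v n) @[n --> \oo] --> (0 : R).
Proof.
move=> u0 v0; have -> : (0 : R) = 3 * (m * 0 * 0 + 0 * a + b * 0) by ring.
apply: cvgMr; apply: cvgD; last exact: cvgMr.
apply: cvgD; last exact: cvgMl.
by apply: cvgM => //; exact: cvgMr.
Qed.

End ComplexParts.

Definition linear_subspace {R : realType} {E : lmodType R[i]} (K : set E) : Prop :=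
  K 0 /\ forall (a : R[i]) f g, K f -> K g -> K (a *: f + g).

(* A complex vector space [P] with a semidefinite inner product that is
   complete for the associated seminorm.  Rapidly converging sequences suffice
   to express completeness. *)
Record hilbert {R : realType} {E : lmodType R[i]} (P : set E)
    (ip : E -> E -> R[i]) : Prop := Hilbert {
  hilbert_subspace : linear_subspace P;
  hilbert_linear : forall (a : R[i]) f g h, P f -> P g -> P h ->
    ip (a *: f + g) h = a * ip f h + ip g h;
  hilbert_conj : forall f g, P f -> P g -> ip g f = Num.conj (ip f g);
  hilbert_ge0 : forall f, P f -> 0 <= complex.Re (ip f f);
  hilbert_complete : forall u : nat -> E, (forall n, P (u n)) ->
    (forall n, complex.Re (ip (u n.+1 - u n) (u n.+1 - u n)) <= 4^-1 ^+ n) ->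
    exists2 l, P l &
      complex.Re (ip (u n - l) (u n - l)) @[n --> \oo] --> (0 : R) }.

Section Hilbert.
Context {R : realType} {E : lmodType R[i]}.
Implicit Types (P K : set E) (f g h : E).

Lemma subspaceZ K a f : linear_subspace K -> K f -> K (a *: f).
Proof. by move=> [K0 KL] Kf; rewrite -[X in K X]addr0; exact: KL. Qed.

Lemma subspaceD K f g : linear_subspace K -> K f -> K g -> K (f + g).
Proof. by move=> [K0 KL] Kf Kg; rewrite -[f]scale1r; exact: KL. Qed.

Lemma subspaceN K f : linear_subspace K -> K f -> K (- f).
Proof. by move=> sK Kf; rewrite -scaleN1r; exact: subspaceZ. Qed.

Lemma subspaceB K f g : linear_subspace K -> K f -> K g -> K (f - g).
Proof. by move=> sK Kf Kg; apply: subspaceD => //; exact: subspaceN. Qed.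

Lemma subspace_sum K (I : Type) (r : seq I) (Q : pred I) (F : I -> E) :
  linear_subspace K -> (forall i, Q i -> K (F i)) -> K (\sum_(i <- r | Q i) F i).
Proof.
move=> sK KF; elim/big_ind : _ => //; first by case: sK.
by move=> f g; exact: subspaceD.
Qed.

Variables (P : set E) (ip : E -> E -> R[i]).
Hypothesis hP : hilbert P ip.
Let sP := hilbert_subspace hP.

Local Notation N f := (complex.Re (ip f f)).

Let PD f g : P f -> P g -> P (f + g). Proof. exact: subspaceD. Qed.
Let PB f g : P f -> P g -> P (f - g). Proof. exact: subspaceB. Qed.
Let PN f : P f -> P (- f). Proof. exact: subspaceN. Qed.
Let PZ a f : P f -> P (a *: f). Proof. exact: subspaceZ. Qed.

Lemma ipDl f g h : P f -> P g -> P h -> ip (f + g) h = ip f h + ip g h.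
Proof.
by move=> Pf Pg Ph; rewrite -{1}[f]scale1r (hilbert_linear hP)// mul1r.
Qed.

Lemma ip0l h : P h -> ip 0 h = 0.
Proof.
move=> Ph; have P0 : P 0 by case: sP.
by apply: (@addrI _ (ip 0 h)); rewrite -ipDl// !addr0.
Qed.

Lemma ipZl a f h : P f -> P h -> ip (a *: f) h = a * ip f h.
Proof.
move=> Pf Ph; have P0 : P 0 by case: sP.
by rewrite -[a *: f]addr0 (hilbert_linear hP)// ip0l// addr0.
Qed.

Lemma ipNl f h : P f -> P h -> ip (- f) h = - ip f h.
Proof. by move=> Pf Ph; rewrite -scaleN1r ipZl// mulN1r. Qed.

Lemma ipBl f g h : P f -> P g -> P h -> ip (f - g) h = ip f h - ip g h.
Proof. by move=> Pf Pg Ph; rewrite ipDl ?ipNl//; exact: PN. Qed.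

Lemma ipDr f g h : P f -> P g -> P h -> ip h (f + g) = ip h f + ip h g.
Proof.
move=> Pf Pg Ph; rewrite (hilbert_conj hP (PD Pf Pg) Ph) ipDl// rmorphD.
by rewrite (hilbert_conj hP Pf Ph) (hilbert_conj hP Pg Ph).
Qed.

Lemma ip0r h : P h -> ip h 0 = 0.
Proof.
move=> Ph; have P0 : P 0 by case: sP.
by rewrite (hilbert_conj hP P0 Ph) ip0l// rmorph0.
Qed.

Lemma ipZr a f h : P f -> P h -> ip h (a *: f) = Num.conj a * ip h f.
Proof.
move=> Pf Ph; rewrite (hilbert_conj hP (PZ a Pf) Ph) ipZl// rmorphM.
by rewrite (hilbert_conj hP Pf Ph).
Qed.

Lemma ipNr f h : P f -> P h -> ip h (- f) = - ip h f.
Proof. by move=> Pf Ph; rewrite -scaleN1r ipZr// rmorphN1 mulN1r. Qed.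

Lemma ipBr f g h : P f -> P g -> P h -> ip h (f - g) = ip h f - ip h g.
Proof. by move=> Pf Pg Ph; rewrite ipDr ?ipNr//; exact: PN. Qed.

Lemma ip_suml (I : Type) (r : seq I) (Q : pred I) (F : I -> E) h : P h ->
  (forall i, Q i -> P (F i)) ->
  ip (\sum_(i <- r | Q i) F i) h = \sum_(i <- r | Q i) ip (F i) h.
Proof.
move=> Ph PF; elim: r => [|i r IH]; first by rewrite !big_nil ip0l.
rewrite !big_cons; case: ifP => // Qi; rewrite ipDl ?IH//; first exact: PF.
exact: subspace_sum.
Qed.

Lemma ip_sumr (I : Type) (r : seq I) (Q : pred I) (F : I -> E) h : P h ->
  (forall i, Q i -> P (F i)) ->
  ip h (\sum_(i <- r | Q i) F i) = \sum_(i <- r | Q i) ip h (F i).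
Proof.
move=> Ph PF; rewrite (hilbert_conj hP (subspace_sum _ sP PF) Ph) ip_suml//.
rewrite rmorph_sum; apply: eq_bigr => i Qi.
by rewrite (hilbert_conj hP (PF i Qi) Ph).
Qed.

Lemma Im_ip_diag f : P f -> complex.Im (ip f f) = 0.
Proof.
move=> Pf; have := congr1 (@complex.Im R) (hilbert_conj hP Pf Pf).
by rewrite ImCJ; lra.
Qed.

Lemma Re_ipC f g : P f -> P g -> complex.Re (ip g f) = complex.Re (ip f g).
Proof. by move=> Pf Pg; rewrite (hilbert_conj hP Pf Pg) ReCJ. Qed.

Lemma sqnormDZ f g (t : R) : P f -> P g ->
  N (f + t%:C%C *: g) = N f + 2 * t * complex.Re (ip f g) + t ^+ 2 * N g.
Proof.
move=> Pf Pg; have Ptg := PZ t%:C%C Pg.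
rewrite ipDl ?ipDr//; [|exact: PD..].
rewrite !ipZl ?ipZr// !ReCD !ReCM /= (Re_ipC Pf Pg).
by rewrite !(ImCD, ImCM) ReCJ ImCJ/= ; ring.
Qed.

Lemma sqnormD f g : P f -> P g ->
  N (f + g) = N f + 2 * complex.Re (ip f g) + N g.
Proof.
by move=> Pf Pg; have := sqnormDZ 1 Pf Pg; rewrite scale1r => ->; ring.
Qed.

Lemma sqnormB f g : P f -> P g ->
  N (f - g) = N f - 2 * complex.Re (ip f g) + N g.
Proof.
move=> Pf Pg; rewrite sqnormD ?ipNr ?ipNl ?ReCN//; [|exact: PN..].
by rewrite opprK; ring.
Qed.

Lemma sqnormN f : P f -> N (- f) = N f.
Proof. by move=> Pf; rewrite ipNl ?ipNr ?opprK//; exact: PN. Qed.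

Lemma sqnormZ a f : P f ->
  N (a *: f) = (complex.Re a ^+ 2 + complex.Im a ^+ 2) * N f.
Proof.
move=> Pf; have Paf := PZ a Pf; rewrite ipZl// ipZr// !ReCM ImCM ReCJ ImCJ.
by rewrite (Im_ip_diag Pf); ring.
Qed.

Lemma sqnorm_distC f g : P f -> P g -> N (f - g) = N (g - f).
Proof. by move=> Pf Pg; rewrite -sqnormN ?opprB//; exact: PB. Qed.

(** For nonzero [a], evaluation at the minimum -b/a gives the bound. For a = 0 the function of t is
    affine, and a nonzero slope would give the value -1 at -(c+1)/(2b). *)
Lemma quadratic_discr (a b c : R) : 0 <= a -> 0 <= c ->
  (forall t, 0 <= c + 2 * t * b + t ^+ 2 * a) -> b ^+ 2 <= c * a.
Proof.
move=> a0 c0 H; have [aE|an0] := eqVneq a 0.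
  have [->|bn0] := eqVneq b 0; first by rewrite expr0n aE mulr0.
  have := H (- ((c + 1) / (2 * b))); rewrite aE mulr0 addr0.
  suff -> : 2 * (- ((c + 1) / (2 * b))) * b = - (c + 1) by lra.
  by field.
have a1 : 0 < a by rewrite lt_def an0.
have := H (- (b / a)).
have -> : c + 2 * (- (b / a)) * b + (- (b / a)) ^+ 2 * a = (c * a - b ^+ 2) / a.
  by field.
by rewrite ler_pdivlMr// mul0r; lra.
Qed.

Lemma Cauchy_Schwarz f g : P f -> P g ->
  complex.Re (ip f g) ^+ 2 <= N f * N g.
Proof.
move=> Pf Pg; apply: quadratic_discr; [exact: (hilbert_ge0 hP)|exact: (hilbert_ge0 hP)|].
by move=> t; rewrite -sqnormDZ//; apply: (hilbert_ge0 hP) => //; apply: PD => //;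
  exact: PZ.
Qed.

(** The real inequality is applied to f and w g with w = <f, g>: this rotation makes the pairing
    equal to |w|^2, and one factor |w|^2 cancels. *)
Lemma Cauchy_SchwarzC f g : P f -> P g ->
  complex.Re (ip f g) ^+ 2 + complex.Im (ip f g) ^+ 2 <= N f * N g.
Proof.
move=> Pf Pg; set w := ip f g; set s := _ + _.
have s0 : 0 <= s by rewrite addr_ge0 ?sqr_ge0.
have := Cauchy_Schwarz Pf (PZ w Pg).
rewrite ipZr// sqnormZ// -/w ReCM ReCJ ImCJ mulNr opprK -!expr2 -/s.
have [->|sn0] := eqVneq s 0; first by rewrite mulr_ge0//; exact: (hilbert_ge0 hP).
have {s0} sn0 : 0 < s by rewrite lt_def sn0.
by rewrite expr2 mulrCA ler_pM2l.
Qed.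

(** Cauchy-Schwarz makes the pairing continuous for the seminorm; hence annihilators are closed. *)
Lemma limit_ip (u : nat -> E) (l g : E) : (forall n, P (u n)) -> P l -> P g ->
  N (u n - l) @[n --> \oo] --> 0 ->
  (forall n, ip (u n) g = 0) -> ip l g = 0.
Proof.
move=> Pu Pl Pg ul u0; have Pul n : P (u n - l) by exact: PB.
apply: complex_sqr_le0; apply: (@cvg0_bound _ _ (fun n => N (u n - l) * N g)) => [|n].
  by rewrite -[X in _ --> X](mul0r (N g)); exact: cvgMl.
have := Cauchy_SchwarzC (Pul n) Pg.
by rewrite ipBl// u0 add0r ReCN ImCN !sqrrN.
Qed.

(* The representing vector is the limit of a sequence minimizing
   [|f|^2 - 2 Re (ell f)] on [K]; it lies in the closure of [K]. *)
Lemma Riesz_closure K (ell : E -> R[i]) (M : R) :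
  K `<=` P -> linear_subspace K ->
  (forall (a : R[i]) f g, K f -> K g -> ell (a *: f + g) = a * ell f + ell g) ->
  0 <= M -> (forall f, K f -> complex.Re (ell f) ^+ 2 <= M * N f) ->
  exists2 h, P h &
    (exists2 u : nat -> E, (forall n, K (u n)) &
       N (u n - h) @[n --> \oo] --> 0) /\
    (forall f, K f -> ell f = ip f h).
Proof.
move=> KP sK ellL M0 ellM.
have K0 : K 0 by case: sK.
have KD f g : K f -> K g -> K (f + g) by exact: subspaceD.
have KZ a f : K f -> K (a *: f) by exact: subspaceZ.
have ellD f g : K f -> K g -> ell (f + g) = ell f + ell g.
  by move=> Kf Kg; rewrite -{1}[f]scale1r ellL// mul1r.
have ell0 : ell 0 = 0.
  by apply: (@addrI _ (ell 0)); rewrite -ellD// !addr0.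
have ellZ a f : K f -> ell (a *: f) = a * ell f.
  by move=> Kf; rewrite -[a *: f]addr0 ellL// ell0 addr0.
pose J f := N f - 2 * complex.Re (ell f).
(* From e^2 <= M n, the arithmetic-geometric inequality gives 2 e <= n + M. *)
have J_lb f : K f -> - M <= J f.
  move=> Kf; have Nf := hilbert_ge0 hP (KP _ Kf).
  have eM := ellM _ Kf; rewrite /J.
  set e := complex.Re _ in eM *; set n := N f in eM Nf *.
  suff : 2 * e <= n + M by lra.
  have [e0|e0] := ltP e 0; first by lra.
  rewrite -(@ler_sqr _ (2 * e)) ?nnegrE; [|lra..].
  by have := sqr_ge0 (n - M); nra.
pose S := [set J f | f in K].
have S0 : S !=set0 by exists (J 0); exists 0.
have SM : has_lbound S by exists (- M) => _ [f Kf <-]; exact: J_lb.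
have hS : has_inf S by [].
pose m := inf S.
have mJ f : K f -> m <= J f by move=> Kf; apply: ge_inf => //; exists f.
(* The leading 1/4 cancels the 4 of the parallelogram law: comparing J at u_n, at u_(n+1) and at
   their midpoint gives |u_(n+1) - u_n|^2 <= 4 d_n. *)
pose d (n : nat) : R := 4^-1 * 4^-1 ^+ n.
have d0 n : 0 < d n by rewrite /d mulr_gt0// ?exprn_gt0//; lra.
have dS n : d n.+1 <= d n.
  by rewrite /d exprS; have : (0 : R) < 4^-1 ^+ n by [rewrite exprn_gt0//; lra]; lra.
have /choice[u uP] n : exists f, K f /\ J f < m + d n.
  by have [_ [f Kf <-] fm] := inf_adherent (d0 n) hS; exists f.
have Ku n : K (u n) by case: (uP n).
have Pu n : P (u n) by exact: KP.
have JZ f g t : K f -> K g ->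
    J (f + t%:C%C *: g) =
    J f + 2 * t * (complex.Re (ip f g) - complex.Re (ell g)) + t ^+ 2 * N g.
  move=> Kf Kg; rewrite /J sqnormDZ; [|exact: KP..].
  by rewrite ellD ?ellZ ?ReCD ?ReCM//=; [ring|exact: KZ].
have fast n : N (u n.+1 - u n) <= 4^-1 ^+ n.
  pose g := u n.+1 - u n.
  have Kg : K g by exact: subspaceB.
  have := mJ _ (KD _ _ (Ku n) (KZ (2^-1)%:C%C _ Kg)).
  have := JZ _ _ 2^-1 (Ku n) Kg; have := JZ _ _ 1 (Ku n) Kg.
  rewrite scale1r {1}/g addrC subrK -/g.
  move: (uP n.+1) (uP n) (dS n) (d0 n) => [_ u1] [_ u0].
  have dn : 4^-1 ^+ n = 4 * d n :> R by rewrite /d; field.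
  rewrite dn; move: (_ - _) => r; set x := J (_ + _ *: _); lra.
have [h Ph hcv] := hilbert_complete hP Pu fast.
exists h => //; split; first by exists u.
have d_cv : d n @[n --> \oo] --> (0 : R).
  by apply: cvg_geometric; rewrite ger0_norm; lra.
have Re_eq f : K f -> complex.Re (ip h f) = complex.Re (ell f).
  move=> Kf; have Pf := KP _ Kf; have Nf := hilbert_ge0 hP Pf.
  pose x := complex.Re (ip h f) - complex.Re (ell f).
  suff x0 : x ^+ 2 <= 0.
    by apply/eqP; rewrite -subr_eq0 -sqrf_eq0 eq_le x0 sqr_ge0.
  have xle n : x ^+ 2 <= 2 * N f * N (u n - h) + 2 * N f * d n.
    have := Cauchy_Schwarz (PB (Pu n) Ph) Pf; rewrite ipBl// ReCD ReCN.
    pose y := complex.Re (ip (u n) f) - complex.Re (ell f).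
    have : y ^+ 2 <= d n * N f.
      (* J stays above its infimum along the line u_n + t f, so the discriminant of this quadratic
         in t bounds the error y at stage n. *)
      apply: quadratic_discr => // [|t]; first exact: ltW.
      have := mJ _ (KD _ _ (Ku n) (KZ t%:C%C _ Kf)).
      by rewrite JZ// -/y; have [_] := uP n; lra.
    rewrite /x /y; move: (complex.Re (ip (u n) f)) => a.
    move: (complex.Re (ell f)) (complex.Re (ip h f)) => b c.
    have := sqr_ge0 ((a - b) - (c - a)); nra.
  have cv : 2 * N f * N (u n - h) + 2 * N f * d n @[n --> \oo] -->
      2 * N f * 0 + 2 * N f * 0 by apply: cvgD; apply: cvgMr.
  rewrite mulr0 addr0 in cv; rewrite -(cvg_lim _ cv)//; apply: limr_ge.
    by apply/cvg_ex; exists 0.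
  exact: nearW.
move=> f Kf; have Pf := KP _ Kf; rewrite (hilbert_conj hP Ph Pf).
apply: complex_ext; rewrite ?ReCJ ?ImCJ ?Re_eq//.
(* The imaginary parts agree because the real parts agree at i f. *)
have := Re_eq _ (KZ 'i%C _ Kf).
by rewrite ellZ// ipZr// !ReCM/= => ?; lra.
Qed.

(** H^2 ([H2E]) and the model space ([modelE]) are presented in this way; linearity, closedness and
    projections then come from general lemmas. *)
Definition annihilator (S : set E) : set E :=
  [set f | P f /\ forall s, S s -> ip f s = 0].

Lemma annihilator_subspace S : S `<=` P -> linear_subspace (annihilator S).
Proof.
move=> SP; have P0 : P 0 by case: sP.
split=> [|a f g [Pf f0] [Pg g0]].
  by split=> // s Ss; rewrite ip0l//; exact: SP.
split=> [|s Ss]; first by apply: PD => //; exact: PZ.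
rewrite (hilbert_linear hP) ?f0 ?g0//; [by rewrite mulr0 addr0|exact: SP].
Qed.

Lemma Riesz (S : set E) (ell : E -> R[i]) (M : R) :
  S `<=` P ->
  (forall (a : R[i]) f g, annihilator S f -> annihilator S g ->
     ell (a *: f + g) = a * ell f + ell g) ->
  0 <= M -> (forall f, annihilator S f -> complex.Re (ell f) ^+ 2 <= M * N f) ->
  exists2 h, annihilator S h & forall f, annihilator S f -> ell f = ip f h.
Proof.
move=> SP ellL M0 ellM.
have [|h Ph [[u uS uh] hE]] :=
  Riesz_closure _ (annihilator_subspace SP) ellL M0 ellM; first by move=> f [].
exists h => //; split=> // s Ss.
by apply: (limit_ip _ Ph _ uh) => [n||n]; [case: (uS n)|exact: SP|
  case: (uS n) => _; exact].
Qed.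

(** The projection of f is the Riesz representer of g |-> <g, f> restricted to the annihilator. *)
Lemma projection_exists (S : set E) f : S `<=` P -> P f ->
  exists2 p, annihilator S p & forall g, annihilator S g -> ip (f - p) g = 0.
Proof.
move=> SP Pf.
have [a x y [Px _] [Py _]||x [Px _]|p Sp pE] :=
  @Riesz S (fun g => ip g f) (N f) SP.
- exact: (hilbert_linear hP).
- exact: (hilbert_ge0 hP).
- by rewrite mulrC; exact: Cauchy_Schwarz.
exists p => // g Sg; have [Pg _] := Sg; have [Pp _] := Sp.
by rewrite ipBl// (hilbert_conj hP Pg Pf) pE// -(hilbert_conj hP Pg Pp) subrr.
Qed.

End Hilbert.

(** * Finite-dimensional inner products *)

Lemma lfun_exists {F : fieldType} {U V : vectType F} (f : U -> V) :
  linear f -> exists T : 'Hom(U, V), forall x, T x = f x.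
Proof.
move=> fL; pose fL' := GRing.isLinear.Build _ _ _ _ f fL.
pose fH : {linear U -> V} := HB.pack f fL'.
by exists (linfun fH) => x; rewrite lfunE.
Qed.

Section FiniteDimension.
Context {R : realType} {H : vectType R[i]}.
Variable dot : {dot H for @Num.conj R[i]}.
Implicit Types (x y : H) (S T : 'End(H)).

Lemma dotDl x y w : dot (x + y) w = dot x w + dot y w.
Proof. exact: linearDl. Qed.

Lemma dotDr x y w : dot w (x + y) = dot w x + dot w y.
Proof. exact: linearDr. Qed.

Lemma dotZl a x y : dot (a *: x) y = a * dot x y.
Proof. exact: linearZl_LR. Qed.

Lemma dotZr a x y : dot x (a *: y) = Num.conj a * dot x y.
Proof. exact: linearZr_LR. Qed.

Lemma dotBl x y w : dot (x - y) w = dot x w - dot y w.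
Proof. exact: linearBl. Qed.

Lemma dotBr x y w : dot w (x - y) = dot w x - dot w y.
Proof. exact: linearBr. Qed.

Lemma dot0l x : dot 0 x = 0.
Proof. exact: linear0l. Qed.

Lemma dot0r x : dot x 0 = 0.
Proof. exact: linear0r. Qed.

Lemma dot_suml (I : Type) (r : seq I) (Q : pred I) (F : I -> H) y :
  dot (\sum_(i <- r | Q i) F i) y = \sum_(i <- r | Q i) dot (F i) y.
Proof. by apply: (big_morph (dot^~ y)); [move=> *; exact: dotDl|exact: dot0l]. Qed.

Lemma dot_sumr (I : Type) (r : seq I) (Q : pred I) (F : I -> H) x :
  dot x (\sum_(i <- r | Q i) F i) = \sum_(i <- r | Q i) dot x (F i).
Proof. by apply: (big_morph (dot x)); [move=> *; exact: dotDr|exact: dot0r]. Qed.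

Lemma dot_conj x y : dot y x = Num.conj (dot x y).
Proof. by rewrite hermC expr0 mul1r. Qed.

Lemma dot_diag x : dot x x = Complex (complex.Re (dot x x)) 0.
Proof.
apply: complex_ext => //=.
by have := congr1 (@complex.Im R) (dot_conj x x); rewrite ImCJ; lra.
Qed.

Lemma sqnorm_ge0 x : 0 <= complex.Re (dot x x).
Proof. by have := dnorm_ge0 dot x; rewrite lecE => /andP[]. Qed.

Lemma sqnorm_eq0 x : complex.Re (dot x x) = 0 -> x = 0.
Proof.
move=> x0; apply/eqP; rewrite -(dnorm_eq0 dot); apply/eqP.
by rewrite dot_diag x0.
Qed.

Lemma dot_ext x y : (forall w, dot x w = dot y w) -> x = y.
Proof.
move=> xy; apply/eqP; rewrite -subr_eq0; apply/eqP/sqnorm_eq0.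
by rewrite dotBl xy subrr.
Qed.

(** Gram-Schmidt: the part [Y] of [x] orthogonal to the previous vectors is normalized and added,
    unless it vanishes. *)
Lemma orthonormal_cover (s : seq H) :
  exists2 t, orthonormal dot t & {subset s <= <<t>>%VS}.
Proof.
elim: s => [|x s [t t1 st]]; first by exists [::].
have [X Xt [Y [xE _ Yt]]] := orthogonal_split dot t x.
have [Y0|Y0] := eqVneq Y 0.
  exists t => // y; rewrite inE => /predU1P[->|]; last exact: st.
  by rewrite xE Y0 addr0.
pose r : R := Num.sqrt (complex.Re (dot Y Y)).
have r2 : r ^+ 2 = complex.Re (dot Y Y) by rewrite sqr_sqrtr ?sqnorm_ge0.
have r0 : r != 0.
  by apply: contra_neq Y0 => r0; apply: sqnorm_eq0; rewrite -r2 r0 expr0n.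
pose Z := r^-1%:C%C *: Y.
have YZ : Y = r%:C%C *: Z by rewrite scalerA -rmorphM/= mulfV// scale1r.
exists (Z :: t).
  rewrite -cat1s orthonormal_cat t1/=; apply/and3P; split=> //.
    rewrite /orthonormal/= !andbT dotZl dotZr dot_diag -r2.
    apply/eqP/complex_ext; rewrite !(ReCM, ImCM, ReCJ, ImCJ)/=; last by lra.
    by field.
  by apply/allP => y yt /=; rewrite dotZl (orthoPl Yt)// mulr0.
move=> y; rewrite inE => /predU1P[->|/st]; last first.
  by apply: subvP; rewrite span_cons addvSr.
rewrite xE memvD//; first by apply: subvP Xt; rewrite span_cons addvSr.
by rewrite YZ memvZ// memv_span// mem_head.
Qed.

Lemma onb_exists : exists (n : nat) (e : 'I_n -> H),
  (forall i j, dot (e i) (e j) = (i == j)%:R) /\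
  (forall x, x = \sum_i dot x (e i) *: e i).
Proof.
have [t t1 bt] := orthonormal_cover (vbasis {:H}).
have /orthonormalP[ut tE] := t1.
exists (size t), (fun i => t`_i).
have E i j : (i < size t)%N -> (j < size t)%N -> dot t`_i t`_j = (i == j)%:R.
  by move=> ? ?; rewrite tE ?mem_nth// nth_uniq.
split=> [i j|x]; first exact: E.
have xt : x \in <<in_tuple t>>%VS.
  have : ({:H} <= <<t>>)%VS.
    by rewrite -(span_basis (vbasisP {:H})); apply/span_subvP.
  by move/subvP; apply; rewrite memvf.
rewrite {1}(coord_span xt); apply: eq_bigr => i _; congr (_ *: _).
rewrite {2}(coord_span xt) dot_suml (bigD1 i)//= dotZl E// eqxx mulr1.
rewrite big1 ?addr0// => j ji; rewrite dotZl E//.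
by rewrite (_ : (j == i :> nat) = false) ?mulr0//; apply/negbTE.
Qed.

(** The basis [vbasis] has no relation to [dot]. A chosen orthonormal basis turns pairings, traces
    and Hilbert-Schmidt norms into sums over coordinates. *)
Definition onb_size : nat := sval (cid onb_exists).

Definition onb : 'I_onb_size -> H := sval (cid (svalP (cid onb_exists))).

Lemma dot_onb i j : dot (onb i) (onb j) = (i == j)%:R.
Proof. by have [] := svalP (cid (svalP (cid onb_exists))). Qed.

Lemma onb_sum x : x = \sum_i dot x (onb i) *: onb i.
Proof. by have [] := svalP (cid (svalP (cid onb_exists))). Qed.

Lemma dot_onb_sum x y :
  dot x y = \sum_i dot x (onb i) * Num.conj (dot y (onb i)).
Proof.
rewrite {1}[y]onb_sum dot_sumr; apply: eq_bigr => i _.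
by rewrite dotZr mulrC.
Qed.

Lemma sqnorm_onb x : complex.Re (dot x x) =
  \sum_i (complex.Re (dot x (onb i)) ^+ 2 + complex.Im (dot x (onb i)) ^+ 2).
Proof.
rewrite dot_onb_sum Re_sum; apply: eq_bigr => i _.
by rewrite ReCM ReCJ ImCJ; ring.
Qed.

Lemma functional_dot (phi : H -> R[i]) : scalar phi ->
  exists w, forall x, phi x = dot x w.
Proof.
move=> phiL; have phi0 : phi 0 = 0.
  by have := phiL 1 0 0; rewrite scaler0 addr0 mul1r => /esym/eqP;
    rewrite -subr_eq0 addrK => /eqP.
have phiD : {morph phi : x y / x + y}.
  by move=> x y; have := phiL 1 x y; rewrite scale1r mul1r.
have phiZ a x : phi (a *: x) = a * phi x.
  by have := phiL a x 0; rewrite !addr0 phi0 addr0.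
exists (\sum_i Num.conj (phi (onb i)) *: onb i) => x.
rewrite {1}[x]onb_sum (big_morph phi phiD phi0) dot_sumr.
by apply: eq_bigr => i _; rewrite phiZ dotZr conjCK mulrC.
Qed.

(** [adj] picks some adjoint and falls back to 0, so one has to be exhibited: y |-> sum_i <y, T e_i>
    e_i. *)
Lemma adjP T x y : dot (T x) y = dot x (adj dot T y).
Proof.
rewrite /adj; case: xgetP => [S _ SE|nT]; first exact: SE.
pose S y := \sum_i dot y (T (onb i)) *: onb i.
have SL : linear S.
  move=> a u v; rewrite /S scaler_sumr -big_split/=; apply: eq_bigr => i _.
  by rewrite dotDl dotZl scalerDl scalerA.
have [S' S'E] := lfun_exists SL.
case: (nT S') => /= u v; rewrite S'E.
rewrite /S dot_sumr {1}[u]onb_sum linear_sum dot_suml.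
by apply: eq_bigr => i _; rewrite linearZ/= dotZl dotZr mulrC -dot_conj mulrC.
Qed.

Lemma adjP' T x y : dot x (T y) = dot (adj dot T x) y.
Proof. by rewrite dot_conj adjP -dot_conj. Qed.

Lemma adj_ext S T : (forall x y, dot (T x) y = dot x (S y)) -> adj dot T = S.
Proof.
move=> TS; apply/lfunP => y; apply: dot_ext => x.
by rewrite dot_conj -adjP TS -dot_conj.
Qed.

Lemma adjK T : adj dot (adj dot T) = T.
Proof. by apply: adj_ext => x y; rewrite -adjP'. Qed.

(** [trace] is computed in [vbasis]; expanding each of its vectors in [onb] and exchanging the sums
    reassembles T e_j from its coordinates. *)
Lemma trace_onb T : trace T = \sum_j dot (T (onb j)) (onb j).
Proof.
rewrite /trace; set b := vbasis _.
under eq_bigr => i _.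
  rewrite {1}[b`_i]onb_sum linear_sum linear_sum/=.
  under eq_bigr => j _ do rewrite !linearZ/=.
  over.
rewrite exchange_big; apply: eq_bigr => j _ /=.
rewrite {2}(coord_vbasis (memvf (T (onb j)))) dot_suml.
by apply: eq_bigr => i _; rewrite dotZl mulrC.
Qed.

Lemma hs_dotE S T : hs_dot dot S T = \sum_j dot (S (onb j)) (T (onb j)).
Proof.
rewrite /hs_dot trace_onb; apply: eq_bigr => j _.
by rewrite comp_lfunE -adjP'.
Qed.

Lemma Re_hs_dot T : complex.Re (hs_dot dot T T) =
  \sum_j complex.Re (dot (T (onb j)) (T (onb j))).
Proof. by rewrite hs_dotE Re_sum. Qed.

Lemma Re_dot_le x y : 2 * complex.Re (dot x y) <=
  complex.Re (dot x x) + complex.Re (dot y y).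
Proof.
have := sqnorm_ge0 (x - y).
rewrite dotBl !dotBr !(ReCD, ReCN) (dot_conj x y) ReCJ; lra.
Qed.

Lemma Im_dot_le x y : 2 * complex.Im (dot x y) <=
  complex.Re (dot x x) + complex.Re (dot y y).
Proof.
have := Re_dot_le ((- 'i%C) *: x) y.
by rewrite !dotZl !dotZr !(ReCM, ImCM, ReCJ, ImCJ, ReCN, ImCN)/=; lra.
Qed.

Lemma norm_Re_dot_le x y : `|complex.Re (dot x y)| <=
  complex.Re (dot x x) + complex.Re (dot y y).
Proof.
have := Re_dot_le (- x) y; have := Re_dot_le x y.
rewrite -scaleN1r !dotZl !dotZr !(ReCM, ImCM, ReCJ, ImCJ, ReCN, ImCN)/=.
have := sqnorm_ge0 x; have := sqnorm_ge0 y.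
by rewrite ler_norml => *; apply/andP; split; lra.
Qed.

Lemma norm_Im_dot_le x y : `|complex.Im (dot x y)| <=
  complex.Re (dot x x) + complex.Re (dot y y).
Proof.
have := Im_dot_le (- x) y; have := Im_dot_le x y.
rewrite -scaleN1r !dotZl !dotZr !(ReCM, ImCM, ReCJ, ImCJ, ReCN, ImCN)/=.
have := sqnorm_ge0 x; have := sqnorm_ge0 y.
by rewrite ler_norml => *; apply/andP; split; lra.
Qed.


Lemma dot_Cauchy_Schwarz x y :
  complex.Re (dot x y) ^+ 2 + complex.Im (dot x y) ^+ 2 <=
  complex.Re (dot x x) * complex.Re (dot y y).
Proof.
have [] := CauchySchwarz dot x y; rewrite -add_Re2_Im2 => + _.
by rewrite (dot_diag x) (dot_diag y) lecE !ReCM/= => /andP[_]; rewrite mulr0 subr0.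
Qed.

(** Both sides are the sum of the squared moduli of the matrix entries in [onb]. *)
Lemma Re_hs_dot_adj T : complex.Re (hs_dot dot (adj dot T) (adj dot T)) =
  complex.Re (hs_dot dot T T).
Proof.
rewrite !Re_hs_dot; under eq_bigr => i _ do rewrite sqnorm_onb.
rewrite exchange_big/=; apply: eq_bigr => i _; rewrite sqnorm_onb.
apply: eq_bigr => j _; rewrite -adjP' (dot_conj (onb j)) ReCJ ImCJ.
by rewrite sqrrN.
Qed.

(** The i-th coordinate of T x is <x, adj T e_i>, to which Cauchy-Schwarz applies. Square
    integrability of a symbol controls its action on functions through this bound. *)
Lemma sqnorm_apply_le T x : complex.Re (dot (T x) (T x)) <=
  complex.Re (hs_dot dot T T) * complex.Re (dot x x).
Proof.
rewrite sqnorm_onb -Re_hs_dot_adj Re_hs_dot mulr_suml; apply: ler_sum => i _.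
by rewrite adjP mulrC; exact: dot_Cauchy_Schwarz.
Qed.

Lemma sqnormD_leH x y : complex.Re (dot (x + y) (x + y)) <=
  2 * complex.Re (dot x x) + 2 * complex.Re (dot y y).
Proof.
by rewrite dotDl !dotDr !ReCD (dot_conj x y) ReCJ; have := Re_dot_le x y; lra.
Qed.

Lemma sqnormZH a x : complex.Re (dot (a *: x) (a *: x)) =
  (complex.Re a ^+ 2 + complex.Im a ^+ 2) * complex.Re (dot x x).
Proof.
rewrite dotZl dotZr mulrA [dot x x]dot_diag !(ReCM, ImCM, ReCJ, ImCJ)/=; ring.
Qed.

Lemma sqnorm_hs_ge0 T : 0 <= complex.Re (hs_dot dot T T).
Proof. by rewrite Re_hs_dot; apply: sumr_ge0 => i _; exact: sqnorm_ge0. Qed.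

Lemma hnorm_ge0 x : 0 <= hnorm dot x. Proof. exact: sqrtr_ge0. Qed.

Lemma sqr_hnorm x : hnorm dot x ^+ 2 = complex.Re (dot x x).
Proof. by rewrite sqr_sqrtr// sqnorm_ge0. Qed.

(** Purity enters through this lemma alone. A nonzero x would, once normalized, be a unit vector
    whose image has norm at least 1. *)
Lemma strict_contraction T x : opnorm dot T < 1 ->
  complex.Re (dot x x) <= complex.Re (dot (T x) (T x)) -> x = 0.
Proof.
move=> T1 xT; apply: contrapT => x0.
pose r := hnorm dot x.
have r0 : 0 < r.
  rewrite lt_def hnorm_ge0 andbT; apply/eqP => r0; apply: x0.
  by apply: sqnorm_eq0; rewrite -sqr_hnorm -/r r0 expr0n.
pose y := (r^-1)%:C%C *: x.
have y1 : complex.Re (dot y y) = 1.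
  by rewrite sqnormZH/= -sqr_hnorm -/r; field; rewrite gt_eqF.
have Ty : 1 <= hnorm dot (T y).
  rewrite -(@ler_sqr _ 1) ?nnegrE ?hnorm_ge0// sqr_hnorm expr1n.
  rewrite linearZ/= sqnormZH/= -(ler_pM2l (_ : 0 < r ^+ 2)) ?exprn_gt0//.
  rewrite mulr1 mulrA.
  have -> : r ^+ 2 * (r^-1 ^+ 2 + 0 ^+ 2) = 1 by field; rewrite gt_eqF.
  by rewrite mul1r sqr_hnorm.
have := lt_le_trans T1 Ty; rewrite ltNge => /negP; apply.
apply: ub_le_sup; last first.
  by exists y => //=; rewrite /hnorm y1 sqrtr1.
(* [sup] dominates the elements of its set only if that set is bounded above; the Hilbert-Schmidt
   norm is a bound. *)
exists (Num.sqrt (complex.Re (hs_dot dot T T))) => _ [w /= w1 <-].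
rewrite /hnorm ler_wsqrtr//; apply: (le_trans (sqnorm_apply_le T w)).
rewrite -{2}[complex.Re (hs_dot _ _ _)]mulr1 ler_wpM2l ?sqnorm_hs_ge0//.
by rewrite -sqr_hnorm exprn_ile1// hnorm_ge0.
Qed.

Lemma injective_lfun_inv (G : 'End(H)) : (forall x, G x = 0 -> x = 0) ->
  exists G' : 'End(H), (forall x, G (G' x) = x) /\ (forall x, G' (G x) = x).
Proof.
move=> G0; have /lker0P Gi : lker G == 0%VS.
  apply/eqP/vspaceP => x; rewrite memv_ker memv0.
  by apply/eqP/eqP => [/G0|->]; rewrite ?linear0.
have kG : lker G == 0%VS by apply/lker0P.
exists (G^-1)%VF; split=> x; last by rewrite lker0_lfunK.
by rewrite lker0_lfunVK.
Qed.

Lemma outer_linear (v w : H) : linear (fun x : H => dot x w *: v).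
Proof. by move=> a x y; rewrite dotDl dotZl scalerDl scalerA. Qed.

Definition outer (v w : H) : 'End(H) := sval (cid (lfun_exists (outer_linear v w))).

Lemma outerE v w x : outer v w x = dot x w *: v.
Proof. exact: svalP (cid (lfun_exists (outer_linear v w))) x. Qed.

Lemma outer_linear_l (w u v : H) (a : R[i]) :
  outer (a *: u + v) w = a *: outer u w + outer v w.
Proof.
apply/lfunP => x.
by rewrite !lfunE/= !lfunE/= !outerE scalerDr !scalerA mulrC.
Qed.

Lemma lfun_onb T : T = \sum_i outer (T (onb i)) (onb i).
Proof.
apply/lfunP => x; rewrite sum_lfunE {1}[x]onb_sum linear_sum.
by apply: eq_bigr => i _; rewrite outerE linearZ.
Qed.

End FiniteDimension.

Arguments onb {R H} dot _.

(** * Integration on the circle *)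

#[global] Instance ae_lebesgue_filter {R : realType} :
  Filter (nbhs (almost_everywhere (@lebesgue_measure R))).
Proof. exact: (ae_filter_ringOfSetsType (@lebesgue_measure R)). Qed.

Section CircleIntegral.
Context {R : realType}.
Local Notation I01 := (`[0%R, 1%R]%classic : set R).
Local Notation mu := (@lebesgue_measure R).
Implicit Types (P Q : R[i] -> Prop) (f g : R[i] -> R[i]).

Let mI01 : @measurable _ (measurableTypeR R) I01.
Proof. exact: measurable_itv. Qed.

Lemma ae_circleW P : (forall z, P z) -> ae_circle P.
Proof. by move=> Pz; apply: aeW => t _. Qed.

Lemma ae_circle_pt P : (forall t, P (circle_pt t)) -> ae_circle P.
Proof. by move=> Pz; apply: aeW => t _. Qed.

Lemma ae_circleS P Q : (forall z, P z -> Q z) -> ae_circle P -> ae_circle Q.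
Proof.
by move=> PQ; rewrite /ae_circle; apply: filterS => t Pt It; exact/PQ/Pt.
Qed.

Lemma ae_circleS2 P Q (S : R[i] -> Prop) :
  (forall z, P z -> Q z -> S z) -> ae_circle P -> ae_circle Q -> ae_circle S.
Proof.
move=> PQ; rewrite /ae_circle; apply: filterS2 => t Pt Qt It.
by apply: PQ; [exact: Pt|exact: Qt].
Qed.

Lemma circle_pt_norm (t : R) :
  complex.Re (circle_pt t) ^+ 2 + complex.Im (circle_pt t) ^+ 2 = 1.
Proof. exact: cos2Dsin2. Qed.

Lemma circle_pt_neq0 (t : R) : circle_pt t != 0.
Proof.
apply/eqP => z0; have := circle_pt_norm t; rewrite z0 /= expr0n addr0 => /eqP.
by rewrite eq_sym oner_eq0.
Qed.

Lemma circle_pt_mulJ (t : R) : circle_pt t * Num.conj (circle_pt t) = 1.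
Proof.
have := circle_pt_norm t; case: (circle_pt t) => a b /= ab.
by apply: complex_ext => /=; [rewrite -ab|]; ring.
Qed.

Lemma circle_pt_inv (t : R) : (circle_pt t)^-1 = Num.conj (circle_pt t).
Proof.
apply: (@mulfI _ (circle_pt t)); first exact: circle_pt_neq0.
by rewrite circle_pt_mulJ mulfV// circle_pt_neq0.
Qed.

Lemma circle_pt_conjX (t : R) (n : int) :
  Num.conj (circle_pt t ^ n) = circle_pt t ^ (- n).
Proof. by rewrite fmorphXz -exprz_inv circle_pt_inv. Qed.

Lemma circle_pt_normX (t : R) (n : int) :
  complex.Re (circle_pt t ^ n) ^+ 2 + complex.Im (circle_pt t ^ n) ^+ 2 = 1.
Proof.
have : circle_pt t ^ n * Num.conj (circle_pt t ^ n) = 1.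
  by rewrite circle_pt_conjX -expfzDr ?circle_pt_neq0// subrr.
move/(congr1 (@complex.Re R)); rewrite ReCM ReCJ ImCJ/= => <-; ring.
Qed.

Lemma circle_measurable_ext f g : (forall t, f (circle_pt t) = g (circle_pt t)) ->
  circle_measurable f -> circle_measurable g.
Proof.
move=> fg [fR fI]; split; [apply: eq_measurable_fun fR|apply: eq_measurable_fun fI];
by move=> t _; rewrite fg.
Qed.

Lemma circle_measurable_cst c : circle_measurable (fun=> c : R[i]).
Proof. by split; exact: measurable_cst. Qed.

Lemma circle_measurableD f g : circle_measurable f -> circle_measurable g ->
  circle_measurable (fun z => f z + g z).
Proof.
move=> [fR fI] [gR gI]; split.
  by apply: eq_measurable_fun (measurable_funD fR gR) => t _; rewrite ReCD.
by apply: eq_measurable_fun (measurable_funD fI gI) => t _; rewrite ImCD.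
Qed.

Lemma circle_measurableM f g : circle_measurable f -> circle_measurable g ->
  circle_measurable (fun z => f z * g z).
Proof.
move=> [fR fI] [gR gI]; split.
  by apply: eq_measurable_fun (measurable_funB (measurable_funM fR gR)
    (measurable_funM fI gI)) => t _; rewrite ReCM.
by apply: eq_measurable_fun (measurable_funD (measurable_funM fR gI)
  (measurable_funM fI gR)) => t _; rewrite ImCM.
Qed.

Lemma circle_measurableJ f : circle_measurable f ->
  circle_measurable (fun z => Num.conj (f z)).
Proof.
move=> [fR fI]; split.
  by apply: eq_measurable_fun fR => t _; rewrite ReCJ.
by apply: eq_measurable_fun (measurable_funN fI) => t _; rewrite ImCJ.
Qed.

Lemma circle_measurable_sum (I : Type) (r : seq I) (Q : pred I)
    (F : I -> R[i] -> R[i]) :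
  (forall i, circle_measurable (F i)) ->
  circle_measurable (fun z => \sum_(i <- r | Q i) F i z).
Proof.
move=> mF; elim: r => [|i r IH].
  by apply: circle_measurable_ext (circle_measurable_cst 0) => t; rewrite big_nil.
have [Qi|Qi] := boolP (Q i).
  by apply: circle_measurable_ext (circle_measurableD (mF i) IH) => t;
    rewrite big_cons Qi.
by apply: circle_measurable_ext IH => t; rewrite big_cons (negbTE Qi).
Qed.

Lemma circle_measurable_id : circle_measurable (fun z : R[i] => z).
Proof.
have c2 : continuous (fun t : R => 2 * pi * t).
  by move=> t; apply: cvgM; [exact: cvg_cst|exact: cvg_id].
split; apply: measurable_funTS; apply: continuous_measurable_fun => t /=.
  by apply: (@continuous_comp _ _ _ (fun t => 2 * pi * t) (@cos R));
    [exact: c2|exact: continuous_cos].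
by apply: (@continuous_comp _ _ _ (fun t => 2 * pi * t) (@sin R));
  [exact: c2|exact: continuous_sin].
Qed.

Lemma circle_measurableX f n : circle_measurable f ->
  circle_measurable (fun z => f z ^+ n).
Proof.
move=> mf; elim: n => [|n IH].
  exact: circle_measurable_ext (circle_measurable_cst 1).
by apply: circle_measurable_ext (circle_measurableM mf IH) => t; rewrite exprS.
Qed.

Lemma circle_measurable_exprz (n : int) :
  circle_measurable (fun z : R[i] => z ^ n).
Proof.
case: n => n; first exact: circle_measurableX circle_measurable_id.
apply: circle_measurable_ext
  (circle_measurableX n.+1 (circle_measurableJ circle_measurable_id)) => t.
by rewrite -circle_pt_inv exprVn.
Qed.

Definition circle_integrable f : Prop :=
  mu.-integrable I01 (fun t => (complex.Re (f (circle_pt t)))%:E) /\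
  mu.-integrable I01 (fun t => (complex.Im (f (circle_pt t)))%:E).

Lemma circle_integrable_measurable f : circle_integrable f ->
  circle_measurable f.
Proof.
by move=> [fR fI]; split; apply/measurable_EFinP;
  [exact: (measurable_int mu fR)|exact: (measurable_int mu fI)].
Qed.

Lemma circle_integrable_le f (h : R -> R) : circle_measurable f ->
  mu.-integrable I01 (EFin \o h) ->
  (forall t, `|complex.Re (f (circle_pt t))| <= h t) ->
  (forall t, `|complex.Im (f (circle_pt t))| <= h t) ->
  circle_integrable f.
Proof.
move=> [fR fI] ih hR hI.
have hle t : h t <= `|h t| by exact: ler_norm.
split.
  apply: le_integrable ih => //; first exact/measurable_EFinP.
  by move=> t _; rewrite lee_fin; exact: le_trans (hR t) (hle t).
apply: le_integrable ih => //; first exact/measurable_EFinP.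
by move=> t _; rewrite lee_fin; exact: le_trans (hI t) (hle t).
Qed.

Lemma circle_integrable_ext f g : (forall t, f (circle_pt t) = g (circle_pt t)) ->
  circle_integrable f -> circle_integrable g.
Proof.
move=> fg [fR fI]; split.
  by apply: eq_integrable fR => // t _; rewrite fg.
by apply: eq_integrable fI => // t _; rewrite fg.
Qed.

Lemma circle_integrableD f g : circle_integrable f -> circle_integrable g ->
  circle_integrable (fun z => f z + g z).
Proof.
move=> [fR fI] [gR gI]; split.
  by apply: (eq_integrable mI01 _ _ _ (integrableD mI01 fR gR)) => t _;
    rewrite ReCD EFinD.
by apply: (eq_integrable mI01 _ _ _ (integrableD mI01 fI gI)) => t _;
  rewrite ImCD EFinD.
Qed.

Lemma circle_integrableZ c f : circle_integrable f ->
  circle_integrable (fun z => c * f z).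
Proof.
move=> [fR fI]; split.
  apply: (eq_integrable mI01 _ _ _ (integrableB mI01
    (integrableZl mI01 (complex.Re c) fR)
    (integrableZl mI01 (complex.Im c) fI))) => t _.
  by rewrite ReCM EFinB !EFinM.
apply: (eq_integrable mI01 _ _ _ (integrableD mI01
    (integrableZl mI01 (complex.Re c) fI)
    (integrableZl mI01 (complex.Im c) fR))) => t _.
by rewrite ImCM EFinD !EFinM.
Qed.

Lemma circle_integrable_sum (I : Type) (r : seq I) (Q : pred I)
    (F : I -> R[i] -> R[i]) :
  (forall i, circle_integrable (F i)) ->
  circle_integrable (fun z => \sum_(i <- r | Q i) F i z).
Proof.
move=> mF; elim: r => [|i r IH].
  split; apply: (eq_integrable mI01 _ _ _ (integrable0 mu I01)) => t _;
  by rewrite big_nil.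
have [Qi|Qi] := boolP (Q i).
  by apply: circle_integrable_ext (circle_integrableD (mF i) IH) => t;
    rewrite big_cons Qi.
by apply: circle_integrable_ext IH => t; rewrite big_cons (negbTE Qi).
Qed.

Lemma circle_int_ext f g : (forall t, f (circle_pt t) = g (circle_pt t)) ->
  circle_int f = circle_int g.
Proof.
move=> fg; rewrite /circle_int; congr Complex;
by apply: eq_Rintegral => t _; rewrite fg.
Qed.

Lemma circle_int_ae f g : circle_measurable f -> circle_measurable g ->
  f =T g -> circle_int f = circle_int g.
Proof.
move=> [fR fI] [gR gI] fg; rewrite /circle_int; congr Complex;
rewrite /Rintegral; congr fine; apply: (@ae_eq_integral _ _ _ mu I01 _ _ mI01) => //;
  try exact/measurable_EFinP.
- by move: fg; rewrite /ae_circle; apply: filterS => t fgt It; rewrite fgt.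
- by move: fg; rewrite /ae_circle; apply: filterS => t fgt It; rewrite fgt.
Qed.

Lemma circle_intD f g : circle_integrable f -> circle_integrable g ->
  circle_int (fun z => f z + g z) = circle_int f + circle_int g.
Proof.
move=> [fR fI] [gR gI]; apply: complex_ext; rewrite (ReCD, ImCD) /=.
  by under eq_Rintegral do rewrite ReCD; rewrite RintegralD.
by under eq_Rintegral do rewrite ImCD; rewrite RintegralD.
Qed.

Let integrableZR (k : R) (h : R -> R) : mu.-integrable I01 (fun t => (h t)%:E) ->
  mu.-integrable I01 (fun t => (k * h t)%:E).
Proof.
move=> ih; apply: (eq_integrable mI01 _ _ _ (integrableZl mI01 k ih)) => t _.
by rewrite EFinM.
Qed.

Lemma circle_intZ c f : circle_integrable f ->
  circle_int (fun z => c * f z) = c * circle_int f.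
Proof.
move=> [fR fI]; apply: complex_ext; rewrite (ReCM, ImCM) /=.
  under eq_Rintegral do rewrite ReCM.
  by rewrite RintegralB ?RintegralZl//; exact: integrableZR.
under eq_Rintegral do rewrite ImCM.
by rewrite RintegralD ?RintegralZl//; exact: integrableZR.
Qed.

Lemma circle_intJ f : circle_integrable f ->
  circle_int (fun z => Num.conj (f z)) = Num.conj (circle_int f).
Proof.
move=> [fR fI]; apply: complex_ext; rewrite (ReCJ, ImCJ) /=.
  by under eq_Rintegral do rewrite ReCJ.
under eq_Rintegral do rewrite ImCJ -mulN1r.
by rewrite RintegralZl// mulN1r.
Qed.

Lemma circle_int_sum (I : Type) (r : seq I) (Q : pred I)
    (F : I -> R[i] -> R[i]) : (forall i, circle_integrable (F i)) ->
  circle_int (fun z => \sum_(i <- r | Q i) F i z) =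
  \sum_(i <- r | Q i) circle_int (F i).
Proof.
move=> mF; elim: r => [|i r IH].
  rewrite big_nil; apply: complex_ext => /=.
    by under eq_Rintegral do rewrite big_nil; rewrite /Rintegral integral0.
  by under eq_Rintegral do rewrite big_nil; rewrite /Rintegral integral0.
rewrite big_cons; have [Qi|Qi] := boolP (Q i); last first.
  by rewrite -IH; apply: circle_int_ext => t; rewrite big_cons (negbTE Qi).
rewrite -IH -circle_intD//; last exact: circle_integrable_sum.
by apply: circle_int_ext => t; rewrite big_cons Qi.
Qed.

Let mu01 : mu I01 = 1%E.
Proof. by rewrite lebesgue_measure_itv/= lte_fin ltr01 oppr0 adde0. Qed.

Lemma integrable_cst01 (c : R) : mu.-integrable I01 (fun=> c%:E).
Proof.
apply: (@measurable_bounded_integrable _ _ _ mu (fun=> c) I01 mI01).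
- have : (mu I01 < +oo)%E by rewrite mu01 ltry.
  by [].
- exact: measurable_cst.
- by exists `|c|; split; [exact: normr_real|move=> M cM t _ /=; exact: ltW].
Qed.

Lemma circle_integrable_cst c : circle_integrable (fun=> c : R[i]).
Proof. by split; exact: integrable_cst01. Qed.

Lemma circle_int_cst c : circle_int (fun=> c : R[i]) = c.
Proof.
have E r : \int[mu]_(t in I01) r = r.
  transitivity (r * fine (mu I01)); first exact: Rintegral_cst.
  by rewrite mu01 mulr1.
by apply: complex_ext => /=; exact: E.
Qed.


End CircleIntegral.


(** * The space L^2 *)

Section Measurability.
Context {R : realType} {V : vectType R[i]}.
Implicit Types (f : R[i] -> V) (phi : V -> R[i]).

Lemma scalar_sum phi (I : Type) (r : seq I) (a : I -> R[i]) (v : I -> V) :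
  scalar phi -> phi (\sum_(i <- r) a i *: v i) = \sum_(i <- r) a i * phi (v i).
Proof.
move=> phiL; elim: r => [|i r IH]; last by rewrite !big_cons phiL IH.
rewrite !big_nil; have := phiL 1 0 0; rewrite scaler0 addr0 mul1r => /esym/eqP.
by rewrite -subr_eq0 addrK => /eqP.
Qed.

Lemma vmeasurable_functional f phi : scalar phi -> vmeasurable f ->
  circle_measurable (fun z => phi (f z)).
Proof.
move=> phiL mf; apply: (@circle_measurable_ext _ (fun z =>
    \sum_i coord (vbasis {:V}) i (f z) * phi (vbasis {:V})`_i)) => [t|].
  by rewrite {2}(coord_vbasis (memvf (f (circle_pt t)))) scalar_sum.
apply: circle_measurable_sum => i; apply: circle_measurableM; first exact: mf.
exact: circle_measurable_cst.
Qed.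

(** [vint] is defined by coordinates in [vbasis]; this frees it from the basis and, through pairings
    with vectors, reduces vector integrals to scalar ones. *)
Lemma vint_functional f phi : scalar phi ->
  (forall i, circle_integrable (fun z => coord (vbasis {:V}) i (f z))) ->
  phi (vint f) = circle_int (fun z => phi (f z)).
Proof.
move=> phiL fi; rewrite /vint scalar_sum//.
transitivity (circle_int (fun z =>
    \sum_(i < \dim {:V}) phi (vbasis {:V})`_i * coord (vbasis {:V}) i (f z))).
  rewrite circle_int_sum; last by move=> i; exact: circle_integrableZ.
  by apply: eq_bigr => i _; rewrite circle_intZ// mulrC.
apply: circle_int_ext => t.
rewrite [in RHS](coord_vbasis (memvf (f (circle_pt t)))) scalar_sum//.
by apply: eq_bigr => i _; rewrite mulrC.
Qed.

End Measurability.

Section SquareIntegrable.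
Context {R : realType} {H : vectType R[i]}.
Variable dot : {dot H for @Num.conj R[i]}.
Local Notation I01 := (`[0%R, 1%R]%classic : set R).
Local Notation mu := (@lebesgue_measure R).
Local Notation E := (R[i] -> H).
Implicit Types (f g : R[i] -> H).
Local Notation sq f := (fun t : R =>
  complex.Re (dot (f (circle_pt t)) (f (circle_pt t)))).

Let mI01 : @measurable _ (measurableTypeR R) I01.
Proof. exact: measurable_itv. Qed.

Lemma dot_scalar w : scalar (dot^~ w).
Proof. by move=> a x y; rewrite dotDl dotZl. Qed.

Lemma vmeasurableP f :
  vmeasurable f <-> forall y, circle_measurable (fun z => dot (f z) y).
Proof.
split=> [mf y|mf i]; first exact: (vmeasurable_functional (dot_scalar y) mf).
have [w wE] := @functional_dot _ _ dot (coord (vbasis {:H}) i) (@linearP _ _ _ _ _).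
by apply: circle_measurable_ext (mf w) => t; rewrite wE.
Qed.

Lemma vmeasurable_ext f g : (forall t, f (circle_pt t) = g (circle_pt t)) ->
  vmeasurable f -> vmeasurable g.
Proof.
by move=> fg mf i; apply: circle_measurable_ext (mf i) => t; rewrite fg.
Qed.

Lemma vmeasurable_cst (x : H) : vmeasurable (fun=> x : H).
Proof. by move=> i; exact: circle_measurable_cst. Qed.

Lemma vmeasurableD f g : vmeasurable f -> vmeasurable g -> vmeasurable (f + g).
Proof.
move=> mf mg i; apply: circle_measurable_ext (circle_measurableD (mf i) (mg i)).
by move=> t; rewrite /= linearD.
Qed.

Lemma vmeasurableM (a : R[i] -> R[i]) f : circle_measurable a ->
  vmeasurable f -> vmeasurable (fun z => a z *: f z).
Proof.
move=> ma mf i; apply: circle_measurable_ext (circle_measurableM ma (mf i)).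
by move=> t; rewrite /= linearZ.
Qed.

Lemma vmeasurable_dot f g : vmeasurable f -> vmeasurable g ->
  circle_measurable (fun z => dot (f z) (g z)).
Proof.
move=> /vmeasurableP mf /vmeasurableP mg.
have -> : (fun z => dot (f z) (g z)) = (fun z => \sum_(i < onb_size dot)
    dot (f z) (onb dot i) *
    Num.conj (dot (g z) (onb dot i))).
  by apply/funext => z; rewrite -dot_onb_sum.
apply: circle_measurable_sum => i; apply: circle_measurableM => //.
exact: circle_measurableJ.
Qed.

Lemma L2_measurable f : L2 dot f -> vmeasurable f. Proof. by case. Qed.

Lemma L2_integrable f : L2 dot f -> mu.-integrable I01 (EFin \o sq f).
Proof.
move=> [mf fi]; apply/integrableP; split.
  by apply/measurable_EFinP; case: (vmeasurable_dot mf mf).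
apply: le_lt_trans fi; rewrite le_eqVlt; apply/orP; left; apply/eqP.
by apply: eq_integral => t _ /=; rewrite ger0_norm// sqnorm_ge0.
Qed.

Lemma L2_dominated f (h : R -> R) : vmeasurable f ->
  mu.-integrable I01 (EFin \o h) ->
  {ae mu, forall t, I01 t -> sq f t <= h t} -> L2 dot f.
Proof.
move=> mf ih fh; split=> //; have /integrableP[mh hoo] := ih.
apply: le_lt_trans hoo; apply: (@ae_ge0_le_integral _ _ _ mu I01 mI01) => //.
- by move=> t _; rewrite lee_fin sqnorm_ge0.
- by apply/measurable_EFinP; case: (vmeasurable_dot mf mf).
- by apply: measurableT_comp.
- move: fh; apply: filterS => t fh It; rewrite lee_fin.
  by apply: le_trans (fh It) _; exact: ler_norm.
Qed.

Lemma L2_ae f g : vmeasurable g -> f =T g -> L2 dot f -> L2 dot g.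
Proof.
move=> mg fg Lf; apply: L2_dominated (L2_integrable Lf) _ => //.
by move: fg; rewrite /ae_circle; apply: filterS => t fg It; rewrite fg.
Qed.

Lemma L2_le f g (C : R) : vmeasurable f -> L2 dot g ->
  ae_circle (fun z => complex.Re (dot (f z) (f z)) <=
                      C * complex.Re (dot (g z) (g z))) -> L2 dot f.
Proof.
move=> mf Lg fg; apply: (L2_dominated mf (h := fun t => C * sq g t)).
  apply: (eq_integrable mI01 _ _ _ (integrableZl mI01 C (L2_integrable Lg))).
  by move=> t _; rewrite /= EFinM.
by move: fg; rewrite /ae_circle; apply: filterS => t fg It; exact: fg.
Qed.

Lemma L2_bounded f (C : R) : vmeasurable f ->
  ae_circle (fun z => complex.Re (dot (f z) (f z)) <= C) -> L2 dot f.
Proof.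
move=> mf fC; apply: (L2_dominated mf (h := fun=> C)).
  exact: integrable_cst01.
by move: fC; rewrite /ae_circle; apply: filterS => t fC It; exact: fC.
Qed.

Lemma L2_cst (x : H) : L2 dot (fun=> x).
Proof.
apply: (L2_bounded (C := complex.Re (dot x x))); first exact: vmeasurable_cst.
exact: ae_circleW.
Qed.

Lemma L2_exprz f (n : int) : L2 dot f -> L2 dot (fun z => z ^ n *: f z).
Proof.
move=> Lf; apply: (L2_le (C := 1) _ Lf).
  by apply: vmeasurableM; [exact: circle_measurable_exprz|case: Lf].
by apply: ae_circle_pt => t; rewrite sqnormZH circle_pt_normX.
Qed.

Lemma L2_subspace : linear_subspace (L2 dot : set E).
Proof.
split=> [|a f g Lf Lg]; first exact: (L2_cst 0).
have mf := L2_measurable Lf; have mg := L2_measurable Lg.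
have maf : vmeasurable (fun z => a *: f z).
  by apply: vmeasurableM => //; exact: circle_measurable_cst.
set h := a *: f + g.
apply: (L2_dominated (h := fun t => 2 * (complex.Re a ^+ 2 + complex.Im a ^+ 2) *
    sq f t + 2 * sq g t)).
- exact: vmeasurableD.
- apply: (eq_integrable mI01 _ _ _ (integrableD mI01
    (integrableZl mI01 (2 * (complex.Re a ^+ 2 + complex.Im a ^+ 2))
      (L2_integrable Lf)) (integrableZl mI01 2 (L2_integrable Lg)))) => t _.
  by rewrite /= EFinD !EFinM.
- apply: aeW => t _; apply: le_trans (sqnormD_leH dot _ _) _.
  by rewrite sqnormZH !mulrA.
Qed.

Lemma L2dot_integrable f g : L2 dot f -> L2 dot g ->
  circle_integrable (fun z => dot (f z) (g z)).
Proof.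
move=> Lf Lg; apply: (circle_integrable_le (h := fun t => sq f t + sq g t)).
- by apply: vmeasurable_dot; [case: Lf|case: Lg].
- exact: (integrableD mI01 (L2_integrable Lf) (L2_integrable Lg)).
- by move=> t; exact: norm_Re_dot_le.
- by move=> t; exact: norm_Im_dot_le.
Qed.

Lemma L2dot_linear (a : R[i]) f g h : L2 dot f -> L2 dot g -> L2 dot h ->
  L2dot dot (a *: f + g) h = a * L2dot dot f h + L2dot dot g h.
Proof.
move=> Lf Lg Lh; have if_ := L2dot_integrable Lf Lh.
have ig := L2dot_integrable Lg Lh.
rewrite /L2dot -circle_intZ// -circle_intD//; last exact: circle_integrableZ.
by apply: circle_int_ext => t; rewrite dotDl dotZl.
Qed.

Lemma L2dot_conj f g : L2 dot f -> L2 dot g ->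
  L2dot dot g f = Num.conj (L2dot dot f g).
Proof.
move=> Lf Lg; rewrite /L2dot -circle_intJ; last exact: L2dot_integrable.
by apply: circle_int_ext => t; rewrite -dot_conj.
Qed.

Lemma L2dot_ge0 f : 0 <= complex.Re (L2dot dot f f).
Proof. by apply: Rintegral_ge0 => t _; exact: sqnorm_ge0. Qed.

Lemma L2dot_ae f f' g g' : L2 dot f -> L2 dot f' -> L2 dot g -> L2 dot g' ->
  f =T f' -> g =T g' -> L2dot dot f g = L2dot dot f' g'.
Proof.
move=> Lf Lf' Lg Lg' ff' gg'; apply: circle_int_ae.
- exact: circle_integrable_measurable (L2dot_integrable Lf Lg).
- exact: circle_integrable_measurable (L2dot_integrable Lf' Lg').
- by apply: ae_circleS2 ff' gg' => z -> ->.
Qed.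

Lemma L2_eq0 f : L2 dot f -> complex.Re (L2dot dot f f) = 0 ->
  f =T (fun=> 0).
Proof.
move=> Lf f0; have fi := L2_integrable Lf.
have mf : measurable_fun I01 (EFin \o sq f) by exact: measurable_int fi.
have : (\int[mu]_(t in I01) `|(sq f t)%:E|)%E = 0%E.
  have : (\int[mu]_(t in I01) (sq f t)%:E)%E = 0%E.
    rewrite -[LHS]fineK; first by congr EFin; exact: f0.
    exact: integrable_fin_num.
  move=> <-; apply: eq_integral => t _ /=.
  by rewrite ger0_norm// sqnorm_ge0.
move=> /(ae_eq_integral_abs mu mI01 mf); rewrite /ae_circle.
apply: filterS => t ft It; apply: (@sqnorm_eq0 _ _ dot).
by have [] := ft It.
Qed.

End SquareIntegrable.

(** * Sequences with geometrically small increments *)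

Section FastConvergence.
Context {R : realType}.

Lemma fast_cvg (x : nat -> R) (C : R) :
  (forall k, (x k.+1 - x k) ^+ 2 <= C * 3^-1 ^+ k) -> cvgn x.
Proof.
move=> xC.
have C0 : 0 <= C by have := xC 0%N; rewrite expr0 mulr1; apply: le_trans; exact: sqr_ge0.
have -> : x = (fun n => x 0%N + series (telescope x) n).
  by apply/funext => n; exact: eq_sum_telescope.
apply: is_cvgD; first exact: is_cvg_cst.
apply: normed_cvg.
apply: (@series_le_cvg _ _ (geometric (C + 1) (2 / 3))) => [n|n|n|].
- exact: normr_ge0.
- by rewrite /geometric/= mulr_ge0 ?exprn_ge0//; lra.
- rewrite /geometric/= /telescope/=; set d := x n.+1 - x n.
  have dC : d ^+ 2 <= C * 3^-1 ^+ n by exact: xC.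
  have p2 : (0 : R) < 2 ^+ n by rewrite exprn_gt0.
  (* The weight 2^n avoids the square root of 3^-n: since 1 < 2 < 3, both terms decay geometrically,
     at most like (2/3)^n. *)
  have : 2 * `|d| <= 2 ^+ n * d ^+ 2 + (2 ^+ n)^-1.
    have := sqr_ge0 (2 ^+ n * `|d| - 1); rewrite sqrrB expr1n mulr1 exprMn real_normK ?num_real//.
    move=> h; rewrite -(ler_pM2l p2) mulrDr mulfV ?gt_eqF//; lra.
  have e23 : (2 / 3) ^+ n = 2 ^+ n * 3^-1 ^+ n :> R by rewrite exprMn.
  have e12 : (2 ^+ n)^-1 <= (2 / 3) ^+ n :> R.
    by rewrite -exprVn; apply: lerXn2r; rewrite ?nnegrE; lra.
  have : 2 ^+ n * d ^+ 2 <= C * (2 / 3) ^+ n.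
    by rewrite e23; have := ler_wpM2l (ltW p2) dC; lra.
  have : 0 <= (C + 1) * (2 / 3) ^+ n by rewrite mulr_ge0 ?exprn_ge0//; lra.
  lra.
- by apply: is_cvg_geometric_series; rewrite ger0_norm; lra.
Qed.

(** A limit superior is measurable in a parameter for every sequence of measurable functions, even
    where the sequence diverges, as it may on a null set. *)
Definition real_limit (x : nat -> R) : R := fine (limn_esup (EFin \o x)).

Lemma real_limit_cvg (x : nat -> R) : cvgn x -> x n @[n --> \oo] --> real_limit x.
Proof.
move=> cx; rewrite /real_limit is_cvg_limn_esupE; first by rewrite EFin_lim.
by apply/cvg_ex; exists (limn x)%:E; apply: cvg_EFin => //; exact: nearW.
Qed.

Lemma geometric34_sum_le n : \sum_(0 <= k < n) (3 / 4) ^+ k <= 4 :> R.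
Proof.
have -> : \sum_(0 <= k < n) (3 / 4) ^+ k = 4 - 4 * (3 / 4) ^+ n :> R.
  elim: n => [|n IH]; first by rewrite big_geq// expr0; lra.
  by rewrite big_nat_recr//= IH exprS; lra.
by have : (0 : R) <= (3 / 4) ^+ n by [rewrite exprn_ge0//; lra]; lra.
Qed.

End FastConvergence.

(** * Completeness of L^2 *)

Section L2Complete.
Context {R : realType} {H : vectType R[i]}.
Variable dot : {dot H for @Num.conj R[i]}.
Local Notation I01 := (`[0%R, 1%R]%classic : set R).
Local Notation mu := (@lebesgue_measure R).
Local Notation sq f t := (complex.Re (dot (f (circle_pt t)) (f (circle_pt t)))).

Let mI01 : @measurable _ (measurableTypeR R) I01.
Proof. exact: measurable_itv. Qed.

(** The constant 6 solves c = 2 c / 3 + 2, the recursion obtained by splitting off the first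
    increment with |x + y|^2 <= 2 |x|^2 + 2 |y|^2. *)
Lemma fast_sqdist (x : nat -> H) (C : R) :
  (forall k, complex.Re (dot (x k.+1 - x k) (x k.+1 - x k)) <= C * 3^-1 ^+ k) ->
  forall n m, complex.Re (dot (x (n + m)%N - x n) (x (n + m)%N - x n)) <=
    6 * C * 3^-1 ^+ n.
Proof.
move=> xC n m; have C0 : 0 <= C.
  by have := xC 0%N; rewrite expr0 mulr1; apply: le_trans; exact: sqnorm_ge0.
elim: m n => [|m IH] n.
  rewrite addn0 subrr dot0l /= !mulr_ge0 ?exprn_ge0//; lra.
have := IH n.+1; rewrite addSnnS exprS => h1.
have h0 := xC n.
rewrite -[x (n + m.+1)%N](subrK (x n.+1)) -addrA.
by apply: le_trans (sqnormD_leH dot _ _) _; lra.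
Qed.

Definition pointwise_limit (u : nat -> R[i] -> H) (z : R[i]) : H :=
  \sum_(i < onb_size dot)
    Complex (real_limit (fun n => complex.Re (dot (u n z) (onb dot i))))
            (real_limit (fun n => complex.Im (dot (u n z) (onb dot i)))) *: onb dot i.

Lemma dot_pointwise_limit u z i : dot (pointwise_limit u z) (onb dot i) =
  Complex (real_limit (fun n => complex.Re (dot (u n z) (onb dot i))))
          (real_limit (fun n => complex.Im (dot (u n z) (onb dot i)))).
Proof.
rewrite dot_suml (bigD1 i)//= dotZl dot_onb eqxx mulr1 big1 ?addr0// => j ji.
by rewrite dotZl dot_onb (negbTE ji) mulr0.
Qed.

Lemma measurable_real_limit (h : nat -> R -> R) :
  (forall n, measurable_fun I01 (h n)) ->
  measurable_fun I01 (fun t => real_limit (h ^~ t)).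
Proof.
move=> mh; apply: measurableT_comp => //.
by apply: measurable_fun_limn_esup => n; exact/measurable_EFinP.
Qed.

Lemma vmeasurable_pointwise_limit u : (forall n, vmeasurable (u n)) ->
  vmeasurable (pointwise_limit u).
Proof.
move=> mu_; apply/(vmeasurableP dot) => y.
have -> : (fun z => dot (pointwise_limit u z) y) =
    (fun z => \sum_(i < onb_size dot)
       Complex (real_limit (fun n => complex.Re (dot (u n z) (onb dot i))))
           (real_limit (fun n => complex.Im (dot (u n z) (onb dot i)))) *
       dot (onb dot i) y).
  by apply/funext => z; rewrite dot_suml; apply: eq_bigr => i _; rewrite dotZl.
apply: circle_measurable_sum => i; apply: circle_measurableM; last first.
  exact: circle_measurable_cst.
have m n : circle_measurable (fun z => dot (u n z) (onb dot i)).
  by have [+ _] := vmeasurableP dot (u n); apply.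
split; apply: measurable_real_limit => n; by case: (m n).
Qed.

Lemma pointwise_limit_sqdist (u : nat -> R[i] -> H) z (C : R) :
  (forall k, complex.Re (dot (u k.+1 z - u k z) (u k.+1 z - u k z)) <=
    C * 3^-1 ^+ k) ->
  forall n, complex.Re (dot (u n z - pointwise_limit u z)
                            (u n z - pointwise_limit u z)) <= 6 * C * 3^-1 ^+ n.
Proof.
move=> uC n; set x := fun k => u k z.
have xlim i : (complex.Re (dot (x m) (onb dot i)) @[m --> \oo] -->
      complex.Re (dot (pointwise_limit u z) (onb dot i))) /\
    (complex.Im (dot (x m) (onb dot i)) @[m --> \oo] -->
      complex.Im (dot (pointwise_limit u z) (onb dot i))).
  have key k : (complex.Re (dot (x k.+1) (onb dot i)) - complex.Re (dot (x k) (onb dot i))) ^+ 2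
     + (complex.Im (dot (x k.+1) (onb dot i)) - complex.Im (dot (x k) (onb dot i))) ^+ 2 <=
     C * 3^-1 ^+ k.
    apply: le_trans (uC k).
    have := dot_Cauchy_Schwarz dot (x k.+1 - x k) (onb dot i).
    by rewrite dot_onb eqxx /= mulr1 dotBl !(ReCD, ImCD, ReCN, ImCN).
  rewrite dot_pointwise_limit/=; split; apply: real_limit_cvg;
    apply: (@fast_cvg _ _ C) => k; apply: le_trans (key k).
  - by rewrite lerDl sqr_ge0.
  - by rewrite lerDr sqr_ge0.
have cv : complex.Re (dot (u n z - x m) (u n z - x m)) @[m --> \oo] -->
    complex.Re (dot (u n z - pointwise_limit u z) (u n z - pointwise_limit u z)).
  rewrite [X in _ --> X](sqnorm_onb dot).
  under eq_fun do rewrite (sqnorm_onb dot).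
  apply: cvg_big => [|i _]; first exact: add_continuous.
  rewrite !dotBl !(ReCD, ImCD, ReCN, ImCN).
  under eq_fun do rewrite !dotBl !(ReCD, ImCD, ReCN, ImCN).
  have [cR cI] := xlim i.
  by apply: cvgD; apply: cvgM; apply: cvgB => //; exact: cvg_cst.
rewrite -(cvg_lim _ cv)//; apply: limr_le; first by apply/cvg_ex; eexists; exact: cv.
exists n => // m /= nm.
have := fast_sqdist uC n (m - n)%N; rewrite subnKC//.
by rewrite -opprB -scaleN1r sqnormZH/= -/(x m) oppr0 expr0n/= addr0 sqrrN expr1n mul1r.
Qed.

(** Riesz-Fischer. The sum G of 3^n |u_(n+1) - u_n|^2 has integral at most sum (3/4)^n = 4, hence is
    finite a.e. There |u_(n+1) - u_n|^2 <= G 3^-n, so u_n converges pointwise, and 6 G 3^-n is an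
    integrable bound for |u_n - l|^2, which gives both membership of l in L^2 and convergence in
    norm. *)
Lemma L2_complete (u : nat -> R[i] -> H) : (forall n, L2 dot (u n)) ->
  (forall n, complex.Re (L2dot dot (u n.+1 - u n) (u n.+1 - u n)) <= 4^-1 ^+ n) ->
  exists2 l, L2 dot l &
    complex.Re (L2dot dot (u n - l) (u n - l)) @[n --> \oo] --> (0 : R).
Proof.
move=> Lu ufast.
have LB f g : L2 dot f -> L2 dot g -> L2 dot (f - g).
  by apply: subspaceB; exact: L2_subspace.
have Ld n : L2 dot (u n.+1 - u n) by exact: LB.
pose g n (t : R) : \bar R := (3 ^+ n * sq (u n.+1 - u n) t)%:E.
have g0 n t : (0 <= g n t)%E.
  by rewrite lee_fin mulr_ge0 ?exprn_ge0 ?sqnorm_ge0//; lra.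
have gi n : mu.-integrable I01 (g n).
  apply: (eq_integrable mI01 _ _ _ (integrableZl mI01 (3 ^+ n) (L2_integrable (Ld n)))).
  by move=> t _; rewrite /g /= EFinM.
have mg n : measurable_fun I01 (g n) by exact: measurable_int (gi n).
have intg n : (\int[mu]_(t in I01) g n t <= ((3 / 4) ^+ n)%:E)%E.
  have -> : (\int[mu]_(t in I01) g n t =
      (3 ^+ n * complex.Re (L2dot dot (u n.+1 - u n) (u n.+1 - u n)))%:E)%E.
    rewrite /= -(RintegralZl _ mI01 (L2_integrable (Ld n))).
    by rewrite /Rintegral fineK//; exact: integrable_fin_num (gi n).
  by rewrite lee_fin exprMn ler_pM2l ?exprn_gt0.
pose G t := (\sum_(n <oo) g n t)%E.
have mG : measurable_fun I01 G by exact: ge0_emeasurable_sum.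
have G0 t : (0 <= G t)%E by apply: nneseries_ge0 => n _ _; exact: g0.
have intG : (\int[mu]_(t in I01) G t <= 4%:E)%E.
  rewrite integral_nneseries//; apply: lime_le.
    by apply: is_cvg_nneseries => n _ _; exact: integral_ge0.
  apply: nearW => n; apply: (@le_trans _ _ (\sum_(0 <= k < n) ((3 / 4) ^+ k)%:E)%E).
    by apply: lee_sum => k _; exact: intg.
  by rewrite sumEFin lee_fin; exact: geometric34_sum_le.
have Gi : mu.-integrable I01 G.
  apply/integrableP; split=> //.
  under eq_integral do rewrite gee0_abs//.
  by apply: le_lt_trans intG _; rewrite ltry.
pose h t := fine (G t).
have hi : mu.-integrable I01 (EFin \o h).
  apply: le_integrable Gi => //.
    by apply/measurable_EFinP; exact: measurableT_comp.
  move=> t _; rewrite /h /= (gee0_abs (G0 t)) ger0_norm ?fine_ge0//.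
  by case: (G t) (G0 t) => [r| |] //=; rewrite ?leey.
pose l := pointwise_limit u.
have Gfin : {ae mu, forall t, I01 t -> G t \is a fin_num}.
  exact: integrable_ae.
have le_h n : {ae mu, forall t, I01 t -> sq (u n - l) t <= 6 * 3^-1 ^+ n * h t}.
  move: Gfin; apply: filterS => t Gt It.
  rewrite -mulrA [3^-1 ^+ n * _]mulrC mulrA.
  apply: pointwise_limit_sqdist => k.
  have gG : (g k t <= G t)%E.
    have := @nneseries_lim_ge R (fun n => g n t) xpredT 0 k.+1 (fun n _ _ => g0 n t).
    apply: le_trans; rewrite big_nat_recr//=.
    by rewrite leeDr//; apply: sume_ge0 => j _; exact: g0.
  rewrite -(fineK (Gt It)) lee_fin -/(h t) mulrC in gG.
  by rewrite exprVn ler_pdivlMr// exprn_gt0.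
have ml : vmeasurable l.
  by apply: vmeasurable_pointwise_limit => n; case: (Lu n).
have bi n : mu.-integrable I01 (EFin \o (fun t => 6 * 3^-1 ^+ n * h t)).
  apply: (eq_integrable mI01 _ _ _ (integrableZl mI01 (6 * 3^-1 ^+ n) hi)).
  by move=> t _; rewrite /= EFinM.
have mul n : vmeasurable (u n - l).
  rewrite -scaleN1r; apply: vmeasurableD; first by case: (Lu n).
  by apply: (vmeasurableM _ ml); exact: circle_measurable_cst.
have Lul n : L2 dot (u n - l) by exact: L2_dominated (mul n) (bi n) (le_h n).
have Ll : L2 dot l.
  rewrite (_ : l = u 0%N - (u 0%N - l)); last by rewrite opprB addrC subrK.
  exact: LB.
exists l => //.
have int_le n : complex.Re (L2dot dot (u n - l) (u n - l)) <=
    6 * (\int[mu]_(t in I01) h t) * 3^-1 ^+ n.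
  have -> : 6 * (\int[mu]_(t in I01) h t) * 3^-1 ^+ n =
      \int[mu]_(t in I01) (6 * 3^-1 ^+ n * h t).
    by rewrite RintegralZl//; ring.
  rewrite /L2dot/= /Rintegral; apply: fine_le.
  - exact: integrable_fin_num (L2_integrable (Lul n)).
  - exact: integrable_fin_num (bi n).
  apply: (@ae_ge0_le_integral _ _ _ mu I01 mI01).
  - by move=> t _; rewrite lee_fin sqnorm_ge0.
  - exact: measurable_int (L2_integrable (Lul n)).
  - by move=> t _; rewrite lee_fin !mulr_ge0 ?exprn_ge0 ?fine_ge0//; lra.
  - exact: measurable_int (bi n).
  - by move: (le_h n); apply: filterS => t ht It; rewrite lee_fin; exact: ht.
apply: (squeeze_cvgr (f := fun=> 0)
    (h := geometric (6 * (\int[mu]_(t in I01) h t)) 3^-1)).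
- by apply: nearW => n; rewrite L2dot_ge0 int_le.
- exact: cvg_cst.
- by apply: cvg_geometric; rewrite ger0_norm; lra.
Qed.

Lemma L2_hilbert : hilbert (L2 dot) (L2dot dot).
Proof.
split.
- exact: L2_subspace.
- by move=> a f g h Lf Lg Lh; exact: L2dot_linear.
- by move=> f g Lf Lg; exact: L2dot_conj.
- by move=> f _; exact: L2dot_ge0.
- exact: L2_complete.
Qed.

End L2Complete.

(** * Uniqueness of Fourier coefficients *)

Section Threshold.
Context {R : realType}.
Implicit Types x y : R.

(* On [0, 1] these polynomials converge to 1 below 1/2 and to 0 above 1/2. *)
Definition threshold (n : nat) x : R := (1 - x ^+ n) ^+ (2 ^ n)%N.

Lemma bernoulli_ge y m : 0 <= y <= 1 -> 1 - m%:R * y <= (1 - y) ^+ m.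
Proof.
move=> /andP[y0 y1]; elim: m => [|m IH]; first by rewrite mul0r subr0 expr0.
rewrite exprS -natr1; have m0 : (0 : R) <= m%:R by [].
apply: (@le_trans _ _ ((1 - y) * (1 - m%:R * y))); first by nra.
by rewrite ler_wpM2l// subr_ge0.
Qed.

Lemma bernoulli_inv y m : 0 <= y <= 1 -> (1 - y) ^+ m * (1 + m%:R * y) <= 1.
Proof.
move=> /andP[y0 y1]; elim: m => [|m IH]; first by rewrite mul0r addr0 expr0 mulr1.
apply: le_trans IH; rewrite exprSr -mulrA ler_wpM2l ?exprn_ge0 ?subr_ge0//.
by rewrite -natr1; have m0 : (0 : R) <= m%:R by []; nra.
Qed.

Lemma threshold_itv n x : 0 <= x <= 1 -> 0 <= threshold n x <= 1.
Proof.
move=> /andP[x0 x1]; have xn0 : 0 <= x ^+ n by rewrite exprn_ge0.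
have xn1 : x ^+ n <= 1 by rewrite exprn_ile1.
by rewrite exprn_ge0 ?exprn_ile1 ?subr_ge0//= lerBlDr lerDl.
Qed.

(** Bernoulli's inequality with y = x^n and 2^n factors bounds the value below by 1 - (2 x)^n. *)
Lemma threshold_cvg1 x : 0 <= x < 2^-1 -> threshold n x @[n --> \oo] --> (1 : R).
Proof.
move=> /andP[x0 x2]; have x01 : 0 <= x <= 1 by apply/andP; split; lra.
apply: (squeeze_cvgr (f := fun n => 1 - geometric 1 (2 * x) n) (h := fun=> 1)).
- apply: nearW => n; have /andP[_ ->] := threshold_itv n x01; rewrite andbT.
  have y01 : 0 <= x ^+ n <= 1 by rewrite exprn_ge0//= exprn_ile1//; lra.
  apply: le_trans (bernoulli_ge _ y01).
  by rewrite /geometric/= mul1r exprMn natrX.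
- rewrite -[X in _ --> X]subr0; apply: cvgB; first exact: cvg_cst.
  by apply: cvg_geometric; rewrite ger0_norm; lra.
- exact: cvg_cst.
Qed.

(** Here [bernoulli_inv] bounds the value by the inverse of (2 x)^n, which grows because 2 x > 1. *)
Lemma threshold_cvg0 x : 2^-1 < x <= 1 -> threshold n x @[n --> \oo] --> (0 : R).
Proof.
move=> /andP[x2 x1]; have x01 : 0 <= x <= 1 by apply/andP; split; lra.
apply: (squeeze_cvgr (f := fun=> 0) (h := geometric 1 (2 * x)^-1)).
- apply: nearW => n; have /andP[t0 _] := threshold_itv n x01; rewrite t0/=.
  have y01 : 0 <= x ^+ n <= 1 by rewrite exprn_ge0 ?exprn_ile1//; lra.
  have xp : 0 < (2 * x) ^+ n by rewrite exprn_gt0//; lra.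
  rewrite /geometric/= mul1r exprVn -div1r ler_pdivlMr//.
  apply: le_trans (bernoulli_inv (2 ^ n) y01); rewrite ler_wpM2l//.
  by rewrite natrX -exprMn lerDr.
- exact: cvg_cst.
- apply: cvg_geometric; rewrite ger0_norm ?invr_ge0; last by lra.
  by rewrite invf_lt1; lra.
Qed.

End Threshold.

Section TrigonometricPolynomials.
Context {R : realType}.
Implicit Types p q f : R[i] -> R[i].

Definition trig_poly p : Prop := exists s : seq (R[i] * int),
  forall t, p (circle_pt t) = \sum_(a <- s) a.1 * circle_pt t ^ a.2.

Lemma trig_poly_monomial c n : trig_poly (fun z => c * z ^ n).
Proof. by exists [:: (c, n)] => t; rewrite big_seq1. Qed.

Lemma trig_poly_ext p q : (forall t, p (circle_pt t) = q (circle_pt t)) ->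
  trig_poly p -> trig_poly q.
Proof. by move=> pq [s ps]; exists s => t; rewrite -pq. Qed.

Lemma trig_poly_cst c : trig_poly (fun=> c).
Proof. by apply: trig_poly_ext (trig_poly_monomial c 0) => t; rewrite mulr1. Qed.

Lemma trig_polyD p q : trig_poly p -> trig_poly q ->
  trig_poly (fun z => p z + q z).
Proof. by move=> [s ps] [r qr]; exists (s ++ r) => t; rewrite big_cat/= ps qr. Qed.

Lemma trig_polyM p q : trig_poly p -> trig_poly q ->
  trig_poly (fun z => p z * q z).
Proof.
move=> [s ps] [r qr].
exists [seq (a.1 * b.1, a.2 + b.2) | a <- s, b <- r] => t.
rewrite big_allpairs_dep ps qr mulr_suml; apply: eq_bigr => a _.
rewrite mulr_sumr; apply: eq_bigr => b _ /=.
by rewrite expfzDr ?circle_pt_neq0// mulrACA.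
Qed.

Lemma trig_polyX p n : trig_poly p -> trig_poly (fun z => p z ^+ n).
Proof.
move=> pp; elim: n => [|n IH].
  by apply: trig_poly_ext (trig_poly_cst 1) => t; rewrite expr0.
by apply: trig_poly_ext (trig_polyM pp IH) => t; rewrite exprS.
Qed.

Lemma circle_integrableM_exprz f (n : int) : circle_integrable f ->
  circle_integrable (fun z => z ^ n * f z).
Proof.
move=> [fR fI].
pose h t : R := `|complex.Re (f (circle_pt t))| + `|complex.Im (f (circle_pt t))|.
have mI : @measurable _ (measurableTypeR R) `[0%R, 1%R]%classic.
  exact: measurable_itv.
have ih : (@lebesgue_measure R).-integrable `[0%R, 1%R]%classic (EFin \o h).
  have := integrableD mI (integrable_norm fR) (integrable_norm fI).
  exact.
have mzf := circle_measurableM (circle_measurable_exprz n)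
  (circle_integrable_measurable (conj fR fI)).
have le1 t : `|complex.Re (circle_pt t ^ n)| <= 1 /\
             `|complex.Im (circle_pt t ^ n : R[i])| <= 1.
  have := circle_pt_normX t n.
  move: (complex.Re _) (complex.Im _) => a b ab.
  by have := sqr_ge0 a; have := sqr_ge0 b => ? ?;
    rewrite !ler_norml; split; apply/andP; split; nra.
apply: (circle_integrable_le mzf ih) => t.
  have [a1 b1] := le1 t; rewrite ReCM /h.
  apply: le_trans (ler_normB _ _) _; rewrite !normrM.
  by apply: lerD; apply: ler_piMl.
have [a1 b1] := le1 t; rewrite ImCM /h addrC.
apply: le_trans (ler_normD _ _) _; rewrite !normrM.
by apply: lerD; apply: ler_piMl.
Qed.

Lemma circle_int_trig_poly f p : circle_integrable f ->
  (forall n : int, circle_int (fun z => z ^ n * f z) = 0) ->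
  trig_poly p -> circle_int (fun z => p z * f z) = 0.
Proof.
move=> fi f0 [s ps].
transitivity (circle_int (fun z => \sum_(a <- s) a.1 * (z ^ a.2 * f z))).
  apply: circle_int_ext => t; rewrite ps mulr_suml.
  by apply: eq_bigr => a _; rewrite mulrA.
rewrite circle_int_sum => [|a]; last first.
  exact/circle_integrableZ/circle_integrableM_exprz.
rewrite big1// => a _; rewrite circle_intZ ?f0 ?mulr0//.
exact: circle_integrableM_exprz.
Qed.

End TrigonometricPolynomials.

Section FourierUniqueness.
Context {R : realType}.
Local Notation I01 := (`[0%R, 1%R]%classic : set R).
Local Notation mu := (@lebesgue_measure R).
Implicit Types (f : R[i] -> R[i]) (u : R -> R) (b t : R).

Let mI01 : @measurable _ (measurableTypeR R) I01.
Proof. exact: measurable_itv. Qed.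

Lemma ae_neq (a : R) : {ae mu, forall t, t <> a}.
Proof.
exists [set a]; split; [exact: measurable_set1|exact: lebesgue_measure_set1|].
by move=> t /= /contrapT.
Qed.

(** A trigonometric polynomial of degree one, centred at the midpoint b/2 of the arc [0, b] and
    equal to 1/2 at its ends. The factor 1/4 keeps its values in [0, 1], so that
    [1 - threshold n (arc_level b t)] tends to the indicator of the arc away from the ends. *)
Definition arc_level b t : R :=
  2^-1 + 4^-1 * (cos (2 * pi * (t - b / 2)) - cos (pi * b)).

Lemma arc_level_itv b t : 0 <= arc_level b t <= 1.
Proof.
rewrite /arc_level.
have := cos_le1 (pi * b); have := cos_geN1 (pi * b).
have := cos_le1 (2 * pi * (t - b / 2)); have := cos_geN1 (2 * pi * (t - b / 2)).
by move=> *; apply/andP; split; lra.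
Qed.

Lemma arc_level_gt b t : 0 < b < 1 -> 0 < t < b -> 2^-1 < arc_level b t.
Proof.
move=> /andP[b0 b1] /andP[t0 tb]; rewrite /arc_level.
have p0 := pi_gt0 R.
suff : cos (pi * b) < cos (2 * pi * (t - b / 2)) by lra.
have [s0|s0] := leP 0 (t - b / 2).
  by rewrite ltr_cos ?in_itv/= ?inE/=; [nra|apply/andP; split; nra..].
rewrite -[in X in _ < X]cosN ltr_cos ?in_itv/= ?inE/=; first by nra.
  by apply/andP; split; nra.
by apply/andP; split; nra.
Qed.

Lemma arc_level_lt b t : 0 < b < 1 -> b < t < 1 -> arc_level b t < 2^-1.
Proof.
move=> /andP[b0 b1] /andP[t0 tb]; rewrite /arc_level.
have p0 := pi_gt0 R.
have pt1 : 0 < pi * (1 - t) by rewrite mulr_gt0// subr_gt0.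
have pbt : 0 < pi * (t - b) by rewrite mulr_gt0// subr_gt0.
have pb : 0 < pi * b by rewrite mulr_gt0.
have pb1 : 0 < pi * (1 - b) by rewrite mulr_gt0// subr_gt0.
suff : cos (2 * pi * (t - b / 2)) < cos (pi * b) by lra.
have [s0|s0] := leP (2 * pi * (t - b / 2)) pi.
  by rewrite ltr_cos ?in_itv/= ?inE/=; [lra|apply/andP; split; lra..].
(* The angle x lies beyond pi here; its reflection 2 pi - x has the same cosine and lies in
   [0, pi]. *)
rewrite -[in X in X < _]cosN -cosD2pi -mulr_natl ltr_cos ?in_itv/= ?inE/=.
- by lra.
- by apply/andP; split; lra.
- by apply/andP; split; lra.
Qed.

(** Dominated convergence with the bound |u|: the weights lie in [0, 1] and tend to the indicator of
    [0, b] almost everywhere. *)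
Lemma prefix_integral_eq0 u b : 0 < b < 1 ->
  mu.-integrable I01 (EFin \o u) ->
  (forall n, \int[mu]_(t in I01) ((1 - threshold n (arc_level b t)) * u t) = 0) ->
  \int[mu]_(t in `[0, b]) u t = 0.
Proof.
move=> b01 iu u0; have /andP[b0 b1] := b01.
have mu_ : measurable_fun I01 u by apply/measurable_EFinP; exact: measurable_int iu.
have marc : measurable_fun I01 (arc_level b).
  apply: measurable_funTS; apply: continuous_measurable_fun => t.
  apply: cvgD; first exact: cvg_cst.
  apply: cvgMr; apply: cvgB; last exact: cvg_cst.
  apply: (@continuous_comp _ _ _ (fun t => 2 * pi * (t - b / 2)) (@cos R)).
    by apply: cvgMr; apply: cvgB; [exact: cvg_id|exact: cvg_cst].
  exact: continuous_cos.
pose h n t : R := (1 - threshold n (arc_level b t)) * u t.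
have mh n : measurable_fun I01 (h n).
  apply: measurable_funM => //; apply: measurable_funB => //.
  apply: measurable_funX; apply: measurable_funB => //.
  exact: measurable_funX.
have h_le n t : `|h n t| <= `|u t|.
  rewrite normrM ler_piMl//.
  have /andP[? ?] := threshold_itv n (arc_level_itv b t).
  by rewrite ger0_norm; lra.
have mub : measurable_fun I01 (u \_ `[0, b]).
  have : measurable_fun `[0, b]%classic u.
    apply: measurable_funS mu_ => //.
    by apply: subset_itvl; rewrite bnd_simp ltW.
  move/(measurable_restrictT _ (measurable_itv _)).1.
  exact: measurable_funTS.
have lim_h : {ae mu, forall t, I01 t ->
    (EFin \o h n) t @[n --> \oo] --> ((u \_ `[0, b]) t)%:E}.
  (* At 0, b and 1 the level is exactly 1/2, where the limit of [threshold] is not controlled. *)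
  move: (ae_neq 0) (ae_neq 1) (ae_neq b); apply: filterS3 => t /eqP t0 /eqP t1 /eqP tb; rewrite /= in_itv/= => /andP[t0' t1'].
  apply: cvg_EFin; first exact: nearW.
  have {t0 t0'}t0 : 0 < t by rewrite lt_def t0.
  have {t1 t1'}t1 : t < 1 by rewrite lt_def eq_sym t1.
  rewrite patchE; have [tb'|tb'] := ltP t b.
    rewrite mem_set/=; last by rewrite in_itv/= !ltW.
    have e : u t = (1 - 0) * u t by rewrite subr0 mul1r.
    rewrite [X in _ --> X]e.
    apply: cvgMl; apply: cvgB; first exact: cvg_cst.
    apply: threshold_cvg0; rewrite arc_level_gt ?t0//=.
    by have /andP[] := arc_level_itv b t.
  rewrite memNset/=; last by rewrite in_itv/= => /andP[_]; rewrite leNgt lt_def tb tb'.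
  have e : 0 = (1 - 1) * u t by rewrite subrr mul0r.
  rewrite [X in _ --> X]e.
  apply: cvgMl; apply: cvgB; first exact: cvg_cst.
  apply: threshold_cvg1; rewrite arc_level_lt ?t1 ?andbT//; last by rewrite lt_def tb.
  by have /andP[] := arc_level_itv b t.
have h_dom : {ae mu, forall t n, I01 t -> (`|(EFin \o h n) t| <= `|u t|%:E)%E}.
  by apply: aeW => t n _; rewrite lee_fin.
have [_ _] := @dominated_convergence _ _ _ mu I01 mI01 (fun n => EFin \o h n)
  (EFin \o (u \_ `[0, b])) (fun t => `|u t|%:E)
  (fun n => (measurable_EFinP _ _).2 (mh n)) ((measurable_EFinP _ _).2 mub) lim_h
  (integrable_norm iu) h_dom.
have -> : [sequence (\int[mu]_(x in I01) (EFin \o h n) x)%E]_n = (fun=> 0%E).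
  apply/funext => n /=; rewrite -[LHS]fineK; first by congr EFin; exact: u0.
  apply: (integrable_fin_num mI01); apply: (le_integrable mI01 _ _ iu).
    by apply/measurable_EFinP; exact: mh.
  by move=> t _; rewrite lee_fin; exact: h_le.
move=> cv; have := cvg_unique _ cv (cvg_cst 0%E) => e.
transitivity (\int[mu]_(t in I01) (u \_ `[0, b]) t); last first.
  by rewrite /Rintegral e//.
rewrite -Rintegral_mkcondr; congr Rintegral.
by apply/esym/setIidr; apply: subset_itvl; rewrite bnd_simp ltW.
Qed.

(** The primitive of u is zero on (0, 1), and by Lebesgue differentiation its derivative is u almost
    everywhere. *)
Lemma ae_eq0_prefix_integral u : mu.-integrable I01 (EFin \o u) ->
  (forall b, 0 < b < 1 -> \int[mu]_(t in `[0, b]) u t = 0) ->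
  {ae mu, forall t, I01 t -> u t = 0}.
Proof.
move=> iu u0; pose v := u \_ I01.
have iv : mu.-integrable I01 (EFin \o v).
  by apply: (eq_integrable mI01 _ _ _ iu) => t It; rewrite /= /v patchE It.
have lv : locally_integrable [set: R] v by exact: integrable_locally iu.
move: (ae_neq 0) (ae_neq 1) (lebesgue_differentiation lv).
apply: filterS3 => t /eqP t0 /eqP t1 vt; rewrite /= in_itv/= => /andP[t0' t1'].
have {t0 t0'}t0 : 0 < t by rewrite lt_def t0.
have {t1 t1'}t1 : t < 1 by rewrite lt_def eq_sym t1.
have [_] := @FTC1_lebesgue_pt R v (BLeft 0) t 1 t1 iv t0 vt.
have -> : v t = u t by rewrite /v patchE mem_set//= in_itv/= !ltW.
move=> <-; rewrite derive1E.
rewrite (@near_eq_derive _ _ _ _ (fun=> 0)) ?derive_cst//.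
near=> y; have y01 : 0 < y < 1.
  by apply/andP; split; near: y; [exact: lt_nbhsr|exact: lt_nbhsl].
transitivity (\int[mu]_(s in `[0, y]) u s); last exact: u0.
apply: eq_Rintegral => s; rewrite inE/= in_itv/= => /andP[s0 sy].
rewrite /v patchE mem_set//= in_itv/= s0/=; apply: le_trans sy _.
by apply: ltW; case/andP : y01.
Unshelve. all: by end_near. Qed.

(** The hypothesis kills the integral of f against every trigonometric polynomial, in particular
    against approximate indicators of all arcs [0, b]. *)
Lemma fourier_unique f : circle_integrable f ->
  (forall n : int, circle_int (fun z => z ^ n * f z) = 0) -> f =T (fun=> 0).
Proof.
move=> fi f0; have [fR fI] := fi.
(* [arc_level b] as a Laurent polynomial in z: the cosine is half the sum of exp(pi i b) z^-1 and
   its conjugate, so 1/4 becomes 1/8. *)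
pose w b z : R[i] := (2^-1 - 4^-1 * cos (pi * b))%:C%C +
  8^-1%:C%C * (circle_pt (b / 2) * z ^ (-1) + Num.conj (circle_pt (b / 2)) * z ^ 1).
have wE b t : w b (circle_pt t) = (arc_level b t)%:C%C.
  rewrite /w exprN1 circle_pt_inv expr1z /arc_level.
  have -> : cos (2 * pi * (t - b / 2)) = cos (2 * pi * t) * cos (2 * pi * (b / 2))
      + sin (2 * pi * t) * sin (2 * pi * (b / 2)) by rewrite -cosB mulrBr.
  rewrite /circle_pt; set c := cos (2 * pi * (b / 2)); set s := sin (2 * pi * (b / 2)).
  by apply: complex_ext; rewrite !(ReCD, ImCD, ReCM, ImCM, ReCJ, ImCJ)/=; field.
have wp b : trig_poly (w b).
  apply: trig_polyD; first exact: trig_poly_cst.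
  apply: trig_polyM; first exact: trig_poly_cst.
  by apply: trig_polyD; exact: trig_poly_monomial.
pose p b n z : R[i] := 1 + (-1) * (1 + (-1) * w b z ^+ n) ^+ (2 ^ n)%N.
have pp b n : trig_poly (p b n).
  have c1 c := @trig_poly_cst R c.
  apply: trig_polyD => //; apply: trig_polyM => //; apply: trig_polyX.
  by apply: trig_polyD => //; apply: trig_polyM => //; exact: trig_polyX.
have pE b n t : p b n (circle_pt t) = (1 - threshold n (arc_level b t))%:C%C.
  by rewrite /p wE /threshold !mulN1r rmorphB rmorphXn rmorphB rmorphXn.
have pf0 b n : \int[mu]_(t in I01)
      ((1 - threshold n (arc_level b t)) * complex.Re (f (circle_pt t))) = 0 /\
    \int[mu]_(t in I01)
      ((1 - threshold n (arc_level b t)) * complex.Im (f (circle_pt t))) = 0.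
  have := circle_int_trig_poly fi f0 (pp b n) => -[eR eI].
  split; [rewrite -[RHS]eR|rewrite -[RHS]eI]; apply: eq_Rintegral => t _;
  by rewrite (ReCM, ImCM) pE/=; ring.
have hR := ae_eq0_prefix_integral fR (fun b b01 =>
  prefix_integral_eq0 b01 fR (fun n => (pf0 b n).1)).
have hI := ae_eq0_prefix_integral fI (fun b b01 =>
  prefix_integral_eq0 b01 fI (fun n => (pf0 b n).2)).
rewrite /ae_circle; move: hR hI; apply: filterS2 => t hR hI It.
by apply: complex_ext; [exact: hR|exact: hI].
Qed.

End FourierUniqueness.

(** * Orthogonality of the powers of z *)

Section CircleMonomials.
Context {R : realType}.
Local Notation mu := (@lebesgue_measure R).

Lemma circle_ptD (s t : R) : circle_pt (s + t) = circle_pt s * circle_pt t.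
Proof.
by apply: complex_ext; rewrite (ReCM, ImCM)/= mulrDr (cosD, sinD); ring.
Qed.

Lemma circle_ptX (t : R) n : circle_pt t ^+ n = circle_pt (n%:R * t).
Proof.
elim: n => [|n IH].
  by rewrite mul0r expr0 /circle_pt mulr0 cos0 sin0.
by rewrite exprS IH -circle_ptD -natr1; congr circle_pt; ring.
Qed.

Lemma integral_derive01 (F f : R -> R) : continuous f ->
  (forall t : R, is_derive t (1 : R) F (f t)) ->
  \int[mu]_(t in `[0, 1]) f t = F 1 - F 0.
Proof.
move=> cf dF; have dFt (t : R) : derivable F t (1 : R) by exact: ex_derive.
have cF : continuous F by move=> t; exact/differentiable_continuous/derivable1_diffP.
rewrite /Rintegral (@continuous_FTC2 _ f F)//.
- exact: continuous_subspaceT.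
- split; first by move=> t _.
  + by apply: cvg_at_right_filter; exact: cF.
  + by apply: cvg_at_left_filter; exact: cF.
- by move=> t _; rewrite derive1E; apply: derive_val.
Qed.

Lemma integral_cos_sin (n : nat) : (0 < n)%N ->
  \int[mu]_(t in `[0, 1]) cos (2 * pi * (n%:R * t)) = 0 /\
  \int[mu]_(t in `[0, 1]) sin (2 * pi * (n%:R * t)) = 0.
Proof.
move=> n0; pose a : R := 2 * pi * n%:R.
have a0 : a != 0.
  by rewrite !mulf_neq0 ?pnatr_eq0 -?lt0n// gt_eqF// pi_gt0.
have cE t : 2 * pi * (n%:R * t) = a * t by rewrite /a mulrA.
have ca : continuous (fun t : R => a * t).
  by move=> t; apply: cvgM; [exact: cvg_cst|exact: cvg_id].
have dl (t : R) : is_derive t (1 : R) (fun t : R => a * t) a.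
  have := is_deriveZ a (is_derive_id t (1 : R)).
  by move=> h; apply: is_derive_eq; rewrite /GRing.scale/= mulr1.
have e1 : a * 1 = 2 * pi * n%:R by rewrite mulr1.
have [cos1 sin1] : cos (a * 1) = 1 /\ sin (a * 1) = 0.
  have := circle_ptX (1 : R) n; rewrite /circle_pt mulr1.
  have -> : Complex (cos (2 * pi)) (sin (2 * pi)) = 1 :> R[i].
    by rewrite mulr_natl cos2pi sin2pi.
  by rewrite expr1n /a !mulr1 => -[<- <-].
have ccos : continuous (fun t : R => cos (a * t)).
  by move=> t; apply: (@continuous_comp _ _ _ (fun t => a * t) (@cos R));
    [exact: ca|exact: continuous_cos].
have csin : continuous (fun t : R => sin (a * t)).
  by move=> t; apply: (@continuous_comp _ _ _ (fun t => a * t) (@sin R));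
    [exact: ca|exact: continuous_sin].
have dsin (t : R) : is_derive t (1 : R) (fun t => a^-1 * sin (a * t)) (cos (a * t)).
  have h := is_derive1_comp (is_derive_sin (a * t)) (dl t).
  have h' := is_deriveZ a^-1 h.
  by apply: is_derive_eq; rewrite /GRing.scale/=; field.
have dcos (t : R) : is_derive t (1 : R) (fun t => - a^-1 * cos (a * t)) (sin (a * t)).
  have h := is_derive1_comp (is_derive_cos (a * t)) (dl t).
  have h' := is_deriveZ (- a^-1) h.
  by apply: is_derive_eq; rewrite /GRing.scale/=; field.
split; under eq_Rintegral do rewrite cE.
  by rewrite (integral_derive01 ccos dsin) sin1 !mulr0 sin0 mulr0 subrr.
by rewrite (integral_derive01 csin dcos) cos1 !mulr0 cos0 subrr.
Qed.

Lemma circle_int_exprz (n : int) :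
  circle_int (fun z : R[i] => z ^ n) = (n == 0)%:R.
Proof.
have pos k : (0 < k)%N -> circle_int (fun z : R[i] => z ^+ k) = 0.
  move=> k0; have [c0 s0] := integral_cos_sin k0.
  by apply: complex_ext => /=; [rewrite -[RHS]c0|rewrite -[RHS]s0];
    apply: eq_Rintegral => t _; rewrite circle_ptX.
case: n => [[|k]|k].
- by rewrite eqxx; rewrite (@circle_int_ext _ _ (fun=> 1))// circle_int_cst.
- by rewrite pos.
- have i1 : circle_integrable (fun z : R[i] => z ^ Posz k.+1).
    have := circle_integrableM_exprz (Posz k.+1) (circle_integrable_cst (1 : R[i])).
    by apply: circle_integrable_ext => t; rewrite mulr1.
  rewrite -(@circle_int_ext _ (fun z => Num.conj (z ^ Posz k.+1))).
    by rewrite circle_intJ// pos// rmorph0.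
  by move=> t; rewrite circle_pt_conjX -NegzE.
Qed.

End CircleMonomials.

(** * The Hardy space *)

Section HardySpace.
Context {R : realType} {H : vectType R[i]}.
Variable dot : {dot H for @Num.conj R[i]}.
Local Notation E := (R[i] -> H).
Local Notation ip := (L2dot dot).
Local Notation N f := (complex.Re (ip f f)).
Implicit Types (f g h : R[i] -> H) (x y : H) (n : int).

Definition monomial n x : E := fun z => z ^ n *: x.

Let hP := L2_hilbert dot.
Let LB f g : L2 dot f -> L2 dot g -> L2 dot (f - g).
Proof. exact: subspaceB (L2_subspace dot). Qed.

Lemma L2_monomial n x : L2 dot (monomial n x).
Proof. exact: L2_exprz (L2_cst dot x). Qed.
Hint Resolve L2_monomial : core.

Lemma L2dot_ext f f' g g' : (forall t, f (circle_pt t) = f' (circle_pt t)) ->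
  (forall t, g (circle_pt t) = g' (circle_pt t)) -> ip f g = ip f' g'.
Proof. by move=> ff' gg'; apply: circle_int_ext => t; rewrite ff' gg'. Qed.

Lemma L2dot_shift n f g :
  ip (fun z => z ^ n *: f z) g = ip f (fun z => z ^ (- n) *: g z).
Proof. by apply: circle_int_ext => t; rewrite dotZl dotZr circle_pt_conjX opprK. Qed.

Lemma L2dot_shift2 n f g :
  ip (fun z => z ^ n *: f z) (fun z => z ^ n *: g z) = ip f g.
Proof.
rewrite L2dot_shift; apply: L2dot_ext => // t.
by rewrite scalerA -expfzDr ?circle_pt_neq0// addNr scale1r.
Qed.

Lemma L2dot_shift_monomial n (m : int) f x :
  ip (fun z => z ^ n *: f z) (monomial m x) = ip f (monomial (m - n) x).
Proof.
rewrite L2dot_shift; apply: L2dot_ext => // t.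
by rewrite /monomial scalerA -expfzDr ?circle_pt_neq0// addrC.
Qed.

Lemma L2dot_cst x y : ip (fun=> x) (fun=> y) = dot x y.
Proof. exact: circle_int_cst. Qed.

Lemma L2dot_monomial n (m : int) x y :
  ip (monomial n x) (monomial m y) = (n == m)%:R * dot x y.
Proof.
rewrite -subr_eq0 -(circle_int_exprz (R := R)) mulrC.
have i1 : circle_integrable (fun z : R[i] => z ^ (n - m)).
  have := circle_integrableM_exprz (n - m) (circle_integrable_cst (1 : R[i])).
  by apply: circle_integrable_ext => t; rewrite mulr1.
rewrite -circle_intZ//; apply: circle_int_ext => t.
rewrite /monomial dotZl dotZr circle_pt_conjX mulrA mulrC.
by rewrite -expfzDr ?circle_pt_neq0.
Qed.

Lemma monomial0 x : monomial 0 x = fun=> x.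
Proof. by apply/funext => z; rewrite /monomial expr0z scale1r. Qed.

Lemma fourier_dot f n x : L2 dot f -> dot (fourier f n) x = ip f (monomial n x).
Proof.
move=> Lf; have Lzf := L2_exprz (- n) Lf.
rewrite /fourier (vint_functional (dot_scalar dot x)) => [|i].
  apply: circle_int_ext => t.
  by rewrite /monomial dotZl dotZr circle_pt_conjX.
have [w wE] := @functional_dot _ _ dot (coord (vbasis {:H}) i) (@linearP _ _ _ _ _).
have := L2dot_integrable Lzf (L2_cst dot w).
by apply: circle_integrable_ext => t; rewrite wE.
Qed.

Lemma L2_fourier_eq0 f : L2 dot f -> (forall n x, ip f (monomial n x) = 0) ->
  f =T (fun=> 0).
Proof.
move=> Lf f0; apply: (L2_eq0 Lf).
have fi0 i : (fun z => dot (f z) (onb dot i)) =T (fun=> 0).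
  apply: fourier_unique; first exact: L2dot_integrable Lf (L2_cst dot _).
  move=> n; rewrite -(f0 (- n) (onb dot i)); apply: circle_int_ext => t.
  by rewrite /monomial dotZr circle_pt_conjX opprK.
have mf : vmeasurable f by case: Lf.
have mfi i : circle_measurable (fun z => dot (f z) (onb dot i)).
  by have [+ _] := vmeasurableP dot f; apply.
have -> : ip f f = circle_int (fun=> 0); last by rewrite circle_int_cst.
apply: circle_int_ae; first exact: vmeasurable_dot.
  exact: circle_measurable_cst.
(* Induction over a list of coordinates unites their finitely many exceptional null sets. *)
have : forall s : seq 'I_(onb_size dot),
    ae_circle (fun z => \sum_(i <- s)
      dot (f z) (onb dot i) * Num.conj (dot (f z) (onb dot i)) = 0).
  elim=> [|i s IH]; first by apply: ae_circleW => z; rewrite big_nil.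
  by apply: ae_circleS2 (fi0 i) IH => z f0z IHz; rewrite big_cons f0z IHz mul0r addr0.
by move=> /(_ (index_enum _)); apply: ae_circleS => z; rewrite -dot_onb_sum.
Qed.

Definition negative_monomials : set E := [set f | exists n x, n < 0 /\ f = monomial n x].
Definition positive_monomials : set E := [set f | exists n x, 0 <= n /\ f = monomial n x].

Let negL : negative_monomials `<=` L2 dot. Proof. by move=> _ [n [x [_ ->]]]. Qed.
Let posL : positive_monomials `<=` L2 dot. Proof. by move=> _ [n [x [_ ->]]]. Qed.

Lemma H2E : H2 dot = annihilator (L2 dot) ip negative_monomials.
Proof.
apply/seteqP; split=> f [Lf f0]; split=> //.
  by move=> _ [n [x [n0 ->]]]; rewrite -fourier_dot// f0// dot0l.
move=> n n0; apply: (@dot_ext _ _ dot) => x; rewrite fourier_dot// dot0l.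
by apply: f0; exists n, x.
Qed.

Lemma H2_L2 f : H2 dot f -> L2 dot f. Proof. by case. Qed.

Lemma H2P f : L2 dot f -> (forall n x, n < 0 -> ip f (monomial n x) = 0) ->
  H2 dot f.
Proof.
by move=> Lf f0; rewrite H2E; split=> // _ [n [x [n0 ->]]]; exact: f0.
Qed.

Lemma H2_monomial_eq0 f n x : H2 dot f -> n < 0 -> ip f (monomial n x) = 0.
Proof. by rewrite H2E => -[_ f0] n0; apply: f0; exists n, x. Qed.

Lemma H2_subspace : linear_subspace (H2 dot : set E).
Proof. by rewrite H2E; exact: (annihilator_subspace hP negL). Qed.

Lemma H2_monomial n x : 0 <= n -> H2 dot (monomial n x).
Proof.
move=> n0; apply: H2P => // m y m0; rewrite L2dot_monomial.
by rewrite gt_eqF ?mul0r// (lt_le_trans m0).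
Qed.

Lemma H2_cst x : H2 dot (fun=> x).
Proof. by rewrite -monomial0; exact: H2_monomial. Qed.

Lemma ip_conj0 f g : L2 dot f -> L2 dot g -> ip f g = 0 -> ip g f = 0.
Proof. by move=> Lf Lg fg; rewrite L2dot_conj// fg rmorph0. Qed.

Lemma ip_null_l f g : L2 dot f -> L2 dot g -> f =T (fun=> 0) -> ip f g = 0.
Proof.
move=> Lf Lg f0; rewrite (L2dot_ae Lf (L2_cst dot 0) Lg Lg f0); last exact: ae_circleW.
by rewrite -(circle_int_cst 0); apply: circle_int_ext => t; rewrite dot0l.
Qed.

(* Projecting [g] on the functions without nonnegative frequencies leaves a
   function without any frequency. *)
Lemma H2_orthogonal g h : H2 dot g -> L2 dot h ->
  (forall k x, 0 <= k -> ip h (monomial k x) = 0) -> ip g h = 0.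
Proof.
move=> Hg Lh h0; have Lg := H2_L2 Hg.
have [p [Lp p0] pE] := projection_exists hP posL Lg.
have hA : annihilator (L2 dot) ip positive_monomials h.
  by split=> // _ [k [x [k0 ->]]]; exact: h0.
have pnull : p =T (fun=> 0).
  apply: (L2_fourier_eq0 Lp) => n x; have [n0|n0] := leP 0 n.
    by apply: p0; exists n, x.
  have Am : annihilator (L2 dot) ip positive_monomials (monomial n x).
    split=> // _ [k [y [k0 ->]]]; rewrite L2dot_monomial.
    by rewrite lt_eqF ?mul0r// (lt_le_trans n0).
  have := pE _ Am; rewrite (ipBl hP)// H2_monomial_eq0// sub0r => /eqP.
  by rewrite oppr_eq0 => /eqP.
by have := pE _ hA; rewrite (ipBl hP)// (ip_null_l Lp)// subr0.
Qed.

Definition partial_sum f (m : nat) : E :=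
  \sum_(k < m) monomial k%:Z (fourier f k%:Z).

Lemma L2_partial_sum f (m : nat) : L2 dot (partial_sum f m).
Proof. by apply: subspace_sum; [exact: L2_subspace|]. Qed.
Hint Resolve L2_partial_sum : core.

Lemma H2_partial_sum f (m : nat) : H2 dot (partial_sum f m).
Proof.
by apply: subspace_sum => [|k _]; [exact: H2_subspace|exact: H2_monomial].
Qed.

Lemma partial_sum_monomial f (m k : nat) x : L2 dot f -> (k < m)%N ->
  ip (f - partial_sum f m) (monomial k%:Z x) = 0.
Proof.
move=> Lf km; rewrite (ipBl hP)// (ip_suml hP)// -fourier_dot//.
rewrite (bigD1 (Ordinal km))//= L2dot_monomial eqxx mul1r big1 ?addr0 ?subrr//.
move=> j jk; rewrite L2dot_monomial (_ : (_ == _) = false) ?mul0r//.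
by apply/negbTE; apply: contra jk => /eqP[jk]; apply/eqP/val_inj.
Qed.

(** Pythagoras: f - s_k f is orthogonal to all monomials of degree below k, hence to s_k f - s_m
    f. *)
Lemma partial_sum_le f (m k : nat) : L2 dot f -> (m <= k)%N ->
  N (partial_sum f k - partial_sum f m) =
  N (f - partial_sum f m) - N (f - partial_sum f k).
Proof.
move=> Lf mk.
have -> : f - partial_sum f m =
    (f - partial_sum f k) + (partial_sum f k - partial_sum f m).
  by rewrite addrA subrK.
have Lfk := LB Lf (L2_partial_sum f k).
have Lkm := LB (L2_partial_sum f k) (L2_partial_sum f m).
rewrite (sqnormD hP Lfk Lkm).
suff -> : ip (f - partial_sum f k) (partial_sum f k - partial_sum f m) = 0.
  by rewrite /= mulr0 addr0 addrAC subrr add0r.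
rewrite (ipBr hP)// !(ip_sumr hP)// !big1 ?subr0// => j _;
by rewrite partial_sum_monomial// (leq_trans (ltn_ord j)).
Qed.

(** The squared distances [d m] decrease to their infimum. Partial sums that nearly attain it form a
    rapidly converging sequence by Pythagoras; the limit has the Fourier coefficients of f, so it is
    f up to a null function, and the infimum is 0. *)
Lemma partial_sum_cvg f : H2 dot f ->
  N (f - partial_sum f m) @[m --> \oo] --> (0 : R).
Proof.
move=> Hf; have Lf := H2_L2 Hf.
pose d (m : nat) := N (f - partial_sum f m).
have d0 (m : nat) : 0 <= d m by exact: L2dot_ge0.
have dmono (m k : nat) : (m <= k)%N -> d k <= d m.
  move=> mk; rewrite -subr_ge0 -partial_sum_le//; exact: L2dot_ge0.
have dlb : has_lbound (range d) by exists 0 => _ [m _ <-].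
have dinf : has_inf (range d) by split=> //; exists (d 0%N), 0%N.
have e0 j : 0 < 4^-1 ^+ j :> R by rewrite exprn_gt0//; lra.
(* The condition [j <= m] ensures that every frequency is eventually included in the partial sum of
   length [M j]. *)
have /choice[M Mp] j : exists m : nat, (j <= m)%N /\ d m < inf (range d) + 4^-1 ^+ j.
  have [_ [m _ <-] dm] := inf_adherent (e0 j) dinf.
  exists (maxn j m); split; first exact: leq_maxl.
  by apply: le_lt_trans dm; apply: dmono; exact: leq_maxr.
have infd (m : nat) : inf (range d) <= d m by apply: ge_inf => //; exists m.
pose u j := partial_sum f (M j).
have Lu j : L2 dot (u j) by exact: L2_partial_sum.
have [l Ll ul] : exists2 l, L2 dot l & N (u j - l) @[j --> \oo] --> (0 : R).
  apply: (hilbert_complete hP) => // j; rewrite /u.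
  (* [M] need not be monotone; either order leaves a difference of two distances, at most 4^-j. *)
  have [h|/ltnW h] := leqP (M j) (M j.+1).
    rewrite partial_sum_le// -!/(d _).
    by have [_] := Mp j; have := infd (M j.+1); lra.
  rewrite (sqnorm_distC hP)// partial_sum_le// -!/(d _).
  have [_] := Mp j.+1; have := infd (M j); rewrite exprS; have := e0 j; lra.
have ful j : N (f - u j - (f - l)) = N (u j - l).
  have -> : f - u j - (f - l) = l - u j by rewrite opprB addrC addrA subrK.
  exact: (sqnorm_distC hP).
have fl : f - l =T (fun=> 0).
  apply: L2_fourier_eq0; first exact: LB.
  move=> n x; have [n0|n0] := leP 0 n; last first.
    have un j : ip (f - u j) (monomial n x) = 0.
      rewrite (ipBl hP)//; first rewrite !H2_monomial_eq0 ?subr0//.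
      exact: H2_partial_sum.
    apply: (limit_ip hP (u := fun j => f - u j)) un => // [j||]; [exact: LB..|].
    by under eq_fun do rewrite ful.
  case: n n0 => // k _.
  have un j : ip (f - u (j + k.+1)%N) (monomial k%:Z x) = 0.
    apply: partial_sum_monomial => //; have [h _] := Mp (j + k.+1)%N.
    by apply: leq_trans h; rewrite addnS ltnS leq_addl.
  apply: (limit_ip hP (u := fun j => f - u (j + k.+1)%N)) un => // [j||]; [exact: LB..|].
  under eq_fun do rewrite ful.
  by have := ul; rewrite -(cvg_shiftn k.+1).
have du j : d (M j) = N (u j - l).
  rewrite /d -/(u j) (sqnorm_distC hP)//.
  have -> : u j - f = (u j - l) - (f - l) by rewrite opprB addrA subrK.
  have Lul := LB (Lu j) Ll; have Lfl := LB Lf Ll.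
  rewrite (sqnormB hP)// (L2dot_conj Lfl Lul) ReCJ !(ip_null_l Lfl)//=.
  by rewrite mulr0 subr0 addr0.
have inf0 : inf (range d) <= 0.
  rewrite -(cvg_lim _ ul)//; apply: limr_ge; first by apply/cvg_ex; exists 0.
  by apply: nearW => j; rewrite -du.
have cd : d m @[m --> \oo] --> inf (range d).
  exact: nonincreasing_cvgn.
suff e : inf (range d) = 0 by rewrite -e.
apply/eqP; rewrite eq_le inf0/=; apply: lb_le_inf; first by exists (d 0%N), 0%N.
by move=> _ [m _ <-].
Qed.

End HardySpace.

(** * Operator functions *)

Section OperatorFunctions.
Context {R : realType} {H : vectType R[i]}.
Variable dot : {dot H for @Num.conj R[i]}.
Local Notation E := (R[i] -> H).
Local Notation ip := (L2dot dot).
Local Notation I01 := (`[0%R, 1%R]%classic : set R).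
Local Notation mu := (@lebesgue_measure R).
Local Notation sq x := (complex.Re (dot x x)).
Local Notation hs T := (complex.Re (hs_dot dot T T)).
Implicit Types (F G : R[i] -> 'End(H)) (f g : R[i] -> H) (x y : H).

Let mI01 : @measurable _ (measurableTypeR R) I01.
Proof. exact: measurable_itv. Qed.

Lemma eval_scalar x y : scalar (fun T : 'End(H) => dot (T x) y).
Proof. by move=> a S T; rewrite !lfunE/= !lfunE/= dotDl dotZl. Qed.

Lemma vmeasurable_lfun F : (forall x, vmeasurable (fun z => F z x)) ->
  vmeasurable F.
Proof.
move=> mF k; set c := coord (vbasis {:'End(H)}) k.
have -> : (fun z => c (F z)) =
    (fun z => \sum_(i < onb_size dot)
       c (outer dot (F z (onb dot i)) (onb dot i))).
  by apply/funext => z; rewrite {1}(lfun_onb dot (F z)) /c linear_sum.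
apply: circle_measurable_sum => i.
apply: (vmeasurable_functional (phi := fun v => c (outer dot v (onb dot i)))).
  by move=> a u v; rewrite /c outer_linear_l linearP.
exact: mF.
Qed.

Lemma vmeasurable_eval F x y : vmeasurable F ->
  circle_measurable (fun z => dot (F z x) y).
Proof. exact: (vmeasurable_functional (eval_scalar x y)). Qed.

Lemma vmeasurable_apply F f : vmeasurable F -> vmeasurable f ->
  vmeasurable (fun z => F z (f z)).
Proof.
move=> mF mf; apply/(vmeasurableP dot) => y.
have -> : (fun z => dot (F z (f z)) y) = (fun z => \sum_(i < onb_size dot)
    dot (f z) (onb dot i) * dot (F z (onb dot i)) y).
  apply/funext => z; rewrite {1}(onb_sum dot (f z)) linear_sum dot_suml.
  by apply: eq_bigr => i _; rewrite linearZ dotZl.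
apply: circle_measurable_sum => i; apply: circle_measurableM.
  by have [+ _] := vmeasurableP dot f; apply.
exact: vmeasurable_eval.
Qed.

Lemma vmeasurable_adj F : vmeasurable F -> vmeasurable (fun z => adj dot (F z)).
Proof.
move=> mF; apply: vmeasurable_lfun => x; apply/(vmeasurableP dot) => y.
have -> : (fun z => dot (adj dot (F z) x) y) =
    (fun z => Num.conj (dot (F z y) x)).
  by apply/funext => z; rewrite -adjP' dot_conj.
by apply: circle_measurableJ; exact: vmeasurable_eval.
Qed.

Lemma Re_hs_dot_measurable F : vmeasurable F ->
  measurable_fun I01 (fun t : R => hs (F (circle_pt t))).
Proof.
move=> mF; have : circle_measurable (fun z => \sum_(i < onb_size dot)
    dot (F z (onb dot i)) (F z (onb dot i))).
  apply: circle_measurable_sum => i; apply: (vmeasurable_dot dot);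
  apply: vmeasurable_apply => //; exact: vmeasurable_cst.
by move=> [mR _]; apply: eq_measurable_fun mR => t _; rewrite hs_dotE.
Qed.

Lemma L2_hs_integrable F : L2 (hs_dot dot) F ->
  mu.-integrable I01 (fun t => (hs (F (circle_pt t)))%:E).
Proof.
move=> [mF iF]; apply/integrableP; split.
  by apply/measurable_EFinP; exact: Re_hs_dot_measurable mF.
apply: le_lt_trans iF; rewrite le_eqVlt; apply/orP; left; apply/eqP.
by apply: eq_integral => t _ /=; rewrite ger0_norm// sqnorm_hs_ge0.
Qed.

Lemma L2_apply_bounded F f (C : R) : L2 (hs_dot dot) F -> vmeasurable f ->
  ae_circle (fun z => sq (f z) <= C) -> L2 dot (fun z => F z (f z)).
Proof.
move=> LF mf fC; have [mF _] := LF.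
apply: (@L2_dominated _ _ dot _ (fun t => C * hs (F (circle_pt t)))).
- exact: vmeasurable_apply.
- apply: (eq_integrable mI01 _ _ _ (integrableZl mI01 C (L2_hs_integrable LF))).
  by move=> t _; rewrite /= EFinM.
- move: fC; rewrite /ae_circle; apply: filterS => t fC It.
  apply: le_trans (sqnorm_apply_le dot _ _) _; rewrite mulrC.
  by rewrite ler_wpM2r ?sqnorm_hs_ge0//; exact: fC.
Qed.

Lemma L2_apply_cst F x : L2 (hs_dot dot) F -> L2 dot (fun z => F z x).
Proof.
move=> LF; apply: (L2_apply_bounded (f := fun=> x) (C := sq x)) => //.
exact: ae_circleW.
Qed.

(** The squared Hilbert-Schmidt norm is the finite sum of the squared norms of the columns F e_i.
    Families of columns in a model space become symbols in this way. *)
Lemma L2_hs_intro F : (forall x, L2 dot (fun z => F z x)) -> L2 (hs_dot dot) F.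
Proof.
move=> LF; have mF : vmeasurable F by apply: vmeasurable_lfun => x; case: (LF x).
split=> //.
have ii : mu.-integrable I01 (fun t => (\sum_(i < onb_size dot)
    (sq (F (circle_pt t) (onb dot i)))%:E)%E).
  by apply: integrable_sum => // i _; exact: L2_integrable (LF _).
have /integrableP[_] := ii; apply: le_lt_trans.
rewrite le_eqVlt; apply/orP; left; apply/eqP; apply: eq_integral => t _.
rewrite sumEFin /= ger0_norm ?Re_hs_dot//.
by apply: sumr_ge0 => i _; exact: sqnorm_ge0.
Qed.

Lemma L2_hs_adj F : L2 (hs_dot dot) F -> L2 (hs_dot dot) (fun z => adj dot (F z)).
Proof.
move=> [mF iF]; split; first exact: vmeasurable_adj.
apply: le_lt_trans iF; rewrite le_eqVlt; apply/orP; left; apply/eqP.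
by apply: eq_integral => t _; rewrite Re_hs_dot_adj.
Qed.

Lemma L2_hsD F G : L2 (hs_dot dot) F -> L2 (hs_dot dot) G ->
  L2 (hs_dot dot) (fun z => F z + G z).
Proof.
move=> LF LG; apply: L2_hs_intro => x.
have -> : (fun z => (F z + G z) x) = (fun z => F z x) + (fun z => G z x).
  by apply/funext => z; rewrite !lfunE.
by apply: (subspaceD (L2_subspace dot)); exact: L2_apply_cst.
Qed.

Lemma L2dot_adj F f g : ip (fun z => F z (f z)) g = ip f (fun z => adj dot (F z) (g z)).
Proof. by apply: circle_int_ext => t; rewrite adjP. Qed.

Lemma vint_apply F x y : (forall x, L2 dot (fun z => F z x)) ->
  dot (vint F x) y = ip (fun z => F z x) (fun=> y).
Proof.
move=> LF; rewrite (vint_functional (eval_scalar x y))// => k.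
set c := coord (vbasis {:'End(H)}) k.
have /choice[w wE] (i : 'I_(onb_size dot)) :
    exists w, forall v, c (outer dot v (onb dot i)) = dot v w.
  by apply: functional_dot => a u v; rewrite /c outer_linear_l linearP.
have : circle_integrable (fun z => \sum_(i < onb_size dot)
    dot (F z (onb dot i)) (w i)).
  by apply: circle_integrable_sum => i; exact: L2dot_integrable (LF _) (L2_cst dot _).
apply: circle_integrable_ext => t.
rewrite [X in c X](lfun_onb dot) /c linear_sum.
by apply: eq_bigr => i _; rewrite -wE.
Qed.

Lemma fourier_apply F n x y : L2 (hs_dot dot) F ->
  dot (fourier F n x) y = ip (fun z => F z x) (monomial n y).
Proof.
move=> LF; have L x' : L2 dot (fun z => (z ^ (- n) *: F z) x').
  have -> : (fun z => (z ^ (- n) *: F z) x') = (fun z => z ^ (- n) *: F z x').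
    by apply/funext => z; rewrite lfunE.
  exact: L2_exprz (L2_apply_cst _ LF).
rewrite /fourier vint_apply//; apply: circle_int_ext => t.
by rewrite lfunE/= /monomial dotZl dotZr circle_pt_conjX.
Qed.

(** Since 0^0 = 1, the partial sums of the series at 0 are constant from the first term on. *)
Lemma analytic_ext0 {V : vectType R[i]} (f : R[i] -> V) :
  analytic_ext f 0 = fourier f 0.
Proof.
rewrite /analytic_ext [RHS](coord_vbasis (memvf _)); apply: eq_bigr => i _.
congr (_ *: _); set c := coord _ i (fourier f 0).
have sE (n : nat) : \sum_(0 <= k < n.+1) 0 ^+ k * coord (vbasis {:V}) i (fourier f k%:Z) = c.
  rewrite big_nat_recl// expr0 mul1r big1 ?addr0// => k _.
  by rewrite expr0n mul0r.
rewrite /clim; apply: complex_ext => /=; apply/cvg_lim => //; apply: cvg_near_cst;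
  by exists 1%N => // n /= n1; rewrite -(prednK n1) sE.
Qed.

Lemma sqnorm_bounded_hnorm f :
  (exists M : R, ae_circle (fun z => hnorm dot (f z) <= M)) <->
  (exists C : R, ae_circle (fun z => sq (f z) <= C)).
Proof.
split=> -[M fM].
  exists (M ^+ 2); apply: ae_circleS fM => z fM; rewrite -sqr_hnorm.
  have h0 := hnorm_ge0 dot (f z).
  by apply: lerXn2r; rewrite ?nnegrE// (le_trans h0).
exists (Num.sqrt M); apply: ae_circleS fM => z fM.
by rewrite /hnorm ler_wsqrtr.
Qed.

End OperatorFunctions.

(** * Model spaces *)

Section BoundedFunctions.
Context {R : realType} {H : vectType R[i]}.
Variable dot : {dot H for @Num.conj R[i]}.
Local Notation ip := (L2dot dot).
Local Notation sq x := (complex.Re (dot x x)).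
Implicit Types (f g : R[i] -> H) (x y : H) (K : set (R[i] -> H)).

Definition ess_bounded f : Prop := exists C : R, ae_circle (fun z => sq (f z) <= C).

Lemma ess_boundedD f g : ess_bounded f -> ess_bounded g -> ess_bounded (f + g).
Proof.
move=> [C fC] [D gD]; exists (2 * C + 2 * D).
apply: ae_circleS2 fC gD => z fC gD; apply: le_trans (sqnormD_leH dot _ _) _.
by lra.
Qed.

Lemma ess_bounded_exprz (n : int) f :
  ess_bounded f -> ess_bounded (fun z => z ^ n *: f z).
Proof.
move=> [C fC]; exists C; move: fC; rewrite /ae_circle; apply: filterS => t fC It.
by rewrite sqnormZH circle_pt_normX mul1r; exact: fC.
Qed.

Lemma ess_bounded_cst x : ess_bounded (fun=> x).
Proof. by exists (sq x); exact: ae_circleW. Qed.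

Lemma ess_boundedN f : ess_bounded f -> ess_bounded (- f).
Proof.
move=> [C fC]; exists C; apply: ae_circleS fC => z.
by rewrite -[(- f) z]scaleN1r sqnormZH /= oppr0 expr0n addr0 sqrrN expr1n mul1r.
Qed.

Lemma ess_boundedB f g : ess_bounded f -> ess_bounded g -> ess_bounded (f - g).
Proof. by move=> bf bg; apply: ess_boundedD => //; exact: ess_boundedN. Qed.

Lemma ess_bounded_monomial n x : ess_bounded (monomial n x).
Proof. by apply: ess_bounded_exprz; exact: ess_bounded_cst. Qed.

Lemma ess_bounded_partial_sum f m : ess_bounded (partial_sum f m).
Proof.
rewrite /partial_sum; elim/big_ind : _ => [||k _]; first exact: ess_bounded_cst.
  exact: ess_boundedD.
exact: ess_bounded_monomial.
Qed.

Lemma HinftyP f : Hinfty dot (hnorm dot) f <-> H2 dot f /\ ess_bounded f.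
Proof. by rewrite /Hinfty sqnorm_bounded_hnorm. Qed.

(** [orthoproj] chooses among a.e. equal functions, with default 0; its defining property is
    available only after a projection has been exhibited. *)
Lemma orthoprojP K f :
  (exists2 p, K p & forall g, K g -> ip (f - p) g = 0) ->
  K (orthoproj dot K f) /\ forall g, K g -> ip (f - orthoproj dot K f) g = 0.
Proof.
move=> [p Kp pE]; rewrite /orthoproj.
by case: xgetP => [q _ //|/(_ p)]; case.
Qed.

Lemma adjointP K A g :
  (exists2 h, K h & forall f, K f -> ip (A f) g = ip f h) ->
  K (adjoint dot K A g) /\ forall f, K f -> ip (A f) g = ip f (adjoint dot K A g).
Proof.
move=> [p Kp pE]; rewrite /adjoint.
by case: xgetP => [q _ //|/(_ p)]; case.
Qed.

Let hP := L2_hilbert dot.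

Lemma L2_null_dist f g : L2 dot f -> L2 dot g ->
  ip (f - g) (f - g) = 0 -> f =T g.
Proof.
move=> Lf Lg fg; have Lfg := subspaceB (L2_subspace dot) Lf Lg.
have := L2_eq0 Lfg; rewrite fg => /(_ erefl); apply: ae_circleS => z.
by move/eqP; rewrite subr_eq0 => /eqP.
Qed.

(** The difference f - g lies in K, so it may serve as test function and is orthogonal to itself. *)
Lemma subspace_eq_test K f g : linear_subspace K -> K `<=` L2 dot ->
  K f -> K g -> (forall h, K h -> ip f h = ip g h) -> f =T g.
Proof.
move=> sK KL Kf Kg fg; have Kfg := subspaceB sK Kf Kg.
apply: L2_null_dist; [exact: KL..|].
by rewrite (ipBl hP) ?fg ?subrr//; exact: KL.
Qed.

End BoundedFunctions.

Section InnerFunctions.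
Context {R : realType} {H : vectType R[i]}.
Variables (dot : {dot H for @Num.conj R[i]}) (Theta : R[i] -> 'End(H)).
Hypothesis innerT : inner dot Theta.
Local Notation E := (R[i] -> H).
Local Notation ip := (L2dot dot).
Local Notation Theta0 := (analytic_ext Theta 0).
Local Notation K := (model dot Theta).
Implicit Types (f g : R[i] -> H) (x y : H).

Let hP := L2_hilbert dot.

Lemma inner_L2 : L2 (hs_dot dot) Theta. Proof. by case: innerT => [[[]]]. Qed.

Lemma inner_measurable : vmeasurable Theta. Proof. by case: inner_L2. Qed.

Lemma inner_unitary : ae_circle (fun z => unitary dot (Theta z)).
Proof. by case: innerT. Qed.

Lemma unitary_dot T x y : unitary dot T -> dot (T x) (T y) = dot x y.
Proof. by move=> [T1 _]; rewrite adjP -comp_lfunE T1 lfunE. Qed.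

Lemma unitary_adj_dot T x y : unitary dot T ->
  dot (adj dot T x) (adj dot T y) = dot x y.
Proof. by move=> [_ T1]; rewrite -adjP' -comp_lfunE T1 lfunE. Qed.

Lemma L2_inner f : L2 dot f -> L2 dot (fun z => Theta z (f z)).
Proof.
move=> Lf; apply: (L2_le (C := 1) _ Lf).
  by apply: (vmeasurable_apply dot inner_measurable); case: Lf.
by apply: ae_circleS inner_unitary => z uz; rewrite unitary_dot// mul1r.
Qed.

Lemma L2_inner_adj f : L2 dot f -> L2 dot (fun z => adj dot (Theta z) (f z)).
Proof.
move=> Lf; apply: (L2_le (C := 1) _ Lf).
  by apply: (vmeasurable_apply dot (vmeasurable_adj dot inner_measurable)); case: Lf.
by apply: ae_circleS inner_unitary => z uz; rewrite unitary_adj_dot// mul1r.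
Qed.

Lemma ess_bounded_inner f : ess_bounded dot f ->
  ess_bounded dot (fun z => Theta z (f z)).
Proof.
move=> [C fC]; exists C; apply: ae_circleS2 inner_unitary fC => z uz.
by rewrite unitary_dot.
Qed.

Lemma L2dot_inner f g : L2 dot f -> L2 dot g ->
  ip (fun z => Theta z (f z)) (fun z => Theta z (g z)) = ip f g.
Proof.
move=> Lf Lg; apply: circle_int_ae.
- exact: circle_integrable_measurable (L2dot_integrable (L2_inner Lf) (L2_inner Lg)).
- exact: circle_integrable_measurable (L2dot_integrable Lf Lg).
- by apply: ae_circleS inner_unitary => z uz; rewrite unitary_dot.
Qed.

Lemma L2dot_inner_monomial (n k : int) x y :
  ip (fun z => Theta z (monomial k y z)) (monomial n x) =
  dot (fourier Theta (n - k) y) x.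
Proof.
rewrite (fourier_apply (n - k) y x inner_L2) -L2dot_shift_monomial.
by apply: L2dot_ext => // t; rewrite /monomial linearZ.
Qed.

(** Pairing Theta f with z^n x for n < 0 moves Theta to the other side: adj Theta z^n x has no
    nonnegative frequency because Theta has no negative one. *)
Lemma H2_inner f : H2 dot f -> H2 dot (fun z => Theta z (f z)).
Proof.
move=> Hf; have Lf := H2_L2 Hf; apply: H2P; first exact: L2_inner.
move=> n x n0; rewrite L2dot_adj; apply: H2_orthogonal => //.
  by apply: L2_inner_adj; exact: L2_monomial.
move=> k y k0; rewrite L2dot_adj.
have -> : (fun z => adj dot (adj dot (Theta z)) (monomial k y z)) =
    (fun z => Theta z (monomial k y z)).
  by apply/funext => z; rewrite adjK.
apply: ip_conj0; [exact/L2_inner/L2_monomial|exact: L2_monomial|].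
rewrite L2dot_inner_monomial.
have -> : fourier Theta (n - k) = 0.
  by case: innerT => [[[_ F0] _] _]; apply: F0; rewrite subr_lt0 (lt_le_trans n0).
by rewrite lfunE dot0l.
Qed.

Lemma dot_inner0 x y : dot (Theta0 x) y = ip (fun z => Theta z x) (fun=> y).
Proof.
by rewrite analytic_ext0 (fourier_apply 0 x y inner_L2) monomial0.
Qed.

(** Annihilating these functions means lying in H^2 and being orthogonal to Theta H^2; the general
    lemmas on annihilators thereby apply to the model space. *)
Definition model_test : set E := [set f | negative_monomials f \/
  exists2 g, H2 dot g & f = fun z => Theta z (g z)].

Lemma model_test_L2 : model_test `<=` L2 dot.
Proof.
move=> f [[n [x [_ ->]]]|[g Hg ->]]; first exact: L2_monomial.
exact/L2_inner/H2_L2.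
Qed.

Lemma modelE : K = annihilator (L2 dot) ip model_test.
Proof.
rewrite /model H2E; apply/seteqP; split=> f /=.
  move=> [[Lf f0] f1]; split=> // _ [[n [x [n0 ->]]]|[g Hg ->]].
    by apply: f0; exists n, x.
  by apply: f1; rewrite -H2E.
move=> [Lf f0]; split; first by split=> // s s0; apply: f0; left.
by move=> g Hg; apply: f0; right; exists g => //; rewrite H2E.
Qed.

Lemma model_H2 f : K f -> H2 dot f. Proof. by case. Qed.

Lemma model_L2 f : K f -> L2 dot f. Proof. by case=> /H2_L2. Qed.

Lemma model_subspace : linear_subspace (K : set E).
Proof. by rewrite modelE; exact: (annihilator_subspace hP model_test_L2). Qed.

Lemma model_proj f : L2 dot f -> K (orthoproj dot K f) /\
  forall g, K g -> ip (orthoproj dot K f) g = ip f g.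
Proof.
move=> Lf; have [Kp pE] : K (orthoproj dot K f) /\
    forall g, K g -> ip (f - orthoproj dot K f) g = 0.
  apply: orthoprojP; rewrite modelE.
  exact: (projection_exists hP model_test_L2 Lf).
split=> // g Kg; have := pE g Kg.
rewrite (ipBl hP)//; [|exact: model_L2..].
by move/eqP; rewrite subr_eq0 => /eqP.
Qed.

Lemma model_eq f g : K f -> K g -> (forall h, K h -> ip f h = ip g h) -> f =T g.
Proof. by apply: subspace_eq_test; [exact: model_subspace|exact: model_L2]. Qed.

(* The projection of [z^n x] on the model space, up to a null function. *)
Definition model_monomial (n : nat) x : E :=
  monomial n%:Z x - (fun z => Theta z
    (partial_sum (fun w => adj dot (Theta w) (monomial n%:Z x w)) n.+1 z)).

Lemma model_monomial_bounded n x : ess_bounded dot (model_monomial n x).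
Proof.
apply: ess_boundedB; first exact: ess_bounded_monomial.
by apply: ess_bounded_inner; exact: ess_bounded_partial_sum.
Qed.

(** The function h = adj Theta z^n x has no frequency above n, so its analytic part is the
    polynomial [partial_sum h n.+1]. Removing Theta times this polynomial leaves something
    orthogonal to Theta H^2, and still bounded. *)
Lemma model_monomial_in n x : K (model_monomial n x).
Proof.
set h := fun w => adj dot (Theta w) (monomial n%:Z x w).
have Lh : L2 dot h by apply: L2_inner_adj; exact: L2_monomial.
have Hp := H2_partial_sum dot h n.+1; have Lp := H2_L2 Hp.
split; first by apply: (subspaceB (H2_subspace dot)); [exact: H2_monomial|exact: H2_inner].
move=> g Hg; have Lg := H2_L2 Hg.
rewrite (ipBl hP); [|exact: L2_monomial|exact: L2_inner..].
rewrite L2dot_inner//.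
have -> : ip (monomial n%:Z x) (fun z => Theta z (g z)) = ip h g.
  rewrite /h L2dot_adj; apply: L2dot_ext => // t; by rewrite adjK.
rewrite -(ipBl hP)//; have Lhp := subspaceB (L2_subspace dot) Lh Lp.
apply: ip_conj0 => //; apply: H2_orthogonal => // k y k0.
case: k k0 => // k _; have [kn|nk] := ltnP k n.+1; first exact: partial_sum_monomial.
rewrite (ipBl hP)//; last exact: L2_monomial.
have -> : ip h (monomial k%:Z y) = 0.
  rewrite /h L2dot_adj.
  have -> : (fun z => adj dot (adj dot (Theta z)) (monomial k y z)) =
      (fun z => Theta z (monomial k y z)).
    by apply/funext => z; rewrite adjK.
  apply: ip_conj0; [exact/L2_inner/L2_monomial|exact: L2_monomial|].
  rewrite L2dot_inner_monomial.
  have -> : fourier Theta (n%:Z - k%:Z) = 0.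
    by case: innerT => [[[_ F0] _] _]; apply: F0; rewrite subr_lt0 ltz_nat.
  by rewrite lfunE dot0l.
rewrite sub0r (ip_suml hP) => [||i _]; [|exact: L2_monomial..].
rewrite big1 ?oppr0// => i _; rewrite L2dot_monomial (_ : (_ == _) = false) ?mul0r//.
by apply/negbTE; rewrite eqz_nat neq_ltn (leq_trans (ltn_ord i) nk).
Qed.

Lemma ip_model_monomial f n x : K f ->
  ip f (model_monomial n x) = ip f (monomial n%:Z x).
Proof.
move=> Kf; have Lf := model_L2 Kf; have [_ f0] := Kf.
have Hp := H2_partial_sum dot (fun w => adj dot (Theta w) (monomial n%:Z x w)) n.+1.
rewrite (ipBr hP)//; [|exact: L2_monomial|exact/L2_inner/H2_L2].
by rewrite f0// subr0.
Qed.

Lemma model_monomial_infty n x : model_infty dot Theta (model_monomial n x).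
Proof.
split; first exact: model_monomial_in.
apply/HinftyP; split; first by case: (model_monomial_in n x).
exact: model_monomial_bounded.
Qed.

(** Pairing with the bounded functions [model_monomial n x] reads off each Fourier coefficient of h
    of nonnegative index. *)
Lemma model_infty_dense h : K h -> (forall f, model_infty dot Theta f -> ip f h = 0) ->
  h =T (fun=> 0).
Proof.
move=> Kh h0; have Lh := model_L2 Kh; apply: (L2_fourier_eq0 Lh) => n x.
have [n0|n0] := leP 0 n; last exact: H2_monomial_eq0 (model_H2 Kh) n0.
case: n n0 => // n _; rewrite -ip_model_monomial//.
apply: ip_conj0 => //; first exact/model_L2/model_monomial_in.
exact/h0/model_monomial_infty.
Qed.

End InnerFunctions.

(** * Shifts and defect spaces *)

Section ShiftsAndDefects.
Context {R : realType} {H : vectType R[i]}.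
Variables (dot : {dot H for @Num.conj R[i]}) (Theta : R[i] -> 'End(H)).
Hypotheses (innerT : inner dot Theta) (pureT : pure dot Theta).
Local Notation E := (R[i] -> H).
Local Notation ip := (L2dot dot).
Local Notation Theta0 := (analytic_ext Theta 0).
Local Notation K := (model dot Theta).
Implicit Types (f g k : R[i] -> H) (x y : H).

Let hP := L2_hilbert dot.
Let LB f g : L2 dot f -> L2 dot g -> L2 dot (f - g).
Proof. exact: subspaceB (L2_subspace dot). Qed.
Let KL f : K f -> L2 dot f. Proof. exact: model_L2. Qed.

Lemma model_ae f g : L2 dot f -> f =T g -> K g -> K f.
Proof.
move=> Lf fg; rewrite (modelE dot Theta) => -[Lg g0]; split=> // s Ss.
rewrite -(g0 _ Ss); apply: L2dot_ae => //; try exact: (model_test_L2 innerT).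
exact: ae_circleW.
Qed.

(** The form in which density is used. Projecting h on the model space does not change its pairings
    with that space, and the projection is null by [model_infty_dense]. *)
Lemma model_infty_test h : L2 dot h ->
  (forall f, model_infty dot Theta f -> ip f h = 0) -> forall f, K f -> ip f h = 0.
Proof.
move=> Lh h0; have [Kp pE] := model_proj innerT Lh; have Lp := KL Kp.
have E f : K f -> ip f (orthoproj dot K h) = ip f h.
  move=> Kf; have Lf := KL Kf.
  by rewrite (L2dot_conj Lp Lf) pE// -(L2dot_conj Lh Lf).
have pnull : orthoproj dot K h =T (fun=> 0).
  by apply: (model_infty_dense innerT Kp) => f f1; rewrite E ?h0//; case: f1.
move=> f Kf; rewrite -E//; have Lf := KL Kf.
by apply: ip_conj0 => //; exact: ip_null_l pnull.
Qed.

Definition bshift f : E := fun z => z ^ (- 1) *: (f z - fourier f 0).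

Lemma ip_cst f x : L2 dot f -> ip f (fun=> x) = dot (fourier f 0) x.
Proof. by move=> Lf; rewrite fourier_dot// monomial0. Qed.

Lemma L2_center f : L2 dot f -> L2 dot (fun z => f z - fourier f 0).
Proof. by move=> Lf; exact: (LB Lf (L2_cst dot (fourier f 0))). Qed.

Lemma bshift_H2 f : H2 dot f -> H2 dot (bshift f).
Proof.
move=> Hf; have Lf := H2_L2 Hf; have Lc := L2_center Lf.
apply: H2P; first exact: L2_exprz.
move=> n x n0; rewrite L2dot_shift_monomial opprK.
rewrite (ipBl hP Lf (L2_cst dot (fourier f 0)) (L2_monomial dot _ x)).
rewrite -(monomial0 (fourier f 0)) L2dot_monomial.
have [n1|n1] := ltP (n + 1) 0.
  by rewrite H2_monomial_eq0// gt_eqF// mul0r subrr.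
have -> : n + 1 = 0 by apply/eqP; rewrite eq_le n1 andbT; lia.
by rewrite eqxx mul1r fourier_dot// subrr.
Qed.

(** Pairing T f with Theta g is pairing f - f(0) with z Theta g = Theta (z g), which is orthogonal
    to f and, having no constant term, to f(0). *)
Lemma bshift_model f : K f -> K (bshift f).
Proof.
move=> Kf; have Lf := KL Kf; split; first exact: bshift_H2 (model_H2 Kf).
move=> g Hg; have Lg := H2_L2 Hg; rewrite L2dot_shift opprK.
have Hzg : H2 dot (fun z => z ^ 1 *: g z).
  apply: H2P => [|n x n0]; first exact: L2_exprz.
  by rewrite L2dot_shift_monomial H2_monomial_eq0//; lia.
have Lzg := H2_L2 Hzg.
have -> : (fun z => z ^ 1 *: Theta z (g z)) = (fun z => Theta z (z ^ 1 *: g z)).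
  by apply/funext => z; rewrite linearZ.
rewrite (ipBl hP Lf (L2_cst dot _) (L2_inner innerT Lzg)).
have [_ f0] := Kf; rewrite f0// sub0r.
apply/eqP; rewrite oppr_eq0; apply/eqP; apply: ip_conj0 => //; [exact: L2_inner|exact: L2_cst|].
apply/(@ip_conj0 _ _ dot); [exact: L2_cst|exact: L2_inner|].
have -> : (fun z => Theta z (z ^ 1 *: g z)) = (fun z => z ^ 1 *: Theta z (g z)).
  by apply/funext => z; rewrite linearZ.
apply: ip_conj0; [exact/L2_exprz/L2_inner|exact: L2_cst|].
rewrite -(monomial0 (fourier f 0)) L2dot_shift_monomial.
by apply: H2_monomial_eq0 => //; exact: H2_inner.
Qed.

Lemma bshift_bounded f : ess_bounded dot f -> ess_bounded dot (bshift f).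
Proof.
move=> bf; apply: (@ess_bounded_exprz _ _ dot (- 1) (fun z => f z - fourier f 0)).
exact: (ess_boundedB bf (ess_bounded_cst dot (fourier f 0))).
Qed.

(** The subtracted term z^-1 f(0) has a negative frequency, so k does not see it. This makes
    [bshift] the adjoint of the compressed shift. *)
Lemma ip_bshift k f : H2 dot k -> L2 dot f ->
  ip (fun z => z *: k z) f = ip k (bshift f).
Proof.
move=> Hk Lf; have Lk := H2_L2 Hk; have Lc := L2_center Lf.
transitivity (ip (fun z => z ^ 1 *: k z) f); first by apply: L2dot_ext.
rewrite L2dot_shift.
have -> : bshift f = (fun z => z ^ (- 1) *: f z) - monomial (- 1) (fourier f 0).
  by apply/funext => z; rewrite /bshift scalerBr.
rewrite (ipBr hP (L2_exprz _ Lf) (L2_monomial dot _ _) Lk).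
by rewrite (H2_monomial_eq0 _ Hk)// subr0.
Qed.

Lemma compressed_shift_model f : K f -> K (compressed_shift dot Theta f) /\
  forall g, K g -> ip (compressed_shift dot Theta f) g = ip f (bshift g).
Proof.
move=> Kf; have Lf := KL Kf.
have Lzf : L2 dot (fun z => z *: f z) by exact: (L2_exprz 1 Lf).
have [KS SE] := model_proj innerT Lzf.
split=> // g Kg; rewrite SE// ip_bshift//; [exact: model_H2 Kf|exact: KL].
Qed.

Definition kernel0 x : E := fun z => x - Theta z (adj dot Theta0 x).

(** The constant term of adj Theta x is adj Theta0 x, so the kernel is the projection of the
    constant x; the reproducing property follows. *)
Lemma kernel0E x : kernel0 x = model_monomial dot Theta 0 x.
Proof.
apply/funext => z; rewrite /kernel0 /model_monomial monomial0 /partial_sum.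
rewrite big_ord1 monomial0 [in RHS]/GRing.add/=; congr (_ - Theta z _).
apply: (@dot_ext _ _ dot) => y.
have Lx : L2 dot (fun w => adj dot (Theta w) x).
  by apply: (L2_inner_adj innerT (f := fun=> x)); exact: L2_cst.
rewrite fourier_dot// monomial0 L2dot_adj -adjP'.
have -> : (fun w => adj dot (adj dot (Theta w)) y) = (fun w => Theta w y).
  by apply/funext => w; rewrite adjK.
have Ly : L2 dot (fun w => Theta w y).
  by apply: (L2_inner innerT (f := fun=> y)); exact: L2_cst.
by rewrite (L2dot_conj Ly (L2_cst dot x)) -(dot_inner0 innerT) -dot_conj.
Qed.

Lemma kernel0_model x : K (kernel0 x).
Proof. by rewrite kernel0E; exact: model_monomial_in. Qed.

Lemma ip_kernel0 f x : K f -> ip f (kernel0 x) = dot (fourier f 0) x.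
Proof.
move=> Kf; rewrite kernel0E (ip_model_monomial innerT)//.
by rewrite monomial0 ip_cst//; exact: KL.
Qed.

Lemma ip_kernel0_l f x : K f -> ip (kernel0 x) f = dot x (fourier f 0).
Proof.
move=> Kf; rewrite (L2dot_conj (KL Kf) (KL (kernel0_model x))).
by rewrite ip_kernel0// -dot_conj.
Qed.

Lemma fourier_kernel0 x : fourier (kernel0 x) 0 = x - Theta0 (adj dot Theta0 x).
Proof.
apply: (@dot_ext _ _ dot) => y.
have Lx : L2 dot (fun z => Theta z (adj dot Theta0 x)).
  by apply: (L2_inner innerT (f := fun=> _)); exact: L2_cst.
rewrite fourier_dot ?monomial0; last exact/KL/kernel0_model.
rewrite (ipBl hP (L2_cst dot x) Lx (L2_cst dot y)) L2dot_cst.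
by rewrite -(dot_inner0 innerT) dotBl.
Qed.

Lemma kernel0_linear a x y : kernel0 (a *: x + y) = a *: kernel0 x + kernel0 y.
Proof.
have adjL u v : adj dot Theta0 (a *: u + v) = a *: adj dot Theta0 u + adj dot Theta0 v.
  exact: linearP.
apply/funext => z; rewrite /kernel0 adjL linearP.
rewrite /GRing.add/= /GRing.scale/=.
by rewrite scalerBr opprD addrACA.
Qed.

Lemma defect_kernel0 x : defect dot Theta (kernel0 x).
Proof. by split; [exact/KL/kernel0_model|exists x; exact: ae_circleW]. Qed.

Lemma defectP f : defect dot Theta f -> exists x, f =T kernel0 x.
Proof. by move=> [_ [x fx]]; exists x. Qed.

Lemma defect_model f : defect dot Theta f -> K f.
Proof. by move=> [Lf [x fx]]; exact: model_ae (kernel0_model x). Qed.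

Lemma defect_subspace : linear_subspace (defect dot Theta : set E).
Proof.
split.
  split; first exact: (L2_cst dot 0).
  by exists 0; apply: ae_circleW => z;
    rewrite (linear0 (adj dot Theta0)) (linear0 (Theta z)) subrr.
move=> a f g [Lf [x fx]] [Lg [y gy]]; split; first by case: (L2_subspace dot) => _; exact.
exists (a *: x + y); apply: ae_circleS2 fx gy => z fx gy.
rewrite -/(kernel0 (a *: x + y) z) kernel0_linear.
by rewrite /GRing.add/= /GRing.scale/= fx gy.
Qed.

(** If x = Theta0 (adj Theta0 x), then Theta0 does not shrink adj Theta0 x, which is then 0 by
    purity, and x with it. Finite dimension turns this injectivity into invertibility. *)
Lemma defect_inverse : exists G : 'End(H),
  (forall x, fourier (kernel0 (G x)) 0 = x) /\
  (forall x, G (fourier (kernel0 x) 0) = x).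
Proof.
pose G1 : 'End(H) := (\1 - (Theta0 \o adj dot Theta0))%VF.
have G1E x : G1 x = fourier (kernel0 x) 0.
  by rewrite fourier_kernel0 /G1 add_lfunE id_lfunE opp_lfunE comp_lfunE.
have G10 x : G1 x = 0 -> x = 0.
  rewrite G1E fourier_kernel0 => /eqP; rewrite subr_eq0 => /eqP xE.
  have y0 : adj dot Theta0 x = 0.
    by apply: (strict_contraction pureT); rewrite -adjP -xE.
  by rewrite xE y0 linear0.
have [G [G1G GG1]] := injective_lfun_inv G10.
by exists G; split=> x; rewrite -G1E ?G1G ?GG1.
Qed.

(** On the circle this is the backward shift of the column Theta x, whence its membership in H^2. *)
Definition cokernel x : E := fun z => Num.conj z *: (Theta z x - Theta0 x).

Lemma L2_inner_cst x : L2 dot (fun z => Theta z x).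
Proof. by apply: (L2_inner innerT (f := fun=> x)); exact: L2_cst. Qed.

Lemma cokernel_circle x t :
  cokernel x (circle_pt t) = circle_pt t ^ (- 1) *: (Theta (circle_pt t) x - Theta0 x).
Proof. by rewrite /cokernel -circle_pt_inv. Qed.

Lemma fourier_inner0 x : fourier (fun z => Theta z x) 0 = Theta0 x.
Proof.
apply: (@dot_ext _ _ dot) => y; rewrite (dot_inner0 innerT).
by rewrite fourier_dot ?monomial0//; exact: L2_inner_cst.
Qed.

Lemma cokernel_bshift x t :
  cokernel x (circle_pt t) = bshift (fun z => Theta z x) (circle_pt t).
Proof. by rewrite cokernel_circle /bshift fourier_inner0. Qed.

(** Theta preserves pairings, so Theta x against Theta (z g) is x against z g; this and the pairing
    of Theta0 x with z Theta g vanish because neither function has a constant term. *)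
Lemma ip_center_inner x g : H2 dot g ->
  ip (fun z => Theta z x - Theta0 x) (fun z => Theta z (z ^ 1 *: g z)) = 0.
Proof.
move=> Hg; have Lg := H2_L2 Hg; have Lzg := L2_exprz 1 Lg.
have LTzg := L2_inner innerT Lzg.
have Hz y : H2 dot (fun z => z ^ 1 *: Theta z (g z)).
  apply: H2P => [|n w n0]; first exact/L2_exprz/L2_inner.
  by rewrite L2dot_shift_monomial H2_monomial_eq0//; [exact: H2_inner|lia].
rewrite (ipBl hP (L2_inner_cst x) (L2_cst dot (Theta0 x)) LTzg).
rewrite (L2dot_inner innerT (f := fun=> x) (g := fun z => z ^ 1 *: g z))//; last exact: L2_cst.
have zero y f : H2 dot f -> ip (fun=> y) (fun z => z ^ 1 *: f z) = 0.
  move=> Hf; have Lf := H2_L2 Hf.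
  apply: ip_conj0; [exact: L2_exprz|exact: L2_cst|].
  by rewrite -(monomial0 y) L2dot_shift_monomial H2_monomial_eq0.
rewrite zero// sub0r.
have -> : (fun z => Theta z (z ^ 1 *: g z)) = (fun z => z ^ 1 *: Theta z (g z)).
  by apply/funext => z; rewrite linearZ.
by rewrite zero ?oppr0//; exact: H2_inner.
Qed.

Lemma cokernel_model x : K (cokernel x).
Proof.
have Lb : L2 dot (bshift (fun z => Theta z x)).
  by apply: L2_exprz; exact/L2_center/L2_inner_cst.
have mc : vmeasurable (cokernel x).
  by apply: (@vmeasurable_ext _ _ (bshift (fun z => Theta z x))) => [t|];
    [rewrite cokernel_bshift|case: Lb].
have cb : cokernel x =T bshift (fun z => Theta z x).
  by apply: ae_circle_pt => t; exact: cokernel_bshift.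
have Lc : L2 dot (cokernel x).
  by apply: L2_ae mc _ Lb; apply: ae_circleS cb => z ->.
apply: model_ae Lc cb _; split.
  apply: bshift_H2; apply: (H2_inner innerT (f := fun=> x)); exact: H2_cst.
move=> g Hg; rewrite L2dot_shift opprK fourier_inner0.
have -> : (fun z => z ^ 1 *: Theta z (g z)) = (fun z => Theta z (z ^ 1 *: g z)).
  by apply/funext => z; rewrite linearZ.
exact: ip_center_inner.
Qed.

Lemma cokernel_linear a x y : cokernel (a *: x + y) = a *: cokernel x + cokernel y.
Proof.
apply/funext => z; transitivity (a *: cokernel x z + cokernel y z); last by [].
rewrite /cokernel (linearP (Theta z)) (linearP Theta0).
by rewrite opprD addrACA -scalerBr scalerDr !scalerA mulrC.
Qed.

Lemma ip_cokernel x y :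
  ip (cokernel x) (cokernel y) = dot x y - dot (Theta0 x) (Theta0 y).
Proof.
have Lc w : L2 dot (fun z => Theta z w - Theta0 w).
  exact: (LB (L2_inner_cst w) (L2_cst dot (Theta0 w))).
transitivity (ip (fun z => Theta z x - Theta0 x) (fun z => Theta z y - Theta0 y)).
  rewrite -[RHS](L2dot_shift2 dot (- 1)).
  by apply: L2dot_ext => t; rewrite cokernel_circle.
rewrite (ipBl hP (L2_inner_cst x) (L2_cst dot (Theta0 x)) (Lc y)).
rewrite !(ipBr hP (L2_inner_cst y) (L2_cst dot (Theta0 y))); [|exact: L2_cst|exact: L2_inner_cst].
rewrite (L2dot_inner innerT (f := fun=> x) (g := fun=> y)); [|exact: L2_cst..].
rewrite !L2dot_cst -(dot_inner0 innerT).
rewrite (L2dot_conj (L2_inner_cst y) (L2_cst dot (Theta0 x))).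
by rewrite -(dot_inner0 innerT) -dot_conj subrr subr0.
Qed.

Lemma codefect_cokernel x : codefect dot Theta (cokernel x).
Proof. by split; [exact/KL/cokernel_model|exists x; exact: ae_circleW]. Qed.

Lemma codefect_model f : codefect dot Theta f -> K f.
Proof. by move=> [Lf [x fx]]; exact: model_ae (cokernel_model x). Qed.

Lemma codefect_subspace : linear_subspace (codefect dot Theta : set E).
Proof.
split.
  split; first exact: (L2_cst dot 0).
  by exists 0; apply: ae_circleW => z;
    rewrite (linear0 Theta0) (linear0 (Theta z)) subrr scaler0.
move=> a f g [Lf [x fx]] [Lg [y gy]]; split; first by case: (L2_subspace dot) => _; exact.
exists (a *: x + y); apply: ae_circleS2 fx gy => z fx gy.
rewrite -/(cokernel (a *: x + y) z) cokernel_linear.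
by rewrite /GRing.add/= /GRing.scale/= fx gy.
Qed.

(** The Gram operator of the generators is the identity minus adj Theta0 composed with Theta0,
    injective by purity. Its inverse gives the coordinates of projections on the codefect space. *)
Lemma codefect_inverse : exists G : 'End(H),
  forall x y, ip (cokernel (G x)) (cokernel y) = dot x y.
Proof.
pose G2 : 'End(H) := (\1 - (adj dot Theta0 \o Theta0))%VF.
have G2E x : G2 x = x - adj dot Theta0 (Theta0 x).
  by rewrite /G2 add_lfunE id_lfunE opp_lfunE comp_lfunE.
have G20 x : G2 x = 0 -> x = 0.
  rewrite G2E => /eqP; rewrite subr_eq0 => /eqP xE.
  by apply: (strict_contraction pureT); rewrite {1}xE -adjP'.
have [G [G2G _]] := injective_lfun_inv G20.
exists G => x y; rewrite ip_cokernel -[in RHS](G2G x) G2E dotBl.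
by rewrite -adjP'.
Qed.

Lemma subspace_projE (D : set E) f p : linear_subspace D -> D `<=` L2 dot ->
  L2 dot f -> D p -> (forall g, D g -> ip p g = ip f g) ->
  [/\ D (orthoproj dot D f), orthoproj dot D f =T p
    & forall g, D g -> ip (orthoproj dot D f) g = ip f g].
Proof.
move=> sD DL Lf Dp pE.
have [DP PE] : D (orthoproj dot D f) /\
    forall g, D g -> ip (f - orthoproj dot D f) g = 0.
  apply: orthoprojP; exists p => // g Dg.
  by rewrite (ipBl hP) ?pE ?subrr//; exact: DL.
have PE' g : D g -> ip (orthoproj dot D f) g = ip f g.
  move=> Dg; have := PE g Dg; rewrite (ipBl hP)//; [|exact: DL..].
  by move/eqP; rewrite subr_eq0 => /eqP.
split=> //; apply: (subspace_eq_test sD DL) => // h Dh.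
by rewrite PE' ?pE.
Qed.

End ShiftsAndDefects.

(** * Weak identities for operators between subspaces of L^2 *)

Section LinearOperators.
Context {R : realType} {H : vectType R[i]}.
Variable dot : {dot H for @Num.conj R[i]}.
Local Notation E := (R[i] -> H).
Local Notation ip := (L2dot dot).
Implicit Types (f g h : R[i] -> H) (x y : H) (K : set (R[i] -> H)).

Let hP := L2_hilbert dot.

Lemma L2dot_ae_l f f' h : L2 dot f -> L2 dot f' -> L2 dot h -> f =T f' ->
  ip f h = ip f' h.
Proof. by move=> Lf Lf' Lh ff'; apply: L2dot_ae => //; exact: ae_circleW. Qed.

Lemma L2dot_ae_r f h h' : L2 dot f -> L2 dot h -> L2 dot h' -> h =T h' ->
  ip f h = ip f h'.
Proof. by move=> Lf Lh Lh' hh'; apply: L2dot_ae => //; exact: ae_circleW. Qed.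

Lemma linear_op_ip K1 K2 A h : linear_subspace (K1 : set E) -> K2 `<=` L2 dot ->
  linear_op K1 K2 A -> L2 dot h ->
  forall (a : R[i]) f g, K1 f -> K1 g ->
    ip (A (a *: f + g)) h = a * ip (A f) h + ip (A g) h.
Proof.
move=> [_ sK1] K2L [AK _ AL] Lh a f g Kf Kg.
have Lf := K2L _ (AK _ Kf); have Lg := K2L _ (AK _ Kg).
rewrite -(L2dot_linear _ Lf Lg Lh); apply: L2dot_ae => //.
- exact/K2L/AK/sK1.
- by case: (L2_subspace dot) => _; exact.
- exact: AL.
- exact: ae_circleW.
Qed.

Lemma linear_op_ip_ae K1 K2 A f g h : K2 `<=` L2 dot ->
  linear_op K1 K2 A -> L2 dot h -> K1 f -> K1 g -> f =T g ->
  ip (A f) h = ip (A g) h.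
Proof.
move=> K2L [AK AE _] Lh Kf Kg fg; apply: L2dot_ae => //; [exact/K2L/AK..| |].
  exact: AE.
exact: ae_circleW.
Qed.

Lemma fourier_ae f g : L2 dot f -> L2 dot g -> f =T g -> fourier f 0 = fourier g 0.
Proof.
move=> Lf Lg fg; apply: (@dot_ext _ _ dot) => y; rewrite !fourier_dot//.
by apply: L2dot_ae => //; [exact: L2_monomial..|exact: ae_circleW].
Qed.

Lemma fourier0_linear (a : R[i]) f g : L2 dot f -> L2 dot g ->
  fourier (a *: f + g) 0 = a *: fourier f 0 + fourier g 0.
Proof.
move=> Lf Lg; apply: (@dot_ext _ _ dot) => y.
have Lfg : L2 dot (a *: f + g) by case: (L2_subspace dot) => _; exact.
rewrite dotDl dotZl !fourier_dot//.
exact: (L2dot_linear _ Lf Lg (L2_monomial dot _ _)).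
Qed.

(** [beta] is linear only after pairing, because operators are linear only up to null functions.
    Keeping its values on an orthonormal basis and extending them linearly gives a true operator at
    every point. *)
Lemma operator_family K (beta : H -> E) : linear_subspace (K : set E) ->
  K `<=` L2 dot -> (forall x, K (beta x)) ->
  (forall g, K g -> scalar (fun x => ip (beta x) g)) ->
  exists Psi : R[i] -> 'End(H), (forall x, K (fun z => Psi z x)) /\
    forall x g, K g -> ip (fun z => Psi z x) g = ip (beta x) g.
Proof.
move=> sK KL Kb bL.
pose Psi z := \sum_(j < onb_size dot) outer dot (beta (onb dot j) z) (onb dot j).
have PsiE x : (fun z => Psi z x) =
    \sum_(j < onb_size dot) dot x (onb dot j) *: beta (onb dot j).
  apply/funext => z; rewrite /Psi sum_lfunE fct_sumE.
  by apply: eq_bigr => j _; rewrite outerE.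
exists Psi; split=> [x|x g Kg].
  by rewrite PsiE; apply: subspace_sum => // j _; exact: subspaceZ.
have Lg := KL _ Kg.
rewrite PsiE (ip_suml hP) => [||j _]; [|exact: Lg|]; last first.
  by apply: (subspaceZ _ (L2_subspace dot)); exact: KL.
rewrite [in RHS](onb_sum dot x) (scalar_sum _ _ _ (bL g Kg)).
by apply: eq_bigr => j _; rewrite (ipZl hP)//; exact: KL.
Qed.

End LinearOperators.

(** * The adjoint of the modified compressed shift *)

Section ModifiedShift.
Context {R : realType} {H : vectType R[i]}.
Variables (dot : {dot H for @Num.conj R[i]}) (Theta : R[i] -> 'End(H)).
Hypotheses (innerT : inner dot Theta) (pureT : pure dot Theta).
Variable X : (R[i] -> H) -> (R[i] -> H).
Hypothesis linX : linear_op (codefect dot Theta) (defect dot Theta) X.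
Local Notation E := (R[i] -> H).
Local Notation ip := (L2dot dot).
Local Notation Theta0 := (analytic_ext Theta 0).
Local Notation K := (model dot Theta).
Implicit Types (f g k : R[i] -> H) (x y : H).

Let hP := L2_hilbert dot.
Let KL f : K f -> L2 dot f. Proof. exact: model_L2. Qed.
Let sK : linear_subspace (K : set E). Proof. exact: model_subspace. Qed.
Let DL f : defect dot Theta f -> L2 dot f. Proof. by case. Qed.
Let CL f : codefect dot Theta f -> L2 dot f. Proof. by case. Qed.

(** By purity some kernel has the value f(0) at 0. Pairings with kernels see only values at 0, so
    this kernel is the projection. *)
Lemma defect_proj f : K f ->
  [/\ defect dot Theta (orthoproj dot (defect dot Theta) f),
      fourier (orthoproj dot (defect dot Theta) f) 0 = fourier f 0
    & forall g, defect dot Theta g ->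
        ip (orthoproj dot (defect dot Theta) f) g = ip f g].
Proof.
move=> Kf; have [G [Gr _]] := defect_inverse innerT pureT.
pose p := kernel0 dot Theta (G (fourier f 0)).
have Kp : K p by exact: kernel0_model.
have [DP Pp PE] : [/\ defect dot Theta (orthoproj dot (defect dot Theta) f),
    orthoproj dot (defect dot Theta) f =T p
    & forall g, defect dot Theta g ->
        ip (orthoproj dot (defect dot Theta) f) g = ip f g].
  apply: subspace_projE => //.
  - exact: defect_subspace.
  - exact: KL.
  - exact: defect_kernel0.
  - move=> g Dg; have Lg := DL Dg; have [y gy] := defectP Dg.
    have Ly := KL (kernel0_model innerT y).
    rewrite (L2dot_ae_r (KL Kp) Lg Ly gy) (L2dot_ae_r (KL Kf) Lg Ly gy).
    by rewrite !ip_kernel0// Gr.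
split=> //; rewrite (fourier_ae (DL DP) (KL Kp) Pp).
exact: Gr.
Qed.

Lemma codefect_proj : exists G : 'End(H), forall f, L2 dot f -> exists v,
  [/\ forall y, dot v y = ip f (cokernel Theta y),
      codefect dot Theta (orthoproj dot (codefect dot Theta) f)
    & orthoproj dot (codefect dot Theta) f =T cokernel Theta (G v)].
Proof.
have [G GE] := codefect_inverse innerT pureT.
have Lc y : L2 dot (cokernel Theta y) by exact/KL/cokernel_model.
exists G => f Lf.
have [v vE] : exists v, forall y, ip (cokernel Theta y) f = dot y v.
  apply: functional_dot => a u w.
  by rewrite cokernel_linear; exact: (L2dot_linear _ (Lc u) (Lc w) Lf).
have fc y : dot v y = ip f (cokernel Theta y).
  by rewrite (L2dot_conj (Lc y) Lf) vE -dot_conj.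
exists v; split=> //; have [] : [/\ codefect dot Theta (orthoproj dot (codefect dot Theta) f),
    orthoproj dot (codefect dot Theta) f =T cokernel Theta (G v)
    & forall g, codefect dot Theta g ->
        ip (orthoproj dot (codefect dot Theta) f) g = ip f g] => //;
  apply: subspace_projE => //; try exact: codefect_subspace;
  try exact: codefect_cokernel;
  move=> g Cg; have Lg := CL Cg; have [_ [y gy]] := Cg;
  by rewrite (L2dot_ae_r (Lc _) Lg (Lc y) gy) (L2dot_ae_r Lf Lg (Lc y) gy) GE fc.
Qed.

(** Both arguments are backward shifts, so the pairing is that of Theta w - Theta0 w with f - f(0).
    Since f is orthogonal to Theta w, only multiples of <Theta0 w, f(0)> remain. *)
Lemma ip_cokernel_bshift w f : K f ->
  ip (cokernel Theta w) (bshift f) = - dot (Theta0 w) (fourier f 0).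
Proof.
move=> Kf; have Lf := KL Kf; have Lw := L2_inner_cst innerT w.
have Lc y : L2 dot (fun=> y : H) by exact: L2_cst.
have Lwc := subspaceB (L2_subspace dot) Lw (Lc (Theta0 w)).
transitivity (ip ((fun z => Theta z w) - (fun=> Theta0 w)) (f - (fun=> fourier f 0))).
  rewrite -[RHS](L2dot_shift2 dot (- 1)).
  by apply: L2dot_ext => t; rewrite ?cokernel_circle.
rewrite (ipBr hP)// !(ipBl hP)// L2dot_cst.
rewrite -(dot_inner0 innerT) subrr subr0.
have -> : ip (fun z => Theta z w) f = 0.
  have [_ f0] := Kf; apply: ip_conj0 => //.
  by apply: (f0 (fun=> w)); exact: H2_cst.
by rewrite sub0r (L2dot_conj Lf (Lc _)) ip_cst// -dot_conj.
Qed.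

Lemma modified_shift_model k : K k -> K (modified_shift dot Theta X k).
Proof.
move=> Kk; have [G GP] := codefect_proj.
have [_ [_ Cp _]] := GP k (KL Kk).
have [_ [_ Cq _]] := GP _ (CL Cp).
have [XK _ _] := linX.
rewrite /modified_shift /hat; apply: (subspaceD sK).
  by have [] := compressed_shift_model innerT Kk.
apply: (subspaceB sK).
  by apply: (defect_model innerT); exact: XK.
by have [] := compressed_shift_model innerT (codefect_model innerT Cp).
Qed.

(** The shifts S_X and S differ by (X - S) composed with the projection on the codefect space. On a
    generator [cokernel Theta w], X gives a kernel k_y, which pairs with f to <y, f(0)>, and S gives
    -<Theta0 w, f(0)>; so the correction of the adjoint is a generator depending linearly on
    f(0). *)
Lemma modified_shift_adjoint : exists Delta : 'End(H), forall f, K f ->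
  [/\ K (adjoint dot K (modified_shift dot Theta X) f),
      forall k, K k -> ip (modified_shift dot Theta X k) f =
        ip k (adjoint dot K (modified_shift dot Theta X) f)
    & adjoint dot K (modified_shift dot Theta X) f =T
        bshift f + cokernel Theta (Delta (fourier f 0))].
Proof.
have [G GP] := codefect_proj; have [XK XE _] := linX.
pose S := compressed_shift dot Theta.
have Kc w : K (cokernel Theta w) by exact: cokernel_model.
have SE k f : K k -> K f -> ip (S k) f = ip k (bshift f).
  by move=> Kk Kf; have [_] := compressed_shift_model innerT Kk; apply.
have KS k : K k -> K (S k).
  by move=> Kk; have [] := compressed_shift_model innerT Kk.
have KX p : codefect dot Theta p -> K (X p).
  by move=> Cp; apply: (defect_model innerT); exact: XK.
have Cc w : codefect dot Theta (cokernel Theta w) by exact: codefect_cokernel.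
pose D w f := ip (X (cokernel Theta w)) f - ip (cokernel Theta w) (bshift f).
have /choice[delta deltaE] w : exists d, forall f, K f -> D w f = dot d (fourier f 0).
  have [y Xy] := defectP (XK _ (Cc w)).
  exists (y + Theta0 w) => f Kf; rewrite /D ip_cokernel_bshift// opprK dotDl.
  congr (_ + _); have Ky := kernel0_model innerT y; have Lf := KL Kf.
  by rewrite -(ip_kernel0_l innerT _ Kf); apply: L2dot_ae => //;
    [exact/KL/KX|exact: KL|exact: ae_circleW].
(* The vectors [delta w] come from unrelated choices; only those at the basis vectors are kept, and
   linearity of [D] in w supplies the rest. *)
pose Delta0 := \sum_(j < onb_size dot) outer dot (onb dot j) (delta (onb dot j)).
have DE w f : K f -> D w f = dot w (Delta0 (fourier f 0)).
  move=> Kf; have Lf := KL Kf; have Lbf := KL (bshift_model innerT Kf).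
  have DL' : scalar (D^~ f).
    move=> a u v; rewrite /D cokernel_linear.
    rewrite (linear_op_ip (codefect_subspace dot Theta) DL linX Lf)//.
    rewrite (L2dot_linear _ (KL (Kc u)) (KL (Kc v)) Lbf).
    by rewrite mulrBr opprD addrACA.
  rewrite {1}(onb_sum dot w) (scalar_sum _ _ _ DL') /Delta0 sum_lfunE dot_sumr.
  apply: eq_bigr => j _; rewrite deltaE// outerE dotZr mulrC.
  by rewrite -dot_conj.
(* The projection of k is [cokernel Theta (G v)], where v represents the pairings of k with the
   generators; moving G across [dot] gives [adj dot G]. *)
exists (adj dot G \o Delta0)%VF => f Kf.
have Lf := KL Kf; have Kbf := bshift_model innerT Kf.
set h := bshift f + cokernel Theta ((adj dot G \o Delta0)%VF (fourier f 0)).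
have Kh : K h by exact: (subspaceD sK).
have hE k : K k -> ip (modified_shift dot Theta X k) f = ip k h.
  move=> Kk; have Lk := KL Kk.
  have [v [vE Cp pE]] := GP k Lk; have Lp := CL Cp.
  have [v' [vE' Cq qE]] := GP _ Lp.
  rewrite /modified_shift /hat.
  set p := orthoproj dot _ k in Cp pE Lp Cq qE vE' *.
  set q := orthoproj dot _ p in Cq qE *.
  have Kp : K p := codefect_model innerT Cp.
  have Kq : K q := codefect_model innerT Cq.
  have LSk := KL (KS _ Kk); have LSp := KL (KS _ Kp); have LXq := KL (KX _ Cq).
  have LXS : L2 dot (X q - S p) by exact: (subspaceB (L2_subspace dot)).
  transitivity (ip (S k) f + ip (X q - S p) f); first exact: (ipDl hP LSk LXS Lf).
  rewrite (ipBl hP LXq LSp Lf) (SE k f)// (SE p f)//.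
  rewrite (ipDr hP (KL Kbf) (KL (Kc _)) Lk).
  congr (_ + _).
  (* [hat] projects once more; on the codefect space the projection is the identity up to a null
     function. *)
  have qp : q =T p.
    have [_ //] := @subspace_projE _ _ dot (codefect dot Theta) p p
      (codefect_subspace dot Theta) CL Lp Cp (fun _ _ => erefl).
  have qc : q =T cokernel Theta (G v) by apply: ae_circleS2 qp pE => z -> ->.
  rewrite (linear_op_ip_ae DL linX Lf Cq (Cc (G v)) qc).
  rewrite (L2dot_ae_l Lp (KL (Kc (G v))) (KL Kbf) pE).
  by rewrite -/(D (G v) f) DE// comp_lfunE adjP vE.
have [Ka aE] := @adjointP _ _ dot K (modified_shift dot Theta X) f
  (ex_intro2 _ _ h Kh hE).
split=> //; apply: (model_eq innerT) => // k Kk.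
rewrite (L2dot_conj (KL Kk) (KL Ka)) -aE// hE//.
by rewrite -(L2dot_conj (KL Kk) (KL Kh)).
Qed.

End ModifiedShift.

(** * Operators on a defect space as operator functions *)

Section DefectOperators.
Context {R : realType} {H : vectType R[i]}.
Variables (dot : {dot H for @Num.conj R[i]}) (Theta : R[i] -> 'End(H)).
Hypotheses (innerT : inner dot Theta) (pureT : pure dot Theta).
Variables (K2 : set (R[i] -> H)).
Hypotheses (sK2 : linear_subspace (K2 : set (R[i] -> H))) (K2L : K2 `<=` L2 dot).
Local Notation ip := (L2dot dot).
Local Notation K := (model dot Theta).
Implicit Types (f g k : R[i] -> H) (x y : H) (B : (R[i] -> H) -> (R[i] -> H)).

Let hP := L2_hilbert dot.
Let KL f : K f -> L2 dot f. Proof. exact: model_L2. Qed.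

Lemma defect_eq : exists G : 'End(H), forall k, defect dot Theta k ->
  k =T kernel0 dot Theta (G (fourier k 0)).
Proof.
have [G [_ Gl]] := defect_inverse innerT pureT.
exists G => k Dk; have [y ky] := defectP Dk; have [Lk _] := Dk.
have Ly := KL (kernel0_model innerT y).
by rewrite (fourier_ae Lk Ly ky) Gl.
Qed.

(** An element k of the defect space is the kernel of G k(0), so B k depends linearly on k(0). *)
Lemma defect_operator_family B : linear_op (defect dot Theta) K2 B ->
  exists Psi : R[i] -> 'End(H), (forall x, K2 (fun z => Psi z x)) /\
    forall k g, defect dot Theta k -> K2 g ->
      ip (B k) g = ip (fun z => Psi z (fourier k 0)) g.
Proof.
move=> linB; have [BK BE _] := linB; have [G GE] := defect_eq.
have DL f : defect dot Theta f -> L2 dot f by case.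
have Dk x : defect dot Theta (kernel0 dot Theta x) by exact: defect_kernel0.
have [|g Kg|Psi [PsiK PsiE]] := @operator_family _ _ dot K2
    (fun x => B (kernel0 dot Theta (G x))) sK2 K2L.
- by move=> x; exact: BK.
- move=> a u v; rewrite linearP kernel0_linear.
  exact: (linear_op_ip (defect_subspace dot Theta) K2L linB (K2L Kg)).
exists Psi; split=> // k g D_k Kg; rewrite PsiE//.
exact: (linear_op_ip_ae K2L linB (K2L Kg) D_k (Dk _) (GE k D_k)).
Qed.

Lemma sqnorm_fourier0 f : L2 dot f ->
  complex.Re (dot (fourier f 0) (fourier f 0)) <= complex.Re (ip f f).
Proof.
move=> Lf; have Lc := L2_cst dot (fourier f 0).
have := hilbert_ge0 hP (subspaceB (L2_subspace dot) Lf Lc).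
rewrite (sqnormB hP)// ip_cst// L2dot_cst; lra.
Qed.

Lemma L2norm_sqr f : L2norm dot f ^+ 2 = complex.Re (ip f f).
Proof. by rewrite sqr_sqrtr//; exact: L2dot_ge0. Qed.

(** The bound is the L^2 norm of Psi: the pointwise Hilbert-Schmidt inequality is integrated with
    the constant vector k(0), whose norm is at most that of k. *)
Lemma operator_family_bounded (Psi : R[i] -> 'End(H)) :
  (forall x, K2 (fun z => Psi z x)) ->
  bounded_op dot (defect dot Theta) K2 (fun k z => Psi z (fourier k 0)).
Proof.
move=> PsiK; have DL f : defect dot Theta f -> L2 dot f by case.
split.
  split=> [f _|f g Df Dg fg|a f g Df Dg]; first exact: PsiK.
    by rewrite (fourier_ae (DL _ Df) (DL _ Dg) fg); exact: ae_circleW.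
  apply: ae_circleW => z.
  by rewrite (fourier0_linear a (DL _ Df) (DL _ Dg)) linearP.
have LPsi x : L2 dot (fun z => Psi z x) by exact: K2L.
have LF := L2_hs_intro LPsi.
pose C := complex.Re (L2dot (hs_dot dot) Psi Psi).
have C0 : 0 <= C by apply: Rintegral_ge0 => t _; exact: sqnorm_hs_ge0.
exists (Num.sqrt C) => f Df; have Lf := DL _ Df.
rewrite /L2norm -sqrtrM// ler_wsqrtr//.
set x := fourier f 0.
apply: (@le_trans _ _ (C * complex.Re (dot x x))); last first.
  by rewrite ler_wpM2l// sqnorm_fourier0.
have I01m : @measurable _ (measurableTypeR R) `[0%R, 1%R]%classic.
  exact: measurable_itv.
rewrite /C /L2dot/= -RintegralZr//; last exact: L2_hs_integrable LF.
apply: le_Rintegral => //.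
- exact: L2_integrable (LPsi x).
- have := integrableZl I01m (complex.Re (dot x x)) (L2_hs_integrable LF).
  by apply: eq_integrable => // t _; rewrite /= -EFinM mulrC.
- by move=> t _; exact: sqnorm_apply_le.
Qed.

End DefectOperators.

(** * Forms that split through the values at 0 *)

Section SplitForms.
Context {R : realType} {H : vectType R[i]}.
Variable dot : {dot H for @Num.conj R[i]}.
Variables K1 K2 : set (R[i] -> H).
Hypotheses (sK1 : linear_subspace (K1 : set (R[i] -> H))) (K1L : K1 `<=` L2 dot).
Hypotheses (sK2 : linear_subspace (K2 : set (R[i] -> H))) (K2L : K2 `<=` L2 dot).
Local Notation E := (R[i] -> H).
Local Notation ip := (L2dot dot).
Implicit Types (c d : (R[i] -> H) -> (R[i] -> H) -> R[i]).

Let hP := L2_hilbert dot.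

(** Columns are required in [K2] and [K1] so that Psi and Psi' can serve as B and B'. *)
Definition split_form c : Prop := exists Psi Psi' : R[i] -> 'End(H),
  [/\ forall x, K2 (fun z => Psi z x), forall y, K1 (fun z => Psi' z y)
    & forall f g, K1 f -> K2 g ->
        c f g = ip (fun z => Psi z (fourier f 0)) g +
                ip f (fun z => Psi' z (fourier g 0))].

Lemma split_formB c d : split_form c -> split_form d ->
  split_form (fun f g => c f g - d f g).
Proof.
move=> [Psi [Psi' [PK PK' cE]]] [Xi [Xi' [XK XK' dE]]].
exists (fun z => Psi z - Xi z), (fun z => Psi' z - Xi' z).
have E1 (F G : R[i] -> 'End(H)) x :
    (fun z => (F z - G z) x) = (fun z => F z x) - (fun z => G z x).
  by apply/funext => z; rewrite add_lfunE opp_lfunE.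
split=> [x|y|f g Kf Kg].
- by rewrite (E1 Psi Xi x); exact: subspaceB.
- by rewrite (E1 Psi' Xi' y); exact: subspaceB.
have Lf := K1L Kf; have Lg := K2L Kg.
rewrite cE// dE// (E1 Psi Xi) (E1 Psi' Xi') (ipBl hP) ?(ipBr hP)//; [|exact: K1L|exact: K1L|exact: K2L|exact: K2L].
by rewrite opprD addrACA.
Qed.

Lemma split_form_ext c d : (forall f g, K1 f -> K2 g -> c f g = d f g) ->
  split_form c -> split_form d.
Proof.
move=> cd [Psi [Psi' [PK PK' cE]]]; exists Psi, Psi'; split=> // f g Kf Kg.
by rewrite -cd// cE.
Qed.

Lemma split_form_l (beta : H -> E) : (forall x, K2 (beta x)) ->
  (forall g, K2 g -> scalar (fun x => ip (beta x) g)) ->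
  split_form (fun f g => ip (beta (fourier f 0)) g).
Proof.
move=> bK bL; have [Psi [PK PE]] := operator_family sK2 K2L bK bL.
exists Psi, (fun=> 0); split=> [//|y|f g Kf Kg].
  have -> : (fun z : R[i] => (0 : 'End(H)) y) = 0 by apply/funext => z; rewrite zero_lfunE.
  by case: sK1.
have -> : (fun z : R[i] => (0 : 'End(H)) (fourier g 0)) = 0.
  by apply/funext => z; rewrite zero_lfunE.
by rewrite PE// (ip0r hP) ?addr0//; exact: K1L.
Qed.

Lemma split_form_r (beta : H -> E) : (forall y, K1 (beta y)) ->
  (forall f, K1 f -> scalar (fun y => ip (beta y) f)) ->
  split_form (fun f g => ip f (beta (fourier g 0))).
Proof.
move=> bK bL; have [Psi [PK PE]] := operator_family sK1 K1L bK bL.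
exists (fun=> 0), Psi; split=> [x|//|f g Kf Kg].
  have -> : (fun z : R[i] => (0 : 'End(H)) x) = 0 by apply/funext => z; rewrite zero_lfunE.
  by case: sK2.
have -> : (fun z : R[i] => (0 : 'End(H)) (fourier f 0)) = 0.
  by apply/funext => z; rewrite zero_lfunE.
rewrite (ip0l hP) ?add0r; last exact: K2L.
have Lf := K1L Kf.
by rewrite (L2dot_conj (K1L (bK _)) Lf) -PE// -(L2dot_conj (K1L (PK _)) Lf).
Qed.

End SplitForms.

Section SplitFormSums.
Context {R : realType} {H : vectType R[i]}.
Variable dot : {dot H for @Num.conj R[i]}.
Variables K1 K2 : set (R[i] -> H).
Hypotheses (sK1 : linear_subspace (K1 : set (R[i] -> H))) (K1L : K1 `<=` L2 dot).
Hypotheses (sK2 : linear_subspace (K2 : set (R[i] -> H))) (K2L : K2 `<=` L2 dot).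
Implicit Types (c d : (R[i] -> H) -> (R[i] -> H) -> R[i]).
Local Notation split_form := (split_form dot K1 K2).
Local Notation split_formB := (split_formB sK1 K1L sK2 K2L).

Lemma split_formN c : split_form c -> split_form (fun f g => - c f g).
Proof.
move=> sc; apply: split_form_ext (split_formB (split_formB sc sc) sc) => f g _ _.
by rewrite subrr sub0r.
Qed.

Lemma split_formD c d : split_form c -> split_form d ->
  split_form (fun f g => c f g + d f g).
Proof.
move=> sc sd; apply: split_form_ext (split_formB sc (split_formN sd)) => f g _ _.
by rewrite opprK.
Qed.

End SplitFormSums.

(** * Reduction to the backward shift *)

Section BoundedOperators.
Context {R : realType} {H : vectType R[i]}.
Variable dot : {dot H for @Num.conj R[i]}.
Variables Theta1 Theta2 : R[i] -> 'End(H).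
Hypotheses (inner1 : inner dot Theta1) (pure1 : pure dot Theta1).
Hypotheses (inner2 : inner dot Theta2) (pure2 : pure dot Theta2).
Variables X1 X2 : (R[i] -> H) -> (R[i] -> H).
Hypothesis linX1 : linear_op (codefect dot Theta1) (defect dot Theta1) X1.
Hypothesis linX2 : linear_op (codefect dot Theta2) (defect dot Theta2) X2.
Variable A : (R[i] -> H) -> (R[i] -> H).
Local Notation E := (R[i] -> H).
Local Notation ip := (L2dot dot).
Local Notation K1 := (model dot Theta1).
Local Notation K2 := (model dot Theta2).
Local Notation D1 := (defect dot Theta1).
Local Notation D2 := (defect dot Theta2).
Hypothesis bndA : bounded_op dot K1 K2 A.
Implicit Types (f g h k : R[i] -> H) (x y : H).

Let hP := L2_hilbert dot.
Let K1L f : K1 f -> L2 dot f. Proof. exact: model_L2. Qed.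
Let K2L f : K2 f -> L2 dot f. Proof. exact: model_L2. Qed.
Let sK1 : linear_subspace (K1 : set E). Proof. exact: model_subspace. Qed.
Let sK2 : linear_subspace (K2 : set E). Proof. exact: model_subspace. Qed.
Let linA : linear_op K1 K2 A. Proof. by case: bndA. Qed.
Let AK f : K1 f -> K2 (A f). Proof. by case: linA => AK _ _; exact: AK. Qed.

(** The value at h of the adjoint of A, from the Riesz theorem on the annihilator [K1]. *)
Lemma bounded_op_representer h : L2 dot h ->
  exists2 h1, K1 h1 & forall f, K1 f -> ip (A f) h = ip f h1.
Proof.
move=> Lh; have [_ [M MA]] := bndA.
pose C := M ^+ 2 * complex.Re (ip h h).
have C0 : 0 <= C by rewrite mulr_ge0 ?sqr_ge0//; exact: (hilbert_ge0 hP).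
have AC f : K1 f -> complex.Re (ip (A f) h) ^+ 2 <= C * complex.Re (ip f f).
  move=> Kf; have LAf := K2L (AK Kf).
  apply: le_trans (Cauchy_Schwarz hP LAf Lh) _.
  rewrite /C mulrAC; apply: ler_wpM2r; first exact: (hilbert_ge0 hP).
  have Mf := MA f Kf; rewrite -!L2norm_sqr -exprMn ler_sqr// nnegrE ?sqrtr_ge0//.
  by apply: le_trans Mf; exact: sqrtr_ge0.
have := @Riesz _ _ _ _ hP (model_test dot Theta1) (fun f => ip (A f) h) C
  (model_test_L2 inner1).
rewrite -(modelE dot Theta1); apply=> //.
exact: (linear_op_ip sK1 K2L linA Lh).
Qed.

(** Tested on [K1], B' k is Psi' k(0), so its adjoint at f is the kernel k_w, where w represents y
    |-> <Psi' y, f>. Pairing with g then sees only the projection of g, whose value at 0 is g(0). *)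
Lemma defect_adjoint B' (Psi' : R[i] -> 'End(H)) f g :
  (forall y, K1 (fun z => Psi' z y)) ->
  (forall k f, D2 k -> K1 f -> ip (B' k) f = ip (fun z => Psi' z (fourier k 0)) f) ->
  K1 f -> K2 g ->
  K2 (orthoproj dot D2 (adjoint dot D2 B' f)) /\
  ip (orthoproj dot D2 (adjoint dot D2 B' f)) g =
    ip f (fun z => Psi' z (fourier g 0)).
Proof.
move=> PK BE Kf Kg; have Lf := K1L Kf; have Lg := K2L Kg.
have [w wE] : exists w, forall y, ip (fun z => Psi' z y) f = dot y w.
  apply: functional_dot => b u v; rewrite -(L2dot_linear b (K1L (PK u)) (K1L (PK v)) Lf).
  by apply: L2dot_ext => // t; rewrite linearP.
set q := adjoint dot D2 B' f.
have [Dq qE] : D2 q /\ forall k, D2 k -> ip (B' k) f = ip k q.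
  apply: adjointP; exists (kernel0 dot Theta2 w); first exact: defect_kernel0.
  move=> k Dk; rewrite BE// wE ip_kernel0//; exact: defect_model.
have Kq : K2 q by exact: (defect_model inner2).
have [DPq _ PqE] := defect_proj inner2 pure2 Kq.
have [DPg Pg0 PgE] := defect_proj inner2 pure2 Kg.
have DL u : D2 u -> L2 dot u by case.
split; first exact: (defect_model inner2).
rewrite (L2dot_conj Lg (DL _ DPq)) -PgE// -(L2dot_conj (DL _ DPg) (DL _ DPq)).
rewrite PqE// (L2dot_conj (DL _ DPg) (DL _ Dq)) -qE// BE// Pg0.
by rewrite -(L2dot_conj (K1L (PK _)) Lf).
Qed.

(** With corrections r1 f(0) and r2 g(0), the difference is <A r1 f(0), T2 g> + <A T f, r2 g(0)>.
    Moving T2 and T back to the shifts gives <S2 A r1 f(0), g> and <f, S1 s>, where s is the adjoint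
    of A at r2 g(0) and S1 is the compressed shift. *)
Lemma split_form_shift_adjoint (T1 T2 S2 : E -> E) (Delta1 Delta2 : 'End(H)) :
  (forall k, K2 k -> K2 (S2 k)) ->
  (forall f, K1 f -> K1 (T1 f) /\
     T1 f =T bshift f + cokernel Theta1 (Delta1 (fourier f 0))) ->
  (forall g, K2 g -> [/\ K2 (T2 g), forall k, K2 k -> ip (S2 k) g = ip k (T2 g)
     & T2 g =T bshift g + cokernel Theta2 (Delta2 (fourier g 0))]) ->
  split_form dot K1 K2 (fun f g =>
    ip (A (T1 f)) (T2 g) - ip (A (bshift f)) (bshift g)).
Proof.
move=> S2K T1P T2P.
pose r1 x := cokernel Theta1 (Delta1 x); pose r2 x := cokernel Theta2 (Delta2 x).
have r1L b x y : r1 (b *: x + y) = b *: r1 x + r1 y.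
  by rewrite /r1 linearP cokernel_linear.
have r2L b x y : r2 (b *: x + y) = b *: r2 x + r2 y.
  by rewrite /r2 linearP cokernel_linear.
have Kr1 x : K1 (r1 x) by exact: cokernel_model.
have Kr2 x : K2 (r2 x) by exact: cokernel_model.
have /choice[s sP] y : exists h, K1 h /\ forall f, K1 f -> ip (A f) (r2 y) = ip f h.
  by have [h Kh hE] := bounded_op_representer (K2L (Kr2 y)); exists h.
have S1P y : K1 (compressed_shift dot Theta1 (s y)) /\ forall f, K1 f ->
    ip (compressed_shift dot Theta1 (s y)) f = ip (r2 y) (A (bshift f)).
  have [Ks sE] := sP y; have [KS SE] := compressed_shift_model inner1 Ks.
  split=> // f Kf; have Kb := bshift_model inner1 Kf.
  rewrite SE// (L2dot_conj (K1L Kb) (K1L Ks)) -sE//.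
  by rewrite -(L2dot_conj (K2L (AK Kb)) (K2L (Kr2 y))).
have sl : split_form dot K1 K2 (fun f g => ip (S2 (A (r1 (fourier f 0)))) g).
  apply: (split_form_l sK1 K1L sK2 K2L (beta := fun x => S2 (A (r1 x)))).
    by move=> x; exact/S2K/AK.
  move=> g Kg b x y; have [KT TE _] := T2P g Kg.
  have SE w : ip (S2 (A (r1 w))) g = ip (A (r1 w)) (T2 g).
    by apply: TE; exact/AK/Kr1.
  transitivity (ip (A (r1 (b *: x + y))) (T2 g)); first exact: SE.
  rewrite (SE x) (SE y) r1L.
  exact: (linear_op_ip sK1 K2L linA (K2L KT) b (Kr1 x) (Kr1 y)).
have sr : split_form dot K1 K2
    (fun f g => ip f (compressed_shift dot Theta1 (s (fourier g 0)))).
  apply: (split_form_r sK1 K1L sK2 K2L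
    (beta := fun y => compressed_shift dot Theta1 (s y))).
    by move=> y; have [] := S1P y.
  move=> f Kf b x y; have S1E w := proj2 (S1P w) f Kf.
  transitivity (ip (r2 (b *: x + y)) (A (bshift f))); first exact: S1E.
  rewrite (S1E x) (S1E y) r2L.
  have LAb := K2L (AK (bshift_model inner1 Kf)).
  exact: (L2dot_linear b (K2L (Kr2 x)) (K2L (Kr2 y)) LAb).
apply: split_form_ext (split_formD sK1 K1L sK2 K2L sl sr) => f g Kf Kg.
have [KT1 T1E] := T1P f Kf; have [KT2 T2E T2ae] := T2P g Kg.
have Kb1 := bshift_model inner1 Kf; have Kb2 := bshift_model inner2 Kg.
rewrite T2E; last exact/AK.
have [KS SE] := S1P (fourier g 0).
rewrite (L2dot_conj (K1L KS) (K1L Kf)) SE//.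
rewrite -(L2dot_conj (K2L (Kr2 _)) (K2L (AK Kb1))).
have Kbr : K1 (1 *: bshift f + r1 (fourier f 0)) by apply: (proj2 sK1).
have -> : ip (A (T1 f)) (T2 g) = ip (A (1 *: bshift f + r1 (fourier f 0))) (T2 g).
  apply: (linear_op_ip_ae K2L linA (K2L KT2) KT1 Kbr).
  by rewrite scale1r; exact: T1E.
rewrite (linear_op_ip sK1 K2L linA (K2L KT2))// mul1r.
have -> : ip (A (bshift f)) (T2 g) = ip (A (bshift f)) (bshift g + r2 (fourier g 0)).
  apply: (L2dot_ae_r (K2L (AK Kb1)) (K2L KT2) _ T2ae).
  exact: (K2L (subspaceD sK2 Kb2 (Kr2 _))).
rewrite (ipDr hP (K2L Kb2) (K2L (Kr2 _)) (K2L (AK Kb1))).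
by rewrite [RHS]addrAC [X in X - _]addrC addrK addrC.
Qed.

(** Testing against g in [K2] turns the equation into the form identity. B and Psi correspond by B k
    = Psi k(0), since the projection on the defect space keeps the value at 0; likewise B' and
    Psi'. *)
Lemma split_form_equation (T1 T2 S2 : E -> E) :
  (forall f, K1 f -> K1 (T1 f)) -> (forall k, K2 k -> K2 (S2 k)) ->
  (forall g k, K2 g -> K2 k -> ip (S2 k) g = ip k (T2 g)) ->
  split_form dot K1 K2 (fun f g => ip (A f) g - ip (A (T1 f)) (T2 g)) <->
  exists B B' : E -> E,
    [/\ bounded_op dot D1 K2 B, bounded_op dot D2 K1 B'
      & forall f, K1 f ->
          (A f - S2 (A (T1 f))) =T
          (B (orthoproj dot D1 f) + orthoproj dot D2 (adjoint dot D2 B' f))].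
Proof.
move=> T1K S2K TE.
have KS f : K1 f -> K2 (S2 (A (T1 f))) by move=> Kf; exact/S2K/AK/T1K.
have lhsE f g : K1 f -> K2 g ->
    ip (A f - S2 (A (T1 f))) g = ip (A f) g - ip (A (T1 f)) (T2 g).
  move=> Kf Kg; rewrite -(TE g (A (T1 f)) Kg (AK (T1K f Kf))).
  exact: (ipBl hP (K2L (AK Kf)) (K2L (KS _ Kf)) (K2L Kg)).
have lhsK f : K1 f -> K2 (A f - S2 (A (T1 f))).
  by move=> Kf; apply: (subspaceB sK2); [exact: AK|exact: KS].
have rhs B B' (Psi Psi' : R[i] -> 'End(H)) :
    linear_op D1 K2 B ->
    (forall x, K2 (fun z => Psi z x)) ->
    (forall k g, D1 k -> K2 g -> ip (B k) g = ip (fun z => Psi z (fourier k 0)) g) ->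
    (forall y, K1 (fun z => Psi' z y)) ->
    (forall k f, D2 k -> K1 f -> ip (B' k) f = ip (fun z => Psi' z (fourier k 0)) f) ->
    forall f g, K1 f -> K2 g ->
      K2 (B (orthoproj dot D1 f) + orthoproj dot D2 (adjoint dot D2 B' f)) /\
      ip (B (orthoproj dot D1 f) + orthoproj dot D2 (adjoint dot D2 B' f)) g =
      ip (fun z => Psi z (fourier f 0)) g + ip f (fun z => Psi' z (fourier g 0)).
  move=> [BK _ _] PK BE PK' BE' f g Kf Kg.
  have [DP P0 _] := defect_proj inner1 pure1 Kf.
  have [Kq qE] := defect_adjoint PK' BE' Kf Kg.
  have KB := BK _ DP.
  split; first exact: (subspaceD sK2).
  by rewrite (ipDl hP (K2L KB) (K2L Kq) (K2L Kg)) BE// P0 qE.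
split=> [[Psi [Psi' [PK PK' cE]]]|[B [B' [[linB _] [linB' _] BE]]]].
  have bB := operator_family_bounded Theta1 K2L PK.
  have bB' := operator_family_bounded Theta2 K1L PK'.
  exists (fun k z => Psi z (fourier k 0)), (fun k z => Psi' z (fourier k 0)).
  split; [exact: bB|exact: bB'|move=> f Kf].
  have rhsf := rhs _ _ Psi Psi' (proj1 bB) PK (fun _ _ _ _ => erefl) PK'
    (fun _ _ _ _ => erefl) f.
  apply: (model_eq inner2); [exact: lhsK|by have [] := rhsf 0 Kf (proj1 sK2)|].
  move=> g Kg; have [_ ->] := rhsf g Kf Kg.
  by rewrite lhsE// cE.
have [Psi [PK PE]] := defect_operator_family inner1 pure1 sK2 K2L linB.
have [Psi' [PK' PE']] := defect_operator_family inner2 pure2 sK1 K1L linB'.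
exists Psi, Psi'; split=> // f g Kf Kg.
have [KR <-] := rhs B B' Psi Psi' linB PK PE PK' PE' f g Kf Kg.
rewrite -lhsE//; apply: (L2dot_ae_l _ _ (K2L Kg) (BE f Kf)); apply: K2L => //.
exact: lhsK.
Qed.

Local Notation T1 := (adjoint dot K1 (modified_shift dot Theta1 X1)).
Local Notation T2 := (adjoint dot K2 (modified_shift dot Theta2 X2)).
Local Notation S2 := (modified_shift dot Theta2 X2).

Lemma modified_shift_equation :
  split_form dot K1 K2 (fun f g => ip (A f) g - ip (A (bshift f)) (bshift g)) <->
  exists B B' : E -> E,
    [/\ bounded_op dot D1 K2 B, bounded_op dot D2 K1 B'
      & forall f, K1 f ->
          (A f - S2 (A (T1 f))) =T
          (B (orthoproj dot D1 f) + orthoproj dot D2 (adjoint dot D2 B' f))].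
Proof.
have [Delta1 T1P] := modified_shift_adjoint inner1 pure1 linX1.
have [Delta2 T2P] := modified_shift_adjoint inner2 pure2 linX2.
have S2K := modified_shift_model inner2 pure2 linX2.
have T1K f : K1 f -> K1 (T1 f) by move=> Kf; have [] := T1P f Kf.
have TE g k : K2 g -> K2 k -> ip (S2 k) g = ip k (T2 g).
  by move=> Kg Kk; have [_ /(_ k Kk)] := T2P g Kg.
have sd : split_form dot K1 K2 (fun f g =>
    ip (A (T1 f)) (T2 g) - ip (A (bshift f)) (bshift g)).
  apply: (split_form_shift_adjoint (Delta1 := Delta1) S2K _ T2P) => f Kf.
  by have [KT _ TE1] := T1P f Kf.
apply: (iff_trans _ (split_form_equation T1K S2K TE)); split=> sc.
  apply: split_form_ext (split_formB sK1 K1L sK2 K2L sc sd) => f g _ _.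
  by rewrite opprB addrA subrK.
apply: split_form_ext (split_formD sK1 K1L sK2 K2L sc sd) => f g _ _.
by rewrite addrA subrK.
Qed.

End BoundedOperators.

(** * Truncated Toeplitz operators *)

Section IteratedShift.
Context {R : realType} {H : vectType R[i]}.
Variable dot : {dot H for @Num.conj R[i]}.
Local Notation ip := (L2dot dot).
Implicit Types (f g : R[i] -> H) (x y : H).

Let hP := L2_hilbert dot.

Lemma partial_sumS f n :
  partial_sum f n.+1 = partial_sum f n + monomial n%:Z (fourier f n%:Z).
Proof. by rewrite /partial_sum big_ord_recr. Qed.

Lemma ip_partial_sum_next f n y : L2 dot f ->
  ip (f - partial_sum f n) (monomial n%:Z y) = dot (fourier f n%:Z) y.
Proof.
move=> Lf; have Lm x := L2_monomial dot n%:Z x; have Ls k := L2_partial_sum dot f k.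
have := partial_sum_monomial y Lf (ltnSn n).
rewrite (ipBl hP Lf (Ls n.+1) (Lm y)) partial_sumS.
rewrite (ipDl hP (Ls n) (Lm _) (Lm y)) L2dot_monomial eqxx mul1r.
by rewrite (ipBl hP Lf (Ls n) (Lm y)) opprD addrA => /eqP; rewrite subr_eq0 => /eqP.
Qed.

(** The constant removed at step n is the n-th coefficient of f, that is, the next Taylor term; this
    is why both claims are proved together. *)
Lemma iter_bshift f n : L2 dot f ->
  (forall t, iter n bshift f (circle_pt t) =
    circle_pt t ^ (- n%:Z) *: (f (circle_pt t) - partial_sum f n (circle_pt t))) /\
  fourier (iter n bshift f) 0 = fourier f n%:Z.
Proof.
move=> Lf; pose r n z := z ^ (- n%:Z) *: (f z - partial_sum f n z).
have Lr k : L2 dot (r k).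
  by apply: L2_exprz; exact: (subspaceB (L2_subspace dot) Lf (L2_partial_sum dot f k)).
have r0 k : fourier (r k) 0 = fourier f k%:Z.
  apply: (@dot_ext _ _ dot) => y; rewrite fourier_dot//.
  rewrite /r L2dot_shift_monomial sub0r opprK.
  exact: (ip_partial_sum_next k y Lf).
suff rE : forall t, iter n bshift f (circle_pt t) = r n (circle_pt t).
  split=> //; rewrite -r0; apply: (@dot_ext _ _ dot) => y.
  have Lb : L2 dot (iter n bshift f).
    by elim: n {rE} => [|n IH] //=; exact/L2_exprz/L2_center.
  by rewrite !fourier_dot//; apply: L2dot_ext.
elim: n => [t|n IH t]; first by rewrite /r /partial_sum big_ord0 oppr0 expr0z scale1r subr0.
have Lb : L2 dot (iter n bshift f).
  by elim: n {IH} => [|n IH] //=; exact/L2_exprz/L2_center.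
have b0 : fourier (iter n bshift f) 0 = fourier f n%:Z.
  rewrite -r0; apply: (@dot_ext _ _ dot) => y.
  by rewrite !fourier_dot//; apply: L2dot_ext.
rewrite iterS /bshift b0 IH /r partial_sumS.
set z := circle_pt t.
have -> : (partial_sum f n + monomial n%:Z (fourier f n%:Z)) z =
    partial_sum f n z + z ^ n%:Z *: fourier f n%:Z by [].
have z0 : z != 0 by exact: circle_pt_neq0.
rewrite opprD addrA -[in RHS]addn1 PoszD opprD expfzDr// mulrC -scalerA; congr (_ *: _).
by rewrite [RHS]scalerBr scalerA -expfzDr// addNr expr0z scale1r.
Qed.

End IteratedShift.

(** * Symbols and the shift equation *)

Section Toeplitz.
Context {R : realType} {H : vectType R[i]}.
Variable dot : {dot H for @Num.conj R[i]}.
Variables Theta1 Theta2 : R[i] -> 'End(H).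
Hypotheses (inner1 : inner dot Theta1) (inner2 : inner dot Theta2).
Variable A : (R[i] -> H) -> (R[i] -> H).
Local Notation E := (R[i] -> H).
Local Notation ip := (L2dot dot).
Local Notation K1 := (model dot Theta1).
Local Notation K2 := (model dot Theta2).
Hypothesis bndA : bounded_op dot K1 K2 A.
Implicit Types (f g h k : R[i] -> H) (x y : H) (F : R[i] -> 'End(H)).

Let hP := L2_hilbert dot.
Let sL := L2_subspace dot.
Let K1L f : K1 f -> L2 dot f. Proof. exact: model_L2. Qed.
Let K2L f : K2 f -> L2 dot f. Proof. exact: model_L2. Qed.
Let linA : linear_op K1 K2 A. Proof. by case: bndA. Qed.
Let AK f : K1 f -> K2 (A f). Proof. by case: linA => AK _ _; exact: AK. Qed.
Let Lc x : L2 dot (fun=> x). Proof. exact: L2_cst. Qed.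

Lemma L2_apply_ess F f : L2 (hs_dot dot) F -> L2 dot f -> ess_bounded dot f ->
  L2 dot (fun z => F z (f z)).
Proof. by move=> LF [mf _] [C fC]; exact: L2_apply_bounded fC. Qed.

Lemma model_inftyP Theta f : model_infty dot Theta f ->
  model dot Theta f /\ ess_bounded dot f.
Proof. by move=> [Kf /HinftyP[_ bf]]. Qed.

Lemma bshift_model_infty Theta f : inner dot Theta ->
  model_infty dot Theta f -> model_infty dot Theta (bshift f).
Proof.
move=> innerT [Kf /HinftyP[Hf bf]]; split; first exact: bshift_model.
by apply/HinftyP; split; [exact: bshift_H2|exact: bshift_bounded].
Qed.

(* Multiplication by a symbol commutes with the shift; what the constant terms
   of [f] and [g] contribute is left. *)
Lemma toeplitz_shift F f g : L2 (hs_dot dot) F -> L2 dot f -> ess_bounded dot f ->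
  L2 dot g ->
  ip (fun z => F z (f z)) g - ip (fun z => F z (bshift f z)) (bshift g) =
  ip (fun z => F z (fourier f 0)) g +
  ip f ((fun z => adj dot (F z) (fourier g 0)) -
        (fun=> fourier (fun z => adj dot (F z) (fourier g 0)) 0)).
Proof.
move=> LF Lf bf Lg; set f0 := fourier f 0; set g0 := fourier g 0.
have LFf := L2_apply_ess LF Lf bf; have LFc x := L2_apply_cst x LF.
have LFa x := L2_apply_cst x (L2_hs_adj LF).
have LFd := subspaceB sL LFf (LFc f0); have Lg' := subspaceB sL Lg (Lc g0).
(* The factors z^-1 of the two backward shifts cancel in the pairing on the circle. *)
have -> : ip (fun z => F z (bshift f z)) (bshift g) =
    ip ((fun z => F z (f z)) - (fun z => F z f0)) (g - (fun=> g0)).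
  rewrite -[RHS](L2dot_shift2 dot (- 1)); apply: L2dot_ext => // t.
  by rewrite /bshift linearZ linearB.
rewrite (ipBr hP Lg (Lc g0) LFd) (ipBl hP LFf (LFc f0) Lg).
rewrite (ipBl hP LFf (LFc f0) (Lc g0)) (ipBr hP (LFa g0) (Lc _) Lf).
rewrite (L2dot_adj dot F f (fun=> g0)) (L2dot_adj dot F (fun=> f0) (fun=> g0)).
(* <F f0, g0> sees only the constant term of adj F g0, and against that constant f0 may be replaced
   by f; hence the constant subtracted in the statement. *)
rewrite (L2dot_conj (LFa g0) (Lc f0)) (ip_cst f0 (LFa g0)) -dot_conj -(ip_cst _ Lf).
have aux (a b c : R[i]) : a - (a - b - c) = b + c.
  by rewrite !opprB addrCA [a + _]addrC subrK addrC.
exact: aux.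
Qed.

(** The columns of a symbol need not lie in the model space, but pairings with that space see only
    their projections. *)
Lemma projected_family Theta (beta : H -> E) : inner dot Theta ->
  (forall x, L2 dot (beta x)) ->
  (forall b x y, beta (b *: x + y) = b *: beta x + beta y) ->
  exists Psi : R[i] -> 'End(H), (forall x, model dot Theta (fun z => Psi z x)) /\
    forall x g, model dot Theta g -> ip (fun z => Psi z x) g = ip (beta x) g.
Proof.
move=> innerT Lb bL; pose K := model dot Theta.
have PK x := proj1 (model_proj innerT (Lb x)).
have PE x g : K g -> ip (orthoproj dot K (beta x)) g = ip (beta x) g.
  by move=> Kg; have [_ pE] := model_proj innerT (Lb x); exact: pE.
have [|Psi [PsiK PsiE]] := operator_family (model_subspace innerT)
    (fun f Kf => model_L2 Kf) PK.
  move=> g Kg b x y; transitivity (ip (beta (b *: x + y)) g); first exact: PE.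
  rewrite bL; transitivity (b * ip (beta x) g + ip (beta y) g).
    exact: (L2dot_linear b (Lb x) (Lb y) (model_L2 Kg)).
  by congr (_ * _ + _); exact/esym/PE.
exists Psi; split=> // x g Kg.
by transitivity (ip (orthoproj dot K (beta x)) g); [exact: PsiE|exact: PE].
Qed.

(** For bounded f the symbol may be inserted, and [toeplitz_shift] with columns projected on the
    model spaces gives the identity. To reach every f in [K1], the difference of the sides is
    written as a pairing of f with a fixed L^2 function and [model_infty_test] applies. *)
Lemma MT_split_form : MT dot Theta1 Theta2 A ->
  split_form dot K1 K2 (fun f g => ip (A f) g - ip (A (bshift f)) (bshift g)).
Proof.
move=> [_ [Phi [LPhi APhi]]].
have LPa := L2_hs_adj LPhi.
have LPf f : model_infty dot Theta1 f -> L2 dot (fun z => Phi z (f z)).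
  by move=> /model_inftyP[Kf bf]; exact: (L2_apply_ess LPhi (K1L Kf) bf).
have aE f g : model_infty dot Theta1 f -> K2 g -> ip (A f) g = ip (fun z => Phi z (f z)) g.
  move=> mf Kg; have [Kf _] := mf; have [Kp pE] := model_proj inner2 (LPf f mf).
  rewrite -(pE g Kg).
  exact: (L2dot_ae_l (K2L (AK Kf)) (K2L Kp) (K2L Kg) (APhi f mf)).
have LPc x : L2 dot (fun z => Phi z x) := L2_apply_cst x LPhi.
have LPac y : L2 dot (fun z => adj dot (Phi z) y) := L2_apply_cst y LPa.
pose gam y : E := (fun z => adj dot (Phi z) y) -
  (fun=> fourier (fun z => adj dot (Phi z) y) 0).
have Lgam y : L2 dot (gam y) by exact: (subspaceB sL).
have gamL b x y : gam (b *: x + y) = b *: gam x + gam y.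
  have E1 : (fun z => adj dot (Phi z) (b *: x + y)) =
      b *: (fun z => adj dot (Phi z) x) + (fun z => adj dot (Phi z) y).
    by apply/funext => z; rewrite linearP.
  rewrite /gam E1 (fourier0_linear b (LPac x) (LPac y)); apply/funext => z.
  rewrite /GRing.add /GRing.opp/= /GRing.scale/=.
  by rewrite scalerBr opprD addrACA.
have LPl b x y : (fun z => Phi z (b *: x + y)) =
    b *: (fun z => Phi z x) + (fun z => Phi z y).
  by apply/funext => z; rewrite linearP.
have [Psi [PK PE]] := projected_family inner2 LPc LPl.
have [Psi' [PK' PE']] := projected_family inner1 Lgam gamL.
exists Psi, Psi'; split=> // f g Kf Kg.
have Lg := K2L Kg; have Kbg := bshift_model inner2 Kg.
have [h1 Kh1 h1E] := bounded_op_representer inner1 bndA Lg.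
have [h2 Kh2 h2E] := bounded_op_representer inner1 bndA (K2L Kbg).
have [w wE] : exists w, forall x, ip (fun z => Psi z x) g = dot x w.
  apply: functional_dot => b u v; rewrite -(L2dot_linear b (K2L (PK u)) (K2L (PK v)) Lg).
  by apply: L2dot_ext => // t; rewrite linearP.
have Lzh2 : L2 dot (fun z => z *: h2 z) := L2_exprz 1 (K1L Kh2).
have Lq := K1L (PK' (fourier g 0)); set q := (fun z => Psi' z (fourier g 0)) in Lq *.
have L1 := subspaceB sL (K1L Kh1) Lzh2.
have L2' := subspaceB sL L1 (Lc w).
have L3 := subspaceB sL L2' Lq.
(* [h1] and [h2] are the adjoint of A at g and at T g. The term <A T k, T g> = <T k, h2> becomes <k,
   z h2>, and <Psi k(0), g> = <k(0), w> is the pairing of k with the constant w. *)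
have diffE k : K1 k -> ip k (h1 - (fun z => z *: h2 z) - (fun=> w) - q) =
    ip (A k) g - ip (A (bshift k)) (bshift g) -
    (ip (fun z => Psi z (fourier k 0)) g + ip k q).
  move=> Kk; have Lk := K1L Kk; have Kbk := bshift_model inner1 Kk.
  rewrite (ipBr hP L2' Lq Lk) (ipBr hP L1 (Lc w) Lk) (ipBr hP (K1L Kh1) Lzh2 Lk).
  rewrite (ip_cst w Lk) -wE -(h1E k Kk) (h2E _ Kbk).
  rewrite (L2dot_conj (K1L Kh2) (K1L Kbk)) -(ip_bshift (model_H2 Kh2) Lk).
  by rewrite -(L2dot_conj Lzh2 Lk) opprD addrA.
apply/eqP; rewrite -subr_eq0 -(diffE f Kf); apply/eqP.
apply: (model_infty_test inner1 L3) => // {Kf} {}f mf.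
have [Kf bf] := model_inftyP mf; have Lf := K1L Kf.
rewrite (diffE f Kf) (aE f g mf Kg) (aE _ _ (bshift_model_infty inner1 mf) Kbg).
rewrite (toeplitz_shift LPhi Lf bf Lg) (PE _ g Kg) /q.
rewrite (L2dot_conj (K1L (PK' _)) Lf) (PE' _ f Kf) -(L2dot_conj (Lgam _) Lf).
by rewrite subrr.
Qed.

(** At T^n f and T^n g the equation adds one term: <Psi c, T^n g> = <z^n Psi c, g>, because z^n Psi
    c is orthogonal to s_n g; here c is the n-th coefficient of f. The other term is symmetric. *)
Lemma split_form_telescope (Psi Psi' : R[i] -> 'End(H)) f g :
  (forall x, K2 (fun z => Psi z x)) -> (forall y, K1 (fun z => Psi' z y)) ->
  (forall f g, K1 f -> K2 g -> ip (A f) g - ip (A (bshift f)) (bshift g) =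
     ip (fun z => Psi z (fourier f 0)) g + ip f (fun z => Psi' z (fourier g 0))) ->
  K1 f -> K2 g -> forall n, ip (A f) g =
    ip (A (iter n bshift f)) (iter n bshift g) +
    (ip (fun z => Psi z (partial_sum f n z)) g +
     ip f (fun z => Psi' z (partial_sum g n z))).
Proof.
move=> PK PK' cE Kf Kg; have Lf := K1L Kf; have Lg := K2L Kg.
have LP : L2 (hs_dot dot) Psi by apply: L2_hs_intro => x; exact: K2L.
have LP' : L2 (hs_dot dot) Psi' by apply: L2_hs_intro => x; exact: K1L.
have Kfn n : K1 (iter n bshift f) by elim: n => [|n IH] //=; exact: bshift_model.
have Kgn n : K2 (iter n bshift g) by elim: n => [|n IH] //=; exact: bshift_model.
have shifted (F : R[i] -> 'End(H)) k n x : H2 dot (fun z => F z x) -> L2 dot k ->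
    ip (fun z => F z x) (iter n bshift k) = ip (fun z => F z (monomial n%:Z x z)) k.
  move=> HF Lk; have LF := H2_L2 HF; have Ls := L2_partial_sum dot k n.
  transitivity (ip (fun z => F z x) (fun z => z ^ (- n%:Z) *: (k - partial_sum k n) z)).
    by apply: L2dot_ext => // t; have [-> _] := iter_bshift n Lk.
  rewrite -L2dot_shift.
  have LzF : L2 dot (fun z => z ^ n%:Z *: F z x) by exact: L2_exprz.
  rewrite (ipBr hP Lk Ls LzF).
  have -> : ip (fun z => z ^ n%:Z *: F z x) (partial_sum k n) = 0.
    rewrite /partial_sum (ip_sumr hP)//; last by move=> i _; exact: L2_monomial.
    rewrite big1// => i _; rewrite L2dot_shift_monomial.
    by rewrite H2_monomial_eq0// subr_lt0 ltz_nat.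
  by rewrite subr0; apply: L2dot_ext => // t; rewrite /monomial linearZ.
elim=> [|n IH].
  have E0 (F : R[i] -> 'End(H)) k : (fun z => F z (partial_sum k 0 z)) = 0.
    by apply/funext => z; rewrite /partial_sum big_ord0 linear0.
  by rewrite !E0 (ip0l hP Lg) (ip0r hP Lf) !addr0.
have cn := cE _ _ (Kfn n) (Kgn n).
have [_ f0] := iter_bshift n Lf; have [_ g0] := iter_bshift n Lg.
rewrite f0 g0 (shifted _ _ _ _ (model_H2 (PK _)) Lg) in cn.
rewrite (L2dot_conj (K1L (PK' _)) (K1L (Kfn n))) in cn.
rewrite (shifted _ _ _ _ (model_H2 (PK' _)) Lf) in cn.
have La (F : R[i] -> 'End(H)) k : L2 (hs_dot dot) F ->
    L2 dot (fun z => F z (partial_sum k n z)).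
  move=> LF; apply: (L2_apply_ess LF); first exact: L2_partial_sum.
  exact: ess_bounded_partial_sum.
have Lm (F : R[i] -> 'End(H)) x : L2 (hs_dot dot) F ->
    L2 dot (fun z => F z (monomial n%:Z x z)).
  by move=> LF; apply: (L2_apply_ess LF); [exact: L2_monomial|exact: ess_bounded_monomial].
rewrite -(L2dot_conj (Lm _ _ LP') Lf) in cn.
have ES (F : R[i] -> 'End(H)) k : (fun z => F z (partial_sum k n.+1 z)) =
    (fun z => F z (partial_sum k n z)) + (fun z => F z (monomial n%:Z (fourier k n%:Z) z)).
  by apply/funext => z; rewrite partial_sumS linearD.
rewrite !ES (ipDl hP (La _ _ LP) (Lm _ _ LP) Lg) (ipDr hP (La _ _ LP') (Lm _ _ LP') Lf).
rewrite IH; move/eqP: cn; rewrite subr_eq => /eqP ->; rewrite !iterS.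
have aux (a b c d e : R[i]) : a + b + c + (d + e) = c + (d + a + (e + b)) by ring.
exact: aux.
Qed.

(** Boundedness of f and g places adj Psi g and adj Psi' f in L^2, so <Psi s_n f, g> and <f, Psi'
    s_n g> converge by continuity of the pairing. *)
Lemma split_form_MT :
  split_form dot K1 K2 (fun f g => ip (A f) g - ip (A (bshift f)) (bshift g)) ->
  MT dot Theta1 Theta2 A.
Proof.
move=> [Psi [Psi' [PK PK' cE]]]; split=> //.
have LP : L2 (hs_dot dot) Psi by apply: L2_hs_intro => x; exact: K2L.
have LP' : L2 (hs_dot dot) Psi' by apply: L2_hs_intro => x; exact: K1L.
have LPa' := L2_hs_adj LP'; have LPa := L2_hs_adj LP.
pose Phi z := Psi z + adj dot (Psi' z).
have LPhi : L2 (hs_dot dot) Phi by exact: L2_hsD.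
have [_ [M MA]] := bndA.
pose N f := complex.Re (ip f f).
have N0 f : L2 dot f -> 0 <= N f by exact: (hilbert_ge0 hP).
have AM f : K1 f -> N (A f) <= M ^+ 2 * N f.
  move=> Kf; have Mf := MA f Kf.
  rewrite /N -!L2norm_sqr -exprMn ler_sqr// nnegrE ?sqrtr_ge0//.
  by apply: le_trans Mf; exact: sqrtr_ge0.
have aE f g : model_infty dot Theta1 f -> model_infty dot Theta2 g ->
    ip (A f) g = ip (fun z => Phi z (f z)) g.
  move=> /model_inftyP[Kf bf] /model_inftyP[Kg bg].
  have Lf := K1L Kf; have Lg := K2L Kg.
  pose p z := adj dot (Psi z) (g z); pose q z := adj dot (Psi' z) (f z).
  have Lp : L2 dot p by exact: (L2_apply_ess LPa Lg bg).
  have Lq : L2 dot q by exact: (L2_apply_ess LPa' Lf bf).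
  pose df n := f - partial_sum f n; pose dg n := g - partial_sum g n.
  have Ldf n : L2 dot (df n) by exact: (subspaceB sL Lf (L2_partial_sum dot f n)).
  have Ldg n : L2 dot (dg n) by exact: (subspaceB sL Lg (L2_partial_sum dot g n)).
  have Kfn n : K1 (iter n bshift f) by elim: n => [|n IH] //=; exact: bshift_model.
  have Kgn n : K2 (iter n bshift g) by elim: n => [|n IH] //=; exact: bshift_model.
  pose a n := ip (A (iter n bshift f)) (iter n bshift g).
  have eE n : ip (A f) g - ip (fun z => Phi z (f z)) g = a n - (ip (df n) p + ip q (dg n)).
    have PhiE : ip (fun z => Phi z (f z)) g = ip f p + ip q g.
      have LPf := L2_apply_ess LP Lf bf.
      rewrite -(L2dot_adj dot Psi f g) -(ipDl hP LPf Lq Lg).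
      by apply: L2dot_ext => // t; rewrite add_lfunE.
    rewrite (split_form_telescope PK PK' cE Kf Kg n) PhiE.
    rewrite (L2dot_adj dot Psi (partial_sum f n) g).
    have -> : ip f (fun z => Psi' z (partial_sum g n z)) = ip q (partial_sum g n).
      rewrite (L2dot_adj dot (fun z => adj dot (Psi' z)) f); apply: L2dot_ext => // t.
      by rewrite adjK.
    rewrite (ipBl hP Lf (L2_partial_sum dot f n) Lp).
    rewrite (ipBr hP Lg (L2_partial_sum dot g n) Lq).
    rewrite -/(a n) -addrA; congr (_ + _).
    have aux (b c d e : R[i]) : b + c - (d + e) = - ((d - b) + (e - c)) by ring.
    exact: aux.
  set e := _ - _ in eE.
  suff : e = 0 by move/eqP; rewrite subr_eq0 => /eqP.
  (* Each of the three terms of the error is bounded by Cauchy-Schwarz, the first also by the bound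
     M of A; the 3 comes from |r - s - t|^2 <= 3 (|r|^2 + |s|^2 + |t|^2). *)
  pose u n := 3 * (M ^+ 2 * N (df n) * N (dg n) + N (df n) * N p + N q * N (dg n)).
  have eu n : complex.Re e ^+ 2 + complex.Im e ^+ 2 <= u n.
    have Nit k m : L2 dot k -> N (iter m bshift k) = N (k - partial_sum k m).
      move=> Lk; rewrite /N -(L2dot_shift2 dot (- m%:Z) (k - partial_sum k m)).
      by congr complex.Re; apply: L2dot_ext => t; have [-> _] := iter_bshift m Lk.
    have C1 := Cauchy_SchwarzC hP (K2L (AK (Kfn n))) (K2L (Kgn n)).
    have C2 : complex.Re (ip (df n) p) ^+ 2 + complex.Im (ip (df n) p) ^+ 2 <=
        N (df n) * N p by exact: (Cauchy_SchwarzC hP (Ldf n) Lp).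
    have C3 : complex.Re (ip q (dg n)) ^+ 2 + complex.Im (ip q (dg n)) ^+ 2 <=
        N q * N (dg n) by exact: (Cauchy_SchwarzC hP Lq (Ldg n)).
    have C4 := ler_wpM2r (N0 _ (K2L (Kgn n))) (AM _ (Kfn n)).
    rewrite !Nit// -/(df n) -/(dg n) in C4.
    rewrite -/(a n) -/(N _) -/(N (iter n bshift g)) !Nit// -/(dg n) in C1.
    rewrite (eE n) /u !(ReCD, ReCN, ImCD, ImCN).
    move: (le_trans C1 C4) C2 C3; clear.
    move: (complex.Re (a n)) (complex.Im (a n)) => a1 a2.
    move: (complex.Re (ip (df n) p)) (complex.Im (ip (df n) p)) => b1 b2.
    move: (complex.Re (ip q (dg n))) (complex.Im (ip q (dg n))) => c1 c2.
    move: (M ^+ 2 * N (df n) * N (dg n)) (N (df n) * N p) (N q * N (dg n)) => x y z.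
    move=> Hx Hy Hz.
    have sq (r s t : R) : (r - (s + t)) ^+ 2 <= 3 * (r ^+ 2 + s ^+ 2 + t ^+ 2).
      rewrite -subr_ge0.
      have -> : 3 * (r ^+ 2 + s ^+ 2 + t ^+ 2) - (r - (s + t)) ^+ 2 =
        (r + s) ^+ 2 + (r + t) ^+ 2 + (s - t) ^+ 2 by ring.
      by rewrite !addr_ge0 ?sqr_ge0.
    have := sq a1 b1 c1; have := sq a2 b2 c2; lra.
  have Fc : N (df n) @[n --> \oo] --> (0 : R) := partial_sum_cvg (model_H2 Kf).
  have Gc : N (dg n) @[n --> \oo] --> (0 : R) := partial_sum_cvg (model_H2 Kg).
  have uc : u n @[n --> \oo] --> (0 : R).
    exact: (cvg0_combination _ _ _ Fc Gc).
  have e0 := cvg0_bound uc eu.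
  exact: complex_sqr_le0.
exists Phi; split=> // f mf; have [Kf bf] := model_inftyP mf.
have LPf := L2_apply_ess LPhi (K1L Kf) bf; have LA := K2L (AK Kf).
have [Kp pE] := model_proj inner2 LPf.
apply: (model_eq inner2 (AK Kf) Kp) => g Kg; have Lg := K2L Kg.
rewrite pE//; apply/eqP; rewrite -subr_eq0 -(ipBl hP LA LPf Lg); apply/eqP.
have Ld := subspaceB sL LA LPf.
apply: (ip_conj0 Lg Ld).
(* Here f stays bounded, as in the definition of [MT]; only g is extended from bounded functions to
   all of [K2]. *)
apply: (model_infty_test inner2 Ld) => // {Kg Lg} {}g mg.
have [Kg bg] := model_inftyP mg; have Lg := K2L Kg.
apply: (ip_conj0 Ld Lg).
by rewrite (ipBl hP LA LPf Lg) (aE f g mf mg) subrr.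
Qed.

End Toeplitz.

Theorem theorem7p1 (R : realType) (H : vectType R[i])
    (dot : {dot H for @Num.conj R[i]})
    (Theta1 Theta2 : R[i] -> 'End(H))
    (inner1 : inner dot Theta1) (pure1 : pure dot Theta1)
    (inner2 : inner dot Theta2) (pure2 : pure dot Theta2)
    (X1 X2 : (R[i] -> H) -> (R[i] -> H))
    (linX1 : linear_op (codefect dot Theta1) (defect dot Theta1) X1)
    (linX2 : linear_op (codefect dot Theta2) (defect dot Theta2) X2)
    (A : (R[i] -> H) -> (R[i] -> H))
    (bndA : bounded_op dot (model dot Theta1) (model dot Theta2) A) :
  MT dot Theta1 Theta2 A <->
  exists B B' : (R[i] -> H) -> (R[i] -> H),
    [/\ bounded_op dot (defect dot Theta1) (model dot Theta2) B,
        bounded_op dot (defect dot Theta2) (model dot Theta1) B'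
      & forall f, model dot Theta1 f ->
          (A f - modified_shift dot Theta2 X2
                   (A (adjoint dot (model dot Theta1)
                         (modified_shift dot Theta1 X1) f)))
          =T (B (orthoproj dot (defect dot Theta1) f)
              + orthoproj dot (defect dot Theta2)
                  (adjoint dot (defect dot Theta2) B' f))].
Proof.
have shiftE := modified_shift_equation inner1 pure1 inner2 pure2 linX1 linX2 bndA.
apply: (iff_trans _ shiftE); split.
  exact: (MT_split_form inner1 inner2 bndA).
exact: (split_form_MT inner1 inner2 bndA).
Qed.
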